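(* For any pattern $\pi\in\mathfrak{S}$, the following holds: - The function $t\in[0,1)\mapsto e_{\pi,t}$ is locally $\gamma$-Hölder-continuous, for every $\gamma\in(0,1)$. - The centered Gaussian process $t\in(0,1)\mapsto X_{\pi,t}$ with covariance function $H_\pi$ (defined in the context) admits a version that is locally $\gamma$-Hölder-continuous, for every $\gamma\in(0,\tfrac12)$.
   Context: $\mathbb{N}^*=\{1,2,\dots\}$, $[n]=\{1,\dots,n\}$, $\mathfrak{S}_n$ is the symmetric group on $[n]$, $\mathfrak{S}=\bigcup_{n\ge1}\mathfrak{S}_n$, $\mathfrak{S}_\infty$ is the set of bijections of $\mathbb{N}^*$, $|\sigma|=n$ for $\sigma\in\mathfrak{S}_n$. For $\tau\in\mathfrak{S}_n$ and $I=\{i_1<\dots<i_r\}\subseteq[n]$, $\mathrm{pat}(I,\tau)\in\mathfrak{S}_r$ is the permutation $\sigma$ with $\sigma(j)<\sigma(k)\iff\tau(i_j)<\tau(i_k)$; $\mathrm{Occ}(\pi,\tau)=|\{I\subseteq[n]:\mathrm{pat}(I,\tau)=\pi\}|$. Direct sums: $(\sigma\oplus\rho)(i)=\sigma(i)$ for $i\le\ell=|\sigma|$ and $(\sigma\oplus\rho)(\ell+i)=\ell+\rho(i)$ for $1\le i\le|\rho|$; infinite direct sums likewise. A permutation in $\mathfrak{S}$ that is not a direct sum of two non-empty permutations is a block. Every $\pi\in\mathfrak{S}$ is uniquely a direct sum of blocks $\pi=\pi_1\oplus\dots\oplus\pi_d$, and $d$ is its number of blocks. Right-inversion counts: for $\sigma\in\mathfrak{S}_n$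 or $\mathfrak{S}_\infty$, $r_i(\sigma)=|\{j>i:\sigma(j)<\sigma(i)\}|$. They determine $\sigma$; on $\mathfrak{S}_n$ the admissible sequences are those with $0\le r_i\le n-i$ for all $i\in[n]$, and on $\mathfrak{S}_\infty$ the sequences of nonnegative integers with infinitely many zeros. $\mathrm{Geom}(p)$ has mass $p(1-p)^{j-1}$ at $j\ge1$. Mallows blocks: for $q\in[0,1)$, $\Sigma\sim\mathrm{Mallows}(\mathbb{N}^*,q)$ is the random element of $\mathfrak{S}_\infty$ such that $(r_i(\Sigma)+1)_{i\ge1}$ are i.i.d. $\mathrm{Geom}(1-q)$. Then $\Sigma=B_1\oplus B_2\oplus\cdots$ with $(B_k)$ i.i.d. random finite blocks, and $\mathrm{MBlock}(q)$ is the law of $B_1$; its size has finite moments of all orders. For $t\in[0,1)$, $e_{\pi,t}:=\prod_{j=1}^d\frac{\mathbb{E}[\mathrm{Occ}(\pi_j,B)]}{\mathbb{E}[|B|]}$ with $B\sim\mathrm{MBlock}(t)$. Geometric birth process: the càdlàg time-inhomogeneous $\mathbb{N}^*$-valued Markov process $(R_t)_{t\in[0,1)}$ with $R_0=1$ such that, as $h\to0^+$, $\mathbf{P}(R_{t+h}=j+1\mid R_t=j)=h\frac{j}{1-t}+o(h)$ and $\mathbf{P}(R_{t+h}=j\mid R_t=j)=1-h\frac{j}{1-t}+o(h)$. $q$-block process, $q\in(0,1)$: let $B^q\sim\mathrm{MBlock}(q)$ and $M=|B^q|$. Conditionally on $B^q$, let $(R_{i,t})_{t\in[0,q]}$, $i\in[M]$,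 be independent geometric birth processes conditioned to satisfy $R_{i,q}=r_i(B^q)+1$. For $t\in[0,q]$, $B^q_t\in\mathfrak{S}_M$ is the permutation with $r_i(B^q_t)=R_{i,t}-1$, $i\in[M]$. The size $|B^q_t|=|B^q|=M$ does not depend on $t$. Covariance function: for $s,t\in[0,1)$ and any $q\in(0,1)$ with $q\ge\max(s,t)$ (the value does not depend on $q$), $$\begin{aligned}H_\pi(s,t)=\mathbb{E}[|B^q|]\,e_{\pi,s}\,e_{\pi,t}\Bigg(&\frac{1}{(2d-1)!}\sum_{1\le i,j\le d}\binom{i+j-2}{i-1}\binom{2d-i-j}{d-i}\mathrm{Cov}\!\left[\frac{\mathrm{Occ}(\pi_j,B^q_t)}{\mathbb{E}[\mathrm{Occ}(\pi_j,B^q_t)]},\frac{\mathrm{Occ}(\pi_i,B^q_s)}{\mathbb{E}[\mathrm{Occ}(\pi_i,B^q_s)]}\right]\\&-\frac{1}{(d-1)!\,d!}\sum_{i=1}^d\mathrm{Cov}\!\left[\frac{|B^q|}{\mathbb{E}[|B^q|]},\frac{\mathrm{Occ}(\pi_i,B^q_s)}{\mathbb{E}[\mathrm{Occ}(\pi_i,B^q_s)]}+\frac{\mathrm{Occ}(\pi_i,B^q_t)}{\mathbb{E}[\mathrm{Occ}(\pi_i,B^q_t)]}\right]+\frac{1}{(d-1)!^2}\mathrm{Var}\!\left[\frac{|B^q|}{\mathbb{E}[|B^q|]}\right]\Bigg),\end{aligned}$$ with the convention $\frac{\mathrm{Occ}(\rho,B^q_0)}{\mathbb{E}[\mathrm{Occ}(\rho,B^q_0)]}:=1$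 when $\rho$ is not an identity permutation. The function $H_\pi$ is positive semidefinite, and $(X_{\pi,t})_{t\in[0,1)}$ is the centered Gaussian process with covariance function $H_\pi$. *)

(* Defs.v *)
From HB Require Import structures.
From mathcomp Require Import all_boot all_order all_algebra all_fingroup.
From mathcomp Require Import finmap.
From mathcomp Require Import all_classical all_reals all_analysis.

Set Implicit Arguments.
Unset Strict Implicit.
Unset Printing Implicit Defensive.

Import Order.TTheory GRing.Theory Num.Theory.
Import numFieldNormedType.Exports.

Local Open Scope ring_scope.

(* Positions and values are numbered from 0: 'S_n acts on {0, ..., n-1}, and
   bijections of {1, 2, ...} are represented by bijections of nat. *)

(** * Finite permutations *)

(* Contains one empty permutation, which is the unit of the direct sum; the
   patterns are the elements of positive size. *)
Definition finperm := {n : nat & 'S_n}.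

Definition psize (s : finperm) : nat := tag s.

Definition mkperm n (s : 'S_n) : finperm := Tagged (fun n => 'S_n) s.

Definition is_identity (s : finperm) : bool := tagged s == 1%g.

Definition rinv n (s : 'S_n) (i : 'I_n) : nat :=
  #|[set j : 'I_n | (i < j)%N && (s j < s i)%N]|.

(* The sequences c that are not admissible (c i <= n - 1 - i for all i) are
   sent to the identity. *)
Definition perm_of_rinv n (c : nat -> nat) : 'S_n :=
  odflt 1%g [pick s : 'S_n | [forall i, rinv s i == c i]].

(* enum_val lists the elements of I in increasing order. Exactly one s passes
   the test, so the default value of odflt is never used. *)
Definition pat n (I : {set 'I_n}) (t : 'S_n) : 'S_(#|I|) :=
  odflt 1%g [pick s : 'S_(#|I|) | [forall j, forall k,
    (s j < s k)%N == (t (enum_val j) < t (enum_val k))%N]].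

Definition Occ (p t : finperm) : nat :=
  #|[set I : {set 'I_(psize t)} | mkperm (pat I (tagged t)) == p]|.

Definition dsum_fun m n (s : 'S_m) (r : 'S_n) (i : 'I_(m + n)) : 'I_(m + n) :=
  match fintype.split i with
  | inl j => lshift n (s j)
  | inr j => rshift m (r j)
  end.

Lemma dsum_fun_inj m n (s : 'S_m) (r : 'S_n) : injective (dsum_fun s r).
Proof.
move=> i j; rewrite /dsum_fun.
case: (split_ordP i) => i' ->; case: (split_ordP j) => j' ->.
- by move/lshift_inj/perm_inj => ->.
- by move/eqP; rewrite eq_lrshift.
- by move/eqP; rewrite eq_rlshift.
- by move/rshift_inj/perm_inj => ->.
Qed.

Definition dsum (s r : finperm) : finperm :=
  mkperm (perm (@dsum_fun_inj _ _ (tagged s) (tagged r))).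

Definition is_block (s : finperm) : Prop :=
  (0 < psize s)%N /\
  ~ exists s1 s2, [/\ (0 < psize s1)%N, (0 < psize s2)%N & s = dsum s1 s2].

Definition block_decomposition (p : finperm) (bs : seq finperm) : Prop :=
  (forall b, b \in bs -> is_block b) /\
  p = foldr dsum (mkperm (1%g : 'S_0)) bs.

Local Open Scope classical_set_scope.

(* Every p has exactly one block decomposition. *)
Definition blocks (p : finperm) : seq finperm :=
  xget [::] [set bs | block_decomposition p bs].

(** * Infinite permutations *)

Definition rinv_infty (s : nat -> nat) (i : nat) : nat :=
  #|` fset_set [set j : nat | (i < j)%N /\ (s j < s i)%N] |.

Definition is_infinite_dsum (s : nat -> nat) (b : nat -> finperm) : Prop :=
  forall k (i : 'I_(psize (b k))),
    s (\sum_(l < k) psize (b l) + i)%N =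
    (\sum_(l < k) psize (b l) + tagged (b k) i)%N.

(** * Probability *)

Section probability_notions.
Context d (T : measurableType d) (R : realType) (P : probability T R).

Definition cprob (A C : set T) : R := fine (P (A `&` C)) / fine (P C).

(* Measurability for the discrete sigma-algebra of the countable type finperm. *)
Definition random_finperm (B : T -> finperm) : Prop :=
  forall b, measurable (B @^-1` [set b]).

Definition mutually_independent (X : nat -> T -> nat) : Prop :=
  forall (J : seq nat) (A : nat -> set nat), uniq J ->
    P (\bigcap_(i in [set` J]) (X i @^-1` A i)) =
    (\prod_(i <- J) P (X i @^-1` A i))%E.

Definition is_geometric (p : R) (X : T -> nat) : Prop :=
  forall j, (1 <= j)%N -> P (X @^-1` [set j]) = (p * (1 - p) ^+ (j - 1))%:E.

Definition is_mallows (q : R) (S : T -> nat -> nat) : Prop :=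
  [/\ forall w, bijective (S w),
      forall i, measurable_fun setT (fun w => S w i),
      mutually_independent (fun i w => (rinv_infty (S w) i).+1) &
      forall i, is_geometric (1 - q) (fun w => (rinv_infty (S w) i).+1)].

(* normal_prob with standard deviation 0 is not a point mass in the library,
   so the degenerate case is treated apart. *)
Definition centered_normal (X : T -> R) : Prop :=
  exists2 sigma : R, 0 <= sigma & forall A : set R, measurable A ->
    P (X @^-1` A) = if sigma == 0 then \d_(0 : R) A else normal_prob 0 sigma A.

Definition centered_gaussian_process (D : set R) (X : R -> {RV P >-> R})
    (K : R -> R -> R) : Prop :=
  (forall n (t : 'I_n -> R) (a : 'I_n -> R), (forall k, D (t k)) ->
     centered_normal (fun w => \sum_(k < n) a k * X (t k) w)) /\
  (forall s t, D s -> D t -> covariance P (X s) (X t) = (K s t)%:E).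

End probability_notions.

(* B ~ MBlock(q) under P. *)
Definition is_MBlock (R : realType) (q : R) d (T : measurableType d)
    (P : probability T R) (B : T -> finperm) : Prop :=
  random_finperm B /\
  exists (d' : measure_display) (T' : measurableType d')
         (P' : probability T' R) (S : T' -> nat -> nat) (Bs : nat -> T' -> finperm),
    [/\ is_mallows P' q S,
        forall k, random_finperm (Bs k),
        {ae P', forall w, (forall k, is_block (Bs k w)) /\
                          is_infinite_dsum (S w) (fun k => Bs k w)} &
        forall b, P (B @^-1` [set b]) = P' (Bs 0%N @^-1` [set b])].

(** * Geometric birth process and q-block process *)

(* At the ends of an interval D the irrelevant one-sided filter is trivial,
   so that the corresponding condition is void. *)
Definition cadlag_on (R : realType) (D : set R) (f : R -> nat) : Prop :=
  forall t, D t ->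
    (f u @[u --> within D t^'+] --> f t) /\
    exists l : nat, f u @[u --> within D t^'-] --> l.

(* The o(h) are uniform for t in [0, t1], for every fixed j and t1 < 1. With
   pointwise o(h) the law would not be determined: additional jumps at
   deterministic times would be permitted. *)
Definition geometric_birth_process (R : realType) d (T : measurableType d)
    (P : probability T R) (Z : R -> T -> nat) : Prop :=
  [/\ (forall t, 0 <= t < 1 ->
         measurable_fun setT (Z t) /\ forall w, (1 <= Z t w)%N),
      (forall w, cadlag_on `[0, 1[ (Z ^~ w)),
      (forall w, Z 0 w = 1%N),
      (* Markov property *)
      (forall (past : seq R) (v : R -> nat) t u j k,
         (forall s, s \in past -> 0 <= s <= t) -> 0 <= t <= u -> u < 1 ->
         let A := [set w | forall s, s \in past -> Z s w = v s] in
         (0 < P (A `&` (Z t @^-1` [set j])))%E ->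
         cprob P (Z u @^-1` [set k]) (A `&` (Z t @^-1` [set j])) =
         cprob P (Z u @^-1` [set k]) (Z t @^-1` [set j])) &
      (* infinitesimal transition probabilities *)
      (forall (j : nat) (t1 eps : R), 0 <= t1 < 1 -> 0 < eps ->
         exists2 delta : R, 0 < delta & forall t h,
           0 <= t <= t1 -> 0 < h < delta -> t + h < 1 ->
           (0 < P (Z t @^-1` [set j]))%E ->
           `| cprob P (Z (t + h) @^-1` [set j.+1]) (Z t @^-1` [set j])
              - h * (j%:R / (1 - t)) | <= eps * h /\
           `| cprob P (Z (t + h) @^-1` [set j]) (Z t @^-1` [set j])
              - (1 - h * (j%:R / (1 - t))) | <= eps * h)].

(* The last clause gives the finite-dimensional distributions of the family
   (Z i)_(i < |b|) conditionally on B = b: the product over i of those of a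
   geometric birth process G conditioned on G_q = r_i(b) + 1. Only the Z i with
   i < |B| matter. *)
Definition q_block_process (R : realType) (q : R) d (T : measurableType d)
    (P : probability T R) (B : T -> finperm) (Z : nat -> R -> T -> nat) : Prop :=
  [/\ is_MBlock q P B,
      (forall i t, 0 <= t <= q -> measurable_fun setT (Z i t)),
      (forall w i, (i < psize (B w))%N -> cadlag_on `[0, q] (fun t => Z i t w)) &
      exists (d' : measure_display) (T' : measurableType d')
             (P' : probability T' R) (G : R -> T' -> nat),
        geometric_birth_process P' G /\
        forall (b : finperm) (ts : seq R) (v : nat -> R -> nat),
          (forall t, t \in ts -> 0 <= t <= q) ->
          P ((B @^-1` [set b]) `&`
             [set w | forall i t, (i < psize b)%N -> t \in ts ->
                                  Z i t w = v i t]) =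
          (P (B @^-1` [set b]) *
           (\prod_(i < psize b)
              cprob P' [set w | forall t, t \in ts -> G t w = v i t]
                       (G q @^-1` [set (rinv (tagged b) i).+1]))%:E)%E].

(* The random permutation B^q_t. *)
Definition block_at (R : realType) d (T : measurableType d)
    (B : T -> finperm) (Z : nat -> R -> T -> nat) (t : R) (w : T) : finperm :=
  mkperm (perm_of_rinv (psize (B w)) (fun i => (Z i t w - 1)%N)).

(** * The functions e and H *)

Section e_and_H.
Context (R : realType) (p : finperm).

(* Relational, since it involves an arbitrary B ~ MBlock(t); x depends only on
   p and t, because only the law of B matters. *)
Definition is_e (t x : R) : Prop :=
  exists (d : measure_display) (T : measurableType d) (P : probability T R)
         (B : T -> finperm),
    is_MBlock t P B /\
    x = \prod_(b <- blocks p)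
          (fine 'E_P[fun w => (Occ b (B w))%:R] /
           fine 'E_P[fun w => (psize (B w))%:R]).

(* The random variable Occ(b, B^q_t) / E[Occ(b, B^q_t)]; at t = 0 it reads 0 / 0
   for a non-identity b, and is 1 by convention. *)
Definition normalized_Occ d (T : measurableType d) (P : probability T R)
    (Bt : R -> T -> finperm) (b : finperm) (t : R) (w : T) : R :=
  if (t == 0) && ~~ is_identity b then 1
  else (Occ b (Bt t w))%:R / fine 'E_P[fun w' => (Occ b (Bt t w'))%:R].

Definition H_formula (e : R -> R) d (T : measurableType d) (P : probability T R)
    (B : T -> finperm) (Z : nat -> R -> T -> nat) (s t : R) : R :=
  let bs := blocks p in
  let n := size bs in
  let EB := fine 'E_P[fun w => (psize (B w))%:R] in
  let size_ratio := fun w => (psize (B w))%:R / EB in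
  let occ_ratio := fun (i : nat) (u : R) =>
    normalized_Occ P (block_at B Z) (nth (mkperm (1%g : 'S_0)) bs (i - 1)) u in
  EB * e s * e t *
  ((((2 * n - 1)`!)%:R)^-1 *
     (\sum_(1 <= i < n.+1) \sum_(1 <= j < n.+1)
        ('C(i + j - 2, i - 1) * 'C(2 * n - i - j, n - i))%:R *
        fine (covariance P (occ_ratio j t) (occ_ratio i s)))
   - (((n - 1)`! * n`!)%:R)^-1 *
     (\sum_(1 <= i < n.+1)
        fine (covariance P size_ratio
                (fun w => occ_ratio i s w + occ_ratio i t w)))
   + ((((n - 1)`!) ^ 2)%:R)^-1 * fine 'V_P[size_ratio]).

(* x = H_p(s, t), computed with some q >= max(s, t) and some q-block process;
   the value depends on neither. *)
Definition is_H (e : R -> R) (s t x : R) : Prop :=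
  exists (q : R) (d : measure_display) (T : measurableType d)
         (P : probability T R) (B : T -> finperm) (Z : nat -> R -> T -> nat),
    [/\ 0 < q < 1, Num.max s t <= q, q_block_process q P B Z &
        x = H_formula e P B Z s t].

End e_and_H.

(** * Local Hoelder continuity *)

Definition locally_hoelder (R : realType) (gamma : R) (D : set R) (f : R -> R) :
    Prop :=
  forall x, D x -> exists2 delta : R, 0 < delta & exists C : R,
    forall s t, D s -> D t -> `|s - x| < delta -> `|t - x| < delta ->
      `|f s - f t| <= C * `|s - t| `^ gamma.

(* Main.v *)
(* Encode a permutation by the word of its right-inversion counts; direct sums
   become concatenations, and the blocks are the words whose "level" returns to 0
   for the first time at the end. Under MBlock(q) the word has i.i.d. geometric
   letters stopped at this return time, and along the q-block process at times
   s <= t the letters become i.i.d. triples (x, y, z), where x <= y <= z are the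
   values of a geometric birth process at times s, t, q.

   A q-block is a sequence of blocks of the y-word, and Occ(b, .) is additive over
   it when b is a block; a Wald identity then relates the moments under q to those
   under t, which shows that e and H can be computed with any large enough q. For a
   fixed q, each letter changes between times s and t with probability O(t - s)
   per inversion, so that e is locally Lipschitz and
   H(s,s) - 2 H(s,t) + H(t,t) = O(t - s). As the process is Gaussian,
   P(|X_t - X_s| > n 2^(-n/2)) is then summable even after multiplication by 2^n when
   t - s <= 2^(-n), and chaining along the dyadic numbers, with exceptional events
   controlled by the Borel-Cantelli lemma, gives the continuous version. *)

(* The Wald identity rests on a comparison: as y <= z letterwise, the z-level dominates the y-level,
   so whether a word can still be completed to a q-block after its last y-block is decided before
   that y-block starts. The factor [kappa] is the expected number of y-blocks in a q-block. Second
   moments also produce other terms that depend on q, but after normalization each involves only one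
   of the two patterns; they disappear from H because the coefficient matrix has constant row and
   column sums 'C(2d - 1, d), to which the three prefactors are tuned. The bracket then scales as 1
   / kappa and E|B^q| as kappa. The change of q is essential: the hypothesis on H gives each pair of
   times its own q, while Lipschitz constants are obtained at one fixed q. The laws of the birth
   process and of the triples come from lower bounds for every value, which are equalities because
   their total mass is 1. At time 0 the mean number of occurrences of a pattern with an inversion
   vanishes, so normalized counts are controlled only away from 0. The denominators of e contain
   only the mean size, at least 1, so e is regular up to 0. *)
From HB Require Import structures.
From mathcomp Require Import all_boot all_order all_algebra all_fingroup.
From mathcomp Require Import finmap zify ring lra.
Require Import Defs.

Set Implicit Arguments.
Unset Strict Implicit.
Unset Printing Implicit Defensive.

Import Order.TTheory GRing.Theory Num.Theory.

(** * Finite permutations as words of right-inversion counts *)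

Section permutations.
Local Open Scope nat_scope.

(* level w l is the number of letters still needed after l to close all the
   inversions opened so far, w being this number before l; a permutation splits as
   a direct sum at the positions of level 0. *)
Definition lstep (w z : nat) : nat := maxn w.-1 z.

Definition level (w : nat) (l : seq nat) : nat := foldl lstep w l.

(* The level, starting from w, is 0 for the first time at the end of the word. *)
Fixpoint hit (w : nat) (l : seq nat) : bool :=
  if l is z :: l' then
    if lstep w z == 0 then nilp l' else hit (lstep w z) l'
  else false.

Fixpoint adm (l : seq nat) : bool :=
  if l is z :: l' then (z <= size l') && adm l' else true.

Lemma level_cat w l1 l2 : level w (l1 ++ l2) = level (level w l1) l2.
Proof. exact: foldl_cat. Qed.

(** The level is the largest demand not yet met: [w] and each letter lose one unit for every later
    letter. It vanishes when each demand fits into the number of letters that follow it. *)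
Lemma level_eq0 w l : (level w l == 0) = (w <= size l) && adm l.
Proof.
elim: l w => [|z l IH] w /=; first by rewrite leqn0 andbT.
rewrite /level /= -/(level _ l) IH /lstep geq_max.
by rewrite -[w <= _]/(w <= (size l).+1) -[in LHS](ltnS w.-1); case: w => [|w] /=; lia.
Qed.

Lemma adm_level l : adm l = (level 0 l == 0).
Proof. by rewrite level_eq0 leq0n. Qed.

Lemma admP l : reflect (forall i, i < size l -> nth 0 l i + i < size l) (adm l).
Proof.
elim: l => [|z l IH] /=; first by apply: (iffP idP).
apply: (iffP andP) => [[zl /IH al] [|i] /=|al]; first lia.
- by rewrite ltnS => /al; lia.
- split; first by have := al 0 isT; rewrite /=; lia.
  by apply/IH => i il; have /= := al i.+1 il; lia.
Qed.

Lemma adm_cat l1 l2 : adm l1 -> adm l2 -> adm (l1 ++ l2).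
Proof. by rewrite !adm_level level_cat => /eqP -> . Qed.

Lemma adm_drop n l : adm l -> adm (drop n l).
Proof.
elim: l n => [|z l IH] [|n] //= /andP[_]; exact: IH.
Qed.

Lemma adm_catr l1 l2 : adm (l1 ++ l2) -> adm l2.
Proof. by move=> /(adm_drop (size l1)); rewrite drop_size_cat. Qed.

Lemma hit_level w l : hit w l -> level w l = 0.
Proof.
elim: l w => //= z l IH w; rewrite /level /= -/(level _ l).
by case: ifP => [/eqP -> /nilP -> //|_ /IH].
Qed.

Lemma hit_neq0 w l1 l2 : hit w (l1 ++ l2) -> l1 != [::] -> l2 != [::] ->
  level w l1 != 0.
Proof.
elim: l1 w => //= z l1 IH w H _ l20; rewrite /level /= -/(level _ l1).
move: H; case: ifPn => [_ |w0 H].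
  by case: (l1) => //=; case: (l2) l20.
by case: l1 IH H => [|z' l1] IH H //; apply: IH.
Qed.

Lemma hitI w l : l != [::] -> level w l = 0 ->
  (forall l1 l2, l = l1 ++ l2 -> l1 != [::] -> l2 != [::] -> level w l1 != 0) ->
  hit w l.
Proof.
elim: l w => //= z l IH w _; rewrite /level /= -/(level _ l) => l0 H.
case: ifP => w0.
  case: l IH l0 H => // z' l IH l0 /(_ [:: z] (z' :: l) erefl isT isT).
  by rewrite /level /= w0.
apply: IH => //.
  by apply/negP => /eqP E; move: l0; rewrite E /level /= => /eqP; rewrite w0.
move=> l1 l2 E l10 l20; apply: (H (z :: l1) l2) => //.
by rewrite E.
Qed.

Lemma hit_adm l : hit 0 l -> adm l.
Proof. by rewrite adm_level => /hit_level ->. Qed.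

Lemma hit_nnil w l : hit w l -> l != [::].
Proof. by case: l. Qed.

(** Words that stop at the first return to level 0 form a prefix code. *)
Lemma hit_prefix w l1 l2 : hit w l1 -> hit w (l1 ++ l2) -> l2 = [::].
Proof.
elim: l1 w => //= z l1 IH w; case: ifP => _; last exact: IH.
by move=> /nilP -> /= /nilP.
Qed.

(** Both words are prefixes of the sequence [r], hence one is a prefix of the other. This is how the
    right-inversion counts of an infinite permutation single out its first block. *)
Lemma hit_prefix_nth w l1 l2 (r : nat -> nat) : hit w l1 -> hit w l2 ->
  (forall i, i < size l1 -> nth 0 l1 i = r i) ->
  (forall i, i < size l2 -> nth 0 l2 i = r i) -> l1 = l2.
Proof.
move=> h1 h2 r1 r2.
have E (l : seq nat) : (forall i, i < size l -> nth 0 l i = r i) -> l = mkseq r (size l).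
  move=> H; apply: (@eq_from_nth _ 0) => [|i il]; rewrite ?size_mkseq //.
  by rewrite nth_mkseq // H.
wlog le12 : l1 l2 h1 h2 r1 r2 / size l1 <= size l2 => [H|].
  by case: (leqP (size l1) (size l2)) => [|/ltnW] H'; [|symmetry]; apply: H.
have tk : take (size l1) l2 = l1.
  rewrite (E _ r1) (E _ r2) /mkseq -map_take take_iota.
  by rewrite size_map size_iota; congr (map _ (iota _ _)); lia.
have := h2; rewrite -(cat_take_drop (size l1) l2) tk => /(hit_prefix h1) ->.
by rewrite cats0.
Qed.

(** The first factor is the shortest non-empty admissible prefix; an earlier return to level 0 would
    contradict its minimality. *)
Lemma hit_split l : adm l -> l != [::] ->
  exists l1 l2, [/\ l = l1 ++ l2, hit 0 l1 & adm l2].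
Proof.
move=> al l0.
have ex : exists n, (0 < n <= size l) && adm (take n l).
  by exists (size l); rewrite take_size al leqnn lt0n size_eq0 l0.
case: (ex_minnP ex) => m /andP[/andP[m0 ml] am] min.
exists (take m l), (drop m l); split.
- by rewrite cat_take_drop.
- apply: hitI.
  + by rewrite -size_eq0 size_takel //; lia.
  + by apply/eqP; rewrite -adm_level.
  + move=> l1 l2 E l10 l20; rewrite -adm_level; apply/negP => a1.
    have s1 : size (take m l) = size l1 + size l2 by rewrite E size_cat.
    rewrite size_takel // in s1.
    move: l10 l20; rewrite -!size_eq0 => l10 l20.
    have := min (size l1); suff -> : take (size l1) l = l1.
      by rewrite a1; lia.
    rewrite -(cat_take_drop m l) E -catA take_size_cat //.
- exact: adm_drop.
Qed.

Lemma card_ord_lt n (k : nat) : k <= n -> #|[set i : 'I_n | i < k]| = k.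
Proof.
move=> kn; rewrite cardsE -sum1_card.
by rewrite (big_ord_narrow kn) sum1_card card_ord.
Qed.

(** * Right-inversion words of finite permutations (Lehmer codes) *)

Definition rword n (s : 'S_n) : seq nat := [seq rinv s i | i <- enum 'I_n].

Lemma size_rword n (s : 'S_n) : size (rword s) = n.
Proof. by rewrite size_map size_enum_ord. Qed.

Lemma nth_rword n (s : 'S_n) (i : 'I_n) : nth 0 (rword s) i = rinv s i.
Proof. by rewrite (nth_map i) ?size_enum_ord // nth_ord_enum. Qed.

(** [lift_perm ord0 k s] puts the value [k] in front of [s]: the [k] smaller values all come later,
    and the relative order of the others is unchanged. Words can thus be treated by induction on
    their first letter. *)
Lemma rinv_lift0 n k (s : 'S_n) : rinv (lift_perm ord0 k s) ord0 = k.
Proof.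
rewrite /rinv -[RHS](@card_ord_lt n); last by rewrite -ltnS.
rewrite -[RHS](card_preimset _ (@perm_inj _ s)).
rewrite -[RHS](card_imset _ (@lift_inj _ ord0)).
apply: eq_card => j; rewrite !inE lift_perm_id.
apply/idP/imsetP => [/andP[j0]|[j' + ->]].
- case: (unliftP ord0 j) j0 => [j' -> _|-> //].
  rewrite lift_perm_lift => H; exists j' => //; rewrite !inE.
  by move: H; rewrite /= /bump; case: (leqP k (s j')); lia.
- rewrite !inE lift_perm_lift /= /bump => H.
  by move: H; case: (leqP k (s j')); lia.
Qed.

Lemma rinv_liftS n k (s : 'S_n) i :
  rinv (lift_perm ord0 k s) (lift ord0 i) = rinv s i.
Proof.
rewrite /rinv -[RHS](card_imset _ (@lift_inj _ ord0)).
apply: eq_card => j; rewrite !inE lift_perm_lift.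
have bm (a b : nat) : (bump k a < bump k b) = (a < b).
  by rewrite /bump; do 2 case: leqP; lia.
apply/idP/imsetP => [/andP[j0]|[j' + ->]].
- case: (unliftP ord0 j) j0 => [j' -> ij|-> //].
  by rewrite lift_perm_lift => H; exists j' => //; rewrite !inE -(bm _ (s i)) H andbT.
- rewrite inE lift_perm_lift /= (bm (s j') (s i)) => /andP[ij ->].
  by rewrite andbT /bump /=.
Qed.

Lemma rword_lift n k (s : 'S_n) : rword (lift_perm ord0 k s) = val k :: rword s.
Proof.
rewrite /rword enum_ordSl /= rinv_lift0; congr cons.
by rewrite -map_comp; apply: eq_map => i /=; rewrite rinv_liftS.
Qed.

Lemma lift_permP n (s : 'S_n.+1) : exists s', s = lift_perm ord0 (s ord0) s'.
Proof.
have H j : exists j', s (lift ord0 j) = lift (s ord0) j'.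
  case: (unliftP (s ord0) (s (lift ord0 j))) => [j' ->|/perm_inj]; first by exists j'.
  by move=> /eqP; rewrite eq_sym (negPf (neq_lift _ _)).
pose f j := odflt j (unlift (s ord0) (s (lift ord0 j))).
have fE j : s (lift ord0 j) = lift (s ord0) (f j).
  by have [j' E] := H j; rewrite /f E liftK.
have finj : injective f.
  move=> i j E; apply: (@lift_inj _ ord0); apply: (@perm_inj _ s).
  by rewrite !fE E.
exists (perm finj); apply/permP => i.
case: (unliftP ord0 i) => [j ->|->]; last by rewrite lift_perm_id.
by rewrite lift_perm_lift permE fE.
Qed.

Lemma rword_inj n : injective (@rword n).
Proof.
elim: n => [|n IH] s t; first by move=> _; apply/permP => -[].
have [s' ->] := lift_permP s; have [t' ->] := lift_permP t.
by rewrite !rword_lift => -[/val_inj -> /IH ->].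
Qed.

Lemma adm_rword n (s : 'S_n) : adm (rword s).
Proof.
elim: n s => [|n IH] s.
  by have := size_rword s; case: (rword s).
have [s' ->] := lift_permP s.
by rewrite rword_lift /= IH andbT size_rword -ltnS.
Qed.

Lemma adm_rwordP l : adm l -> exists s : 'S_(size l), rword s = l.
Proof.
elim: l => [|z l IH] /=.
  by exists 1%g; have := size_rword (1%g : 'S_0); case: (rword _).
move=> /andP[zl /IH[s sl]].
have zl' : z < (size l).+1 by [].
by exists (lift_perm ord0 (Ordinal zl') s); rewrite rword_lift sl.
Qed.

Definition pword (p : finperm) : seq nat := rword (tagged p).

Definition perm_of_word (l : seq nat) : finperm :=
  mkperm (perm_of_rinv (size l) (nth 0 l)).

Lemma size_pword p : size (pword p) = psize p.
Proof. exact: size_rword. Qed.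

Lemma adm_pword p : adm (pword p).
Proof. exact: adm_rword. Qed.

Lemma pword_inj : injective pword.
Proof.
move=> [n s] [m t]; rewrite /pword /= => E.
have nm : n = m by rewrite -(size_rword s) E size_rword.
by move: t E; rewrite -nm => t /rword_inj ->.
Qed.

Lemma perm_of_wordK l : adm l -> pword (perm_of_word l) = l.
Proof.
move=> /adm_rwordP[s sl]; rewrite /pword /perm_of_word /= /perm_of_rinv.
case: pickP => [t /= /forallP H|/(_ s)]; last first.
  by move=> /negP[]; apply/forallP => i; rewrite -nth_rword sl.
apply: (@eq_from_nth _ 0); rewrite size_rword // => i il.
by rewrite (nth_rword t (Ordinal il)); apply/eqP/H.
Qed.

Lemma pwordK p : perm_of_word (pword p) = p.
Proof. by apply: pword_inj; rewrite perm_of_wordK ?adm_pword. Qed.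

Lemma psize_perm_of_word l : psize (perm_of_word l) = size l.
Proof. by []. Qed.

Lemma perm_of_rinv_word n (c : nat -> nat) :
  mkperm (perm_of_rinv n c) = perm_of_word (mkseq c n).
Proof.
rewrite /perm_of_word size_mkseq; congr mkperm; rewrite /perm_of_rinv.
congr odflt; apply: eq_pick => s; apply: eq_forallb => i.
by rewrite nth_mkseq.
Qed.

(** * Direct sums and blocks in terms of words *)

Lemma dsum_lshift m n (s : 'S_m) (r : 'S_n) i :
  dsum_fun s r (lshift n i) = lshift n (s i).
Proof. by rewrite /dsum_fun; case: (split_ordP (lshift n i)) => j; [move=> /lshift_inj ->|move=> /eqP; rewrite eq_lrshift]. Qed.

Lemma dsum_rshift m n (s : 'S_m) (r : 'S_n) i :
  dsum_fun s r (rshift m i) = rshift m (r i).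
Proof. by rewrite /dsum_fun; case: (split_ordP (rshift m i)) => j; [move=> /eqP; rewrite eq_rlshift|move=> /rshift_inj ->]. Qed.

(** There are no inversions between the two summands, so each count is computed inside its own
    summand. *)
Lemma pword_dsum p q : pword (dsum p q) = pword p ++ pword q.
Proof.
case: p q => m s [n r]; rewrite /pword /dsum /=.
apply: (@eq_from_nth _ 0) => [|i il]; first by rewrite size_cat !size_rword.
rewrite size_rword in il.
rewrite (nth_rword _ (Ordinal il)) nth_cat size_rword.
case: (split_ordP (Ordinal il)) => j E; rewrite E; move: (congr1 val E) => /= ->.
- rewrite nth_rword /rinv.
  rewrite -[RHS](card_imset _ (@lshift_inj m n)); apply: eq_card => k.
  rewrite !inE !permE dsum_lshift; apply/idP/imsetP.
  + case: (split_ordP k) => k' ->.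
      by rewrite dsum_lshift /= => H; exists k' => //; rewrite inE.
    by rewrite dsum_rshift /= => /andP[_]; have := ltn_ord (s j); lia.
  + by move=> [k' H ->]; move: H; rewrite inE dsum_lshift.
- rewrite addKn nth_rword /rinv.
  rewrite -[RHS](card_imset _ (@rshift_inj m n)); apply: eq_card => k.
  rewrite !inE !permE dsum_rshift; apply/idP/imsetP.
  + case: (split_ordP k) => k' ->.
      by rewrite dsum_lshift /= => /andP[]; have := ltn_ord k'; lia.
    by rewrite dsum_rshift /= !ltn_add2l => H; exists k' => //; rewrite inE.
  + by move=> [k' H ->]; move: H; rewrite inE dsum_rshift /= !ltn_add2l.
Qed.

Lemma perm_of_word_cat l1 l2 : adm l1 -> adm l2 ->
  perm_of_word (l1 ++ l2) = dsum (perm_of_word l1) (perm_of_word l2).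
Proof.
move=> a1 a2; apply: pword_inj.
by rewrite pword_dsum !perm_of_wordK ?adm_cat.
Qed.

Lemma is_blockP p : is_block p <-> hit 0 (pword p).
Proof.
split=> [[p0 nd]|H].
- apply: hitI.
  + by rewrite -size_eq0 size_pword -lt0n.
  + by apply/eqP; rewrite -adm_level adm_pword.
  + move=> l1 l2 E l10 l20; rewrite -adm_level; apply/negP => a1.
    have a2 : adm l2 by apply: (@adm_catr l1); rewrite -E adm_pword.
    apply: nd; exists (perm_of_word l1), (perm_of_word l2).
    rewrite !psize_perm_of_word !lt0n !size_eq0 l10 l20; split=> //.
    by rewrite -perm_of_word_cat // -E pwordK.
- split; first by rewrite -size_pword lt0n size_eq0 (hit_nnil H).
  move=> [s1 [s2 [s10 s20 E]]].
  move: H; rewrite E pword_dsum => /hit_neq0.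
  rewrite -!size_eq0 !size_pword -!lt0n => /(_ s10 s20).
  by rewrite lt0n -adm_level adm_pword.
Qed.

Lemma block_decomposition_ex p : exists bs, block_decomposition p bs.
Proof.
have [n] := ubnP (psize p); elim: n p => // n IH p pn.
have [p0|p0] := eqVneq (pword p) [::].
  exists [::]; split => //=; apply: pword_inj; rewrite p0 /pword /=.
  by apply/esym/size0nil; rewrite size_rword.
have [l1 [l2 [E h1 a2]]] := hit_split (adm_pword p) p0.
have a1 := hit_adm h1.
have sz : psize p = size l1 + size l2 by rewrite -size_pword E size_cat.
have l10 : 0 < size l1 by rewrite lt0n size_eq0 (hit_nnil h1).
case: (IH (perm_of_word l2)) => [|bs [bsb Ebs]].
  by rewrite psize_perm_of_word; lia.
exists (perm_of_word l1 :: bs); split => [b|/=].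
  rewrite inE => /orP[/eqP ->|]; last exact: bsb.
  by apply/is_blockP; rewrite perm_of_wordK.
by rewrite -Ebs -perm_of_word_cat // -E pwordK.
Qed.

(** * Occurrences of patterns *)

Lemma enum_val_lt n (I : {set 'I_n}) (j k : 'I_#|I|) :
  (enum_val j < enum_val k) = (j < k).
Proof.
have mono (i i' : 'I_#|I|) : i < i' -> enum_val i < enum_val i'.
  move=> ii'; have x0 := enum_val i.
  rewrite /enum_val !(set_nth_default x0) -?cardE //.
  have : sorted (fun a b : 'I_n => a < b) (enum I).
    have -> : enum I = [seq x <- enum 'I_n | x \in I] by rewrite enumT.
    apply: sorted_filter; first by move=> a b c; apply: ltn_trans.
    by rewrite -[X in is_true X](@sorted_map _ _ (@nat_of_ord n) ltn) val_enum_ord iota_ltn_sorted.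
  have tr : transitive (fun a b : 'I_n => a < b) by move=> a b c; apply: ltn_trans.
  move=> /(sorted_ltn_nth tr x0).
  by apply=> //; rewrite inE -cardE ltn_ord.
have [jk|kj|/val_inj ->] := ltngtP j k; first exact: mono.
  by apply/negbTE; rewrite -leqNgt ltnW // mono.
by rewrite ltnn.
Qed.

Lemma perm_rank n (s : 'S_n) i : nat_of_ord (s i) = #|[set j | s j < s i]|.
Proof.
rewrite -[LHS](@card_ord_lt n) 1?ltnW //.
by rewrite -[LHS](card_preimset _ (@perm_inj _ s)); apply: eq_card => j; rewrite !inE.
Qed.

Lemma perm_eq_order n (s t : 'S_n) :
  (forall j k, (s j < s k) = (t j < t k)) -> s = t.
Proof.
move=> H; apply/permP => i; apply: val_inj => /=.
by rewrite (perm_rank s) (perm_rank t); apply: eq_card => j; rewrite !inE H.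
Qed.

(** The witness is the standardization of [f], which replaces each value by its rank. *)
Lemma ex_std n (f : 'I_n -> nat) : injective f ->
  exists s : 'S_n, forall j k, (s j < s k) = (f j < f k).
Proof.
move=> finj; pose g i := #|[set j | f j < f i]|.
have gmono j k : f j < f k -> g j < g k.
  move=> jk; apply: proper_card; rewrite properE; apply/andP; split.
    by apply/subsetP => x; rewrite !inE => /ltn_trans; apply.
  by apply/subsetPn; exists j; rewrite !inE ?ltnn.
have glt j k : (g j < g k) = (f j < f k).
  have [jk|kj|/finj ->] := ltngtP (f j) (f k); first exact: gmono.
    by apply/negbTE; rewrite -leqNgt ltnW // gmono.
  by rewrite ltnn.
have gn i : g i < n.
  rewrite -[X in _ < X](card_ord n) -cardsT; apply: proper_card.
  by rewrite properE subsetT; apply/subsetPn; exists i; rewrite !inE ?ltnn.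
have hinj : injective (fun i => Ordinal (gn i)).
  move=> i j /(congr1 val) /= E; apply: finj.
  by case: (ltngtP (f i) (f j)) => //; rewrite -glt E ltnn.
by exists (perm hinj) => j k; rewrite !permE /= glt.
Qed.

Lemma pat_lt n (I : {set 'I_n}) (t : 'S_n) j k :
  (pat I t j < pat I t k) = (t (enum_val j) < t (enum_val k)).
Proof.
rewrite /pat; case: pickP => [s /= /forallP H|].
  by have /forallP /(_ k) /eqP := H j.
have [|s Hs] := @ex_std _ (fun j : 'I_#|I| => nat_of_ord (t (enum_val j))).
  by move=> i i' /val_inj /perm_inj /enum_val_inj.
move=> /(_ s) /negP[]; apply/forallP => i; apply/forallP => i'.
by rewrite Hs.
Qed.

Definition occ_map (p : finperm) n (t : 'S_n) (f : 'I_(psize p) -> 'I_n) :=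
  (forall i j, (f i < f j) = (i < j)) /\
  (forall i j, (tagged p i < tagged p j) = (t (f i) < t (f j))).

Lemma mono_ord_inj m n (f : 'I_m -> 'I_n) :
  (forall i j, (f i < f j) = (i < j)) -> injective f.
Proof.
move=> fm a b ab; apply: val_inj.
by case: (ltngtP a b) => //; rewrite -fm ab ltnn.
Qed.

(** An increasing map sends [i] to the element of rank [i] of its image, so the image determines the
    map. *)
Lemma mono_unique m n (f g : 'I_m -> 'I_n) :
  (forall i j, (f i < f j) = (i < j)) -> (forall i j, (g i < g j) = (i < j)) ->
  f @: setT = g @: setT -> f =1 g.
Proof.
have rk (h : 'I_m -> 'I_n) : (forall i j, (h i < h j) = (i < j)) ->
    forall i, #|[set x in h @: setT | x < h i]| = i.
  move=> hm i; rewrite -[RHS](@card_ord_lt m) 1?ltnW //.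
  have hinj : injective h.
    exact: mono_ord_inj.
  rewrite -[RHS](card_imset _ hinj); apply: eq_card => x; rewrite !inE.
  apply/andP/imsetP => [[/imsetP[k _ ->]]|[k + ->]].
    by rewrite hm => ki; exists k => //; rewrite inE.
  by rewrite inE hm => ->; rewrite imset_f.
move=> fm gm E i.
have : g i \in f @: setT by rewrite E imset_f.
move=> /imsetP[k _ gk].
rewrite gk; congr (f _); apply: val_inj => /=.
by rewrite -(rk _ gm i) -(rk _ fm k) E gk.
Qed.

(** Occurrences as increasing embeddings rather than subsets: in this form they can be transported
    along the two injections into a direct sum. *)
Lemma patP p n (t : 'S_n) (I : {set 'I_n}) :
  mkperm (pat I t) = p <-> exists2 f : 'I_(psize p) -> 'I_n, occ_map t f & I = f @: setT.
Proof.
split=> [<-|[f [fm fo] EI]].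
- exists (fun i => enum_val (i : 'I_#|I|)); first split => i j; first exact: enum_val_lt.
    exact: pat_lt.
  apply/setP => x; apply/idP/imsetP => [xI|[i _ ->]]; last exact: enum_valP.
  by exists (enum_rank_in xI x) => //; rewrite enum_rankK_in.
- case: p f fm fo EI => k p f fm fo EI; rewrite /psize /= in f fm fo EI.
  have finj : injective f.
    exact: mono_ord_inj.
  have kI : k = #|I| by rewrite EI card_imset // cardsT card_ord.
  move: p f fm fo EI finj; rewrite kI => p f fm fo EI _.
  congr mkperm; apply: perm_eq_order => i j; rewrite pat_lt fo.
  have E : f =1 enum_val.
    apply: mono_unique fm _ _ => [a b|]; first exact: enum_val_lt.
    rewrite -EI; apply/setP => x; apply/idP/imsetP => [xI|[a _ ->]]; last exact: enum_valP.
    by exists (enum_rank_in xI x) => //; rewrite enum_rankK_in.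
  by rewrite !E.
Qed.

Lemma Occ_self p : 0 < Occ p p.
Proof.
rewrite /Occ card_gt0; apply/set0Pn; exists setT; rewrite inE; apply/eqP.
apply/patP; exists id; first by split.
by rewrite imset_id.
Qed.

Lemma Occ_le p t : Occ p t <= psize t ^ psize p.
Proof.
rewrite /Occ; apply: (@leq_trans #|[set I : {set 'I_(psize t)} | #|I| == psize p]|).
  apply: subset_leq_card; apply/subsetP => I; rewrite !inE => /eqP <-.
  by [].
rewrite card_draws card_ord; apply: (@leq_trans (psize t ^_ psize p)).
  by rewrite -bin_ffact leq_pmulr // fact_gt0.
elim: (psize p) => [|k IH] //; by rewrite ffactnSr expnSr leq_mul // leq_subr.
Qed.

(** Inversions that start before [k0] also end before [k0], so the prefix of length [k0] is
    admissible and the level returns to 0 too early for a block. *)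
Lemma block_split_hit b k0 : is_block b -> 0 < k0 < psize b ->
  (forall i j : 'I_(psize b), i < k0 -> k0 <= j -> tagged b i < tagged b j) ->
  False.
Proof.
move=> /is_blockP hb /andP[k00 kb] H.
have := @hit_neq0 0 (take k0 (pword b)) (drop k0 (pword b)).
rewrite cat_take_drop -!size_eq0 size_takel ?size_drop size_pword; last lia.
move=> /(_ hb); rewrite -lt0n k00 -lt0n subn_gt0 kb => /(_ isT isT) /negP[].
rewrite -adm_level; apply/admP => i; rewrite size_takel ?size_pword; last lia.
move=> ik; rewrite nth_take //.
have ib : i < psize b by lia.
rewrite (nth_rword _ (Ordinal ib)) /rinv.
have : #|[set j : 'I_(psize b) | Ordinal ib < j & tagged b j < tagged b (Ordinal ib)]|
   <= #|[set j : 'I_(psize b) | j < k0] :\: [set j : 'I_(psize b) | j < i.+1]|.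
  apply: subset_leq_card; apply/subsetP => j; rewrite !inE => /andP[ij sj].
  rewrite -leqNgt ij /= ltnNge; apply/negP => /H - /(_ (Ordinal ib) ik).
  by rewrite ltnNge ltnW.
rewrite cardsD card_ord_lt; last lia.
have /setIidPr -> : [set j : 'I_(psize b) | j < i.+1] \subset [set j : 'I_(psize b) | j < k0].
  by apply/subsetP => j; rewrite !inE; lia.
rewrite card_ord_lt // => H1.
by apply: leq_ltn_trans (_ : _ <= k0 - i.+1 + i) _; [rewrite leq_add2r|lia].
Qed.

(** Values of the left summand lie below those of the right one, so an occurrence that meets both
    summands would split [b] as a direct sum. Every occurrence of a block therefore lies in one
    summand. *)
Lemma Occ_dsum b p q : is_block b -> Occ b (dsum p q) = Occ b p + Occ b q.
Proof.
move=> bb; have b0 : 0 < psize b by case: bb.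
case: p q => m s [n r]; rewrite {1}/Occ.
set S := [set I : {set 'I_(psize (dsum _ _))} | _].
set Sl := [set I : {set 'I_m} | mkperm (pat I s) == b].
set Sr := [set I : {set 'I_n} | mkperm (pat I r) == b].
have -> : Occ b (existT _ m s) = #|Sl| by [].
have -> : Occ b (existT _ n r) = #|Sr| by [].
have injl : injective (fun I : {set 'I_m} => [set lshift n x | x in I]).
  exact/imset_inj/lshift_inj.
have injr : injective (fun I : {set 'I_n} => [set rshift m x | x in I]).
  exact/imset_inj/rshift_inj.
rewrite -(card_imset _ injl) -(card_imset _ injr).
set L := [set _ | _ in Sl]; set Rr := [set _ | _ in Sr].
have dis : [disjoint L & Rr].
  apply/pred0P => I /=; apply/negP => /andP[/imsetP[I1 + ->] /imsetP[I2 _ E]].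
  rewrite inE => /eqP /patP[f _ EI].
  have : lshift n (f (Ordinal b0)) \in [set lshift n x | x in I1].
    by rewrite imset_f // EI imset_f.
  by rewrite E => /imsetP[k _ /eqP]; rewrite eq_lrshift.
have -> : #|L| + #|Rr| = #|L :|: Rr|.
  by rewrite cardsU disjoint_setI0 // cards0 subn0.
apply: eq_card => I; rewrite !inE.
apply/eqP/orP => [/patP[f [fm fo] EI]|]; last first.
  case=> /imsetP[I' + ->]; rewrite inE => /eqP /patP[f [fm fo] EI]; apply/patP.
    exists (fun i => lshift n (f i)); last by rewrite EI -imset_comp.
    by split => i j; [exact: fm|rewrite fo !permE !dsum_lshift].
  exists (fun i => rshift m (f i)); last by rewrite EI -imset_comp.
  by split => i j; [rewrite /= ltn_add2l fm|rewrite fo !permE !dsum_rshift /= ltn_add2l].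
have fl (i : 'I_(psize b)) (j : 'I_(psize b)) : i <= j -> f i <= f j.
  by rewrite leq_eqVlt => /orP[/eqP /val_inj -> //|]; rewrite -fm => /ltnW.
have [allr|] := boolP [forall i, m <= f i].
  right; apply/imsetP.
  have rs i : {k | f i = rshift m k}.
    have := forallP allr i; case: (fintype.splitP (f i)) => k E.
      by rewrite E leqNgt ltn_ord.
    by exists k; apply: val_inj.
  pose g i := sval (rs i); have gE i : f i = rshift m (g i) by rewrite /g; case: (rs i).
  exists (g @: setT); last by rewrite EI -imset_comp; apply: eq_imset => i; rewrite gE.
  rewrite inE; apply/eqP/patP; exists g => //; split => i j.
    by rewrite -fm !gE /= ltn_add2l.
  by rewrite fo !gE !permE !dsum_rshift /= ltn_add2l.
rewrite negb_forall => /existsP[i0]; rewrite -ltnNge => fi0.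
have [alll|] := boolP [forall i, f i < m].
  left; apply/imsetP.
  have rs i : {k | f i = lshift n k}.
    have := forallP alll i; case: (fintype.splitP (f i)) => k E.
      by exists k; apply: val_inj.
    by [].
  pose g i := sval (rs i); have gE i : f i = lshift n (g i) by rewrite /g; case: (rs i).
  exists (g @: setT); last by rewrite EI -imset_comp; apply: eq_imset => i; rewrite gE.
  rewrite inE; apply/eqP/patP; exists g => //; split => i j.
    by rewrite -fm !gE.
  by rewrite fo !gE !permE !dsum_lshift.
rewrite negb_forall => /existsP[j0]; rewrite -leqNgt => fj0.
exfalso.
(* The block would be cut at its first position mapped into the right summand. *)
pose P k := [exists i : 'I_(psize b), (k == i :> nat) && (m <= f i)].
have exP : exists k, P k by exists j0; apply/existsP; exists j0; rewrite eqxx.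
case: (ex_minnP exP) => k0 /existsP[i1 /andP[/eqP -> fi1]] min.
apply: (@block_split_hit b i1 bb).
  rewrite ltn_ord andbT; apply: leq_trans (_ : i0.+1 <= _) => //.
  by rewrite ltnNge; apply/negP => /fl; lia.
move=> i j ii1 i1j; rewrite fo.
have fi : f i < m.
  rewrite ltnNge; apply/negP => mi.
  have : i1 <= i by apply: min; apply/existsP; exists i; rewrite eqxx.
  by rewrite leqNgt ii1.
have fj : m <= f j by apply: leq_trans fi1 _; apply: fl.
case: (fintype.splitP (f i)) => k E; last by move: fi; rewrite E ltnNge leq_addr.
case: (fintype.splitP (f j)) => k' E'; first by move: fj; rewrite E' leqNgt ltn_ord.
have -> : f i = lshift n k by apply: val_inj.
have -> : f j = rshift m k' by apply: val_inj.
by rewrite !permE dsum_lshift dsum_rshift /= ltn_addr.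
Qed.

End permutations.

From mathcomp Require Import all_classical all_reals all_analysis measurable_realfun.

Import numFieldNormedType.Exports.
Local Open Scope classical_set_scope.
Local Open Scope ring_scope.

(** * Sums over words *)

Section esum_extra.
Context {R : realType}.
Local Open Scope ereal_scope.

(** Finite subsums give one inequality; the converse is the same inequality for [c^-1]. *)
Lemma esumZl (T : choiceType) (I : set T) (c : R) (a : T -> \bar R) :
  (0 <= c)%R -> (forall i, 0 <= a i) ->
  \esum_(i in I) (c%:E * a i) = c%:E * \esum_(i in I) a i.
Proof.
have le (c' : R) (b : T -> \bar R) : (0 <= c')%R -> (forall i, 0 <= b i) ->
    \esum_(i in I) (c'%:E * b i) <= c'%:E * \esum_(i in I) b i.
  move=> c0 b0; apply: ge_ereal_sup => _ [X [finX XI]] <-.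
  rewrite -ge0_mule_fsumr//.
  by apply: lee_wpmul2l; rewrite ?lee_fin//; apply: esum_ge; exists X.
move=> c0 a0; apply/eqP; rewrite eq_le le//=.
have [->|cn0] := eqVneq c 0%R.
  by rewrite mul0e; apply: esum_ge0 => i _; rewrite mul0e.
have -> : \esum_(i in I) a i = \esum_(i in I) (c^-1%:E * (c%:E * a i)).
  by apply: eq_esum => i _; rewrite muleA -EFinM mulVf// mul1e.
apply: (@le_trans _ _ (c%:E * (c^-1%:E * \esum_(i in I) (c%:E * a i)))).
  apply: lee_wpmul2l; rewrite ?lee_fin//; apply: le => [|i]; first by rewrite invr_ge0.
  by rewrite mule_ge0// lee_fin.
by rewrite muleA -EFinM mulfV// mul1e.
Qed.

Lemma esum_fiber (T T' : choiceType) (f : T -> T') (a : T -> \bar R) :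
  (forall i, 0 <= a i) ->
  \esum_(i in setT) a i = \esum_(j in setT) \esum_(i in [set i | f i = j]) a i.
Proof.
move=> a0; rewrite esum_esum//.
apply/esym; apply: (@reindex_esum R T _ setT _ (fun i => (f i, i)) (fun k => a k.2)).
split.
- by move=> i _ /=.
- by move=> i j _ _ [].
- by move=> [j i] /= [_ <-]; exists i.
Qed.

Lemma esum_pair (T T' : choiceType) (a : T * T' -> \bar R) :
  (forall i, 0 <= a i) ->
  \esum_(k in setT) a k = \esum_(i in setT) \esum_(j in setT) a (i, j).
Proof.
move=> a0; rewrite esum_esum//.
have -> : [set: T * T'] = [set: T] `*`` (fun=> [set: T']) by apply/seteqP; split.
by apply: eq_esum => -[].
Qed.

Lemma esum_seq (A : choiceType) (a : seq A -> \bar R) : (forall l, 0 <= a l) ->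
  \esum_(l in setT) a l =
  a [::] + \esum_(x in setT) \esum_(l in setT) a (x :: l).
Proof.
move=> a0; rewrite (esumID [set [::]])//; congr (_ + _).
  by rewrite setTI esum_set1.
rewrite setTI esum_esum//.
apply: (@reindex_esum R (A * seq A)%type (seq A) _ _ (fun k => k.1 :: k.2) a).
split=> [[x l]//|[x l] [x' l'] _ _ /= [-> ->]//|[|x l] /=]; first by move=> /(_ erefl).
by exists (x, l).
Qed.

Lemma esum_nat_le (a : nat -> \bar R) (C : \bar R) : (forall n, 0 <= a n) ->
  (forall n, \sum_(i < n) a i <= C) -> \esum_(i in setT) a i <= C.
Proof.
move=> a0 H; rewrite -nneseries_esumT//.
apply: lime_le; first exact: is_cvg_nneseries.
by near=> n; rewrite big_mkord.
Unshelve. all: by end_near. Qed.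

Lemma esum_size_le (A : choiceType) (a : seq A -> \bar R) (C : \bar R) :
  (forall l, 0 <= a l) ->
  (forall n, \esum_(l in [set l | (size l <= n)%N]) a l <= C) ->
  \esum_(l in setT) a l <= C.
Proof.
move=> a0 H; apply: ge_ereal_sup => _ [X [finX _]] <-.
have [n Hn] : exists n, X `<=` [set l | (size l <= n)%N].
  have [s ->] := (finite_seqP X).1 finX.
  exists (\max_(l <- s) size l) => l /= ls.
  exact: (@leq_bigmax_seq _ s predT size l).
by apply: le_trans (H n); apply: esum_ge; exists X.
Qed.

(** A word together with one of its size + 1 cuts is the same thing as a pair of words. *)
Lemma esum_cat (A : choiceType) (h : seq A -> seq A -> \bar R) :
  (forall u v, 0 <= h u v) ->
  \esum_(l in setT) \sum_(j < (size l).+1) h (take j l) (drop j l) =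
  \esum_(u in setT) \esum_(v in setT) h u v.
Proof.
move=> h0; rewrite -(esum_pair (a := fun k => h k.1 k.2))//.
rewrite (esum_fiber (fun k : seq A * seq A => k.1 ++ k.2))//.
apply: eq_esum => l _.
pose g (j : nat) := (take j l, drop j l).
have -> : [set k | k.1 ++ k.2 = l] = g @` `I_(size l).+1.
  apply/seteqP; split => [[u v] /= uvl|_ [j _ <-]/=]; last exact: cat_take_drop.
  have ul : (size u < (size l).+1)%N by rewrite -uvl size_cat ltnS leq_addr.
  by exists (size u) => //; rewrite /g /= -uvl take_size_cat// drop_size_cat.
rewrite (@esum_image R _ _ _ g (fun k => h k.1 k.2)).
  by rewrite esum_fset// (fsbig_ord _ _ (fun j => h (take j l) (drop j l))).
move=> i j; rewrite !inE /= => il jl [/(congr1 size)].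
by rewrite !size_takel.
Qed.

End esum_extra.

Section words.
Context {R : realType}.
Local Open Scope ereal_scope.

Definition wt (A : Type) (om : A -> R) (l : seq A) : R := (\prod_(a <- l) om a)%R.

Lemma wt_cons A (om : A -> R) x l : wt om (x :: l) = (om x * wt om l)%R.
Proof. by rewrite /wt big_cons. Qed.

Lemma wt_nil A (om : A -> R) : wt om [::] = 1%R.
Proof. by rewrite /wt big_nil. Qed.

Lemma wt_cat A (om : A -> R) l1 l2 : wt om (l1 ++ l2) = (wt om l1 * wt om l2)%R.
Proof. by rewrite /wt big_cat. Qed.

Lemma wt_ge0 A (om : A -> R) l : (forall a, 0 <= om a)%R -> (0 <= wt om l)%R.
Proof. by move=> om0; apply: prodr_ge0. Qed.

Section marg.
Variables (A B : choiceType) (f : A -> B) (om : A -> R) (om' : B -> R).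
Hypothesis om0 : forall a, (0 <= om a)%R.
Hypothesis om'0 : forall b, (0 <= om' b)%R.
Hypothesis omE : forall b, \esum_(a in [set a | f a = b]) (om a)%:E = (om' b)%:E.

(** Product weights model independent letters: a letterwise map pushes them to the product of the
    pushed weights. *)
Lemma wt_marg l' : \esum_(l in [set l | map f l = l']) (wt om l)%:E = (wt om' l')%:E.
Proof.
elim: l' => [|b l' IH].
  have -> : [set l | map f l = [::]] = [set [::]].
    by apply/seteqP; split => [[|//]|_ ->].
  by rewrite esum_set1 ?wt_nil.
rewrite esum_mkcond esum_seq; last by move=> l; case: ifP => // _; rewrite lee_fin wt_ge0.
rewrite memNset//= add0e.
transitivity (\esum_(x in [set a | f a = b]) ((om x)%:E * (wt om' l')%:E)).
  rewrite [RHS]esum_mkcond; apply: eq_esum => x _.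
  case: ifPn => [/set_mem /= fx|fx].
    rewrite -IH -esumZl// 1?esum_mkcond; last by move=> i; rewrite lee_fin wt_ge0.
    rewrite [RHS]esum_mkcond; apply: eq_esum => l _.
    have -> : (x :: l \in [set l | map f l = b :: l']) = (l \in [set l | map f l = l']).
      by apply/idP/idP => /set_mem /=; [move=> [_ H]|move=> H]; apply/mem_set => //=; rewrite ?H ?fx.
    by rewrite in_setT; case: ifP; rewrite // wt_cons EFinM.
  apply: esum1 => l _; case: ifPn => // /set_mem /= [fb _].
  by move: fx; rewrite -fb notin_setE /=.
under eq_esum do rewrite muleC.
by rewrite esumZl ?wt_ge0// ?omE ?wt_cons 1?mulrC.
Qed.

Lemma esum_marg (F : seq B -> R) : (forall l, 0 <= F l)%R ->
  \esum_(l in setT) (wt om l * F (map f l))%:E =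
  \esum_(l in setT) (wt om' l * F l)%:E.
Proof.
move=> F0.
have wF0 l : 0 <= (wt om l * F (map f l))%:E by rewrite lee_fin mulr_ge0// wt_ge0.
rewrite (esum_fiber (map f))//; apply: eq_esum => l' _.
transitivity (\esum_(l in [set l | map f l = l']) ((F l')%:E * (wt om l)%:E)).
  by apply: eq_esum => l /= <-; rewrite -EFinM mulrC.
rewrite esumZl// ?wt_marg ?EFinM 1?muleC// => l.
by rewrite lee_fin wt_ge0.
Qed.

End marg.

Lemma esum_wt_seq (A : choiceType) (om : A -> R) (F : seq A -> R) :
  (forall a, 0 <= om a)%R -> (forall l, 0 <= F l)%R ->
  \esum_(l in setT) (wt om l * F l)%:E =
  (F [::])%:E + \esum_(x in setT) ((om x)%:E * \esum_(l in setT) (wt om l * F (x :: l))%:E).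
Proof.
move=> om0 F0; have wF0 G l : (forall l, 0 <= G l)%R -> 0 <= (wt om l * G l)%:E.
  by move=> G0; rewrite lee_fin mulr_ge0// wt_ge0.
rewrite esum_seq => [|l]; last exact: wF0.
rewrite wt_nil mul1r; congr (_ + _); apply: eq_esum => x _.
rewrite -esumZl// => [|l]; last by apply: (wF0 (fun l => F (x :: l))).
by apply: eq_esum => l _; rewrite wt_cons -mulrA EFinM.
Qed.

End words.

(** * First passage *)
Section lyapunov.
Context {R : realType}.
Variables (q mu rho : R).
Hypotheses (q0 : 0 < q) (q1 : q < 1) (mu1 : 1 < mu).
Hypotheses (rhoE : rho = q * mu) (rho0 : 0 < rho) (rho1 : rho < 1).

(** These factors decrease from [c0] towards 1. Their decrease from r to r + 1 pays for the jumps of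
    the level up to height r, whose mean cost is [rho ^+ r * c r]. *)
Let c (r : nat) := expR ((1 - rho)^-2 * rho ^+ r).
Let U (w : nat) := 1 + \sum_(j < w) mu ^+ j.+1 * c j.+1.
Let c0 := expR ((1 - rho)^-2).
Let K := c0 * mu / (mu - 1).

Ltac slra := move: q0 q1 mu1 rho0 rho1; lra.

Let c_ge1 r : 1 <= c r.
Proof.
rewrite /c -[leLHS]expR0 ler_expR mulr_ge0 ?invr_ge0 ?exprn_ge0 ?subr_ge0//; exact: ltW.
Qed.

Let c_le r : c r <= c0.
Proof.
rewrite /c /c0 ler_expR ler_piMr// ?invr_ge0 ?exprn_ge0 ?exprn_ile1//; slra.
Qed.

(** With x = [rho ^+ r], the ratio of [c r.+1] to [c r] is exp(- x / (1 - rho)). It is at most 1 - x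
    because 1 + x / (1 - rho) >= 1 / (1 - x) for x <= rho; this dictates the exponent
    [(1 - rho)^-2]. *)
Let c_step r : (0 < r)%N -> c r * rho ^+ r <= c r - c r.+1.
Proof.
move=> r0.
have d0 : 0 < 1 - rho by slra.
set x := rho ^+ r.
have x0 : 0 < x by rewrite exprn_gt0.
have xr : x <= rho by rewrite /x -(prednK r0) exprS ler_piMr ?exprn_ile1//; slra.
suff H : c r.+1 <= c r * (1 - x) by rewrite -/x; slra.
have -> : c r.+1 = c r * expR (- ((1 - rho)^-1 * x)).
  rewrite /c -expRD [rho ^+ r.+1]exprSr; congr expR.
  by rewrite -/x; field; rewrite gt_eqF.
rewrite ler_wpM2l ?(le_trans _ (c_ge1 r))// expRN.
rewrite -[leRHS]invrK lef_pV2 ?posrE ?expR_gt0 ?invr_gt0//; last slra.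
apply: le_trans (expR_ge1Dx _).
rewrite -lerBlDl -(ler_pM2r (_ : 0 < 1 - x)); last slra.
rewrite mulrBl mulVf ?mul1r; last slra.
have -> : 1 - (1 - x) = x by ring.
by rewrite -mulrA mulrC -[leLHS]mulr1 -mulrA ler_pM2l// ler_pdivlMr; slra.
Qed.

Let U_ge1 w : 1 <= U w.
Proof.
rewrite lerDl; apply: sumr_ge0 => j _; rewrite mulr_ge0// ?exprn_ge0//; first slra.
by apply: le_trans (c_ge1 _).
Qed.

Let US w : U w.+1 = U w + mu ^+ w.+1 * c w.+1.
Proof. by rewrite /U big_ord_recr /= addrA. Qed.

Let U_le w : U w <= K * mu ^+ w.
Proof.
have m0 : 0 < mu - 1 by slra.
have c01 : 1 <= c0 by apply: le_trans (c_ge1 0) (c_le 0).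
elim: w => [|w IH].
  by rewrite /U big_ord0 addr0 expr0 mulr1 /K ler_pdivlMr// mul1r; nra.
rewrite US; apply: le_trans (lerD IH (_ : _ <= mu ^+ w.+1 * c0)) _.
  by rewrite ler_wpM2l// exprn_ge0; slra.
rewrite exprS /K; have -> : c0 * mu / (mu - 1) * (mu * mu ^+ w) =
   c0 * mu / (mu - 1) * mu ^+ w + mu * mu ^+ w * c0 by field; slra.
by [].
Qed.

Let step_bound w n : (0 < w)%N ->
  \sum_(z < n) (1 - q) * q ^+ z * U (lstep w z) <= U w - mu ^+ w.
Proof.
move=> w0.
(* The second term places at [N] the whole mass [q ^+ N] of the letters that are at least [N]. The
   left side is constant in [N] while [N.+1 < w]; afterwards each step adds [rho ^+ N.+1 * c N.+1],
   which [c_step] compensates by the decrease of the third term. *)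
have inv N : \sum_(z < N) (1 - q) * q ^+ z * U (lstep w z) +
    q ^+ N * U (lstep w N) + c (maxn w N.+1) <= U w.-1 + c w.
  elim: N => [|N IH].
    by rewrite big_ord0 add0r expr0 mul1r /lstep maxn0 (maxn_idPl _)//.
  rewrite big_ord_recr /=; apply: le_trans IH.
  case: (leqP w N.+1) => wN.
    have -> : lstep w N.+1 = N.+1 by rewrite /lstep; lia.
    have -> : lstep w N = N by rewrite /lstep; lia.
    have -> : maxn w N.+2 = N.+2 by lia.
    rewrite US.
    have := @c_step N.+1 isT; rewrite rhoE exprMn => H.
    rewrite exprS in H *; set a := q ^+ N in H *; set b := mu ^+ N.+1 in H *.
    set s := \sum_(i < _) _; move: q0 q1; nra.
  have -> : lstep w N.+1 = w.-1 by rewrite /lstep; lia.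
  have -> : lstep w N = w.-1 by rewrite /lstep; lia.
  have -> : maxn w N.+2 = w by lia.
  rewrite exprS; set a := q ^+ N; set s := \sum_(i < _) _; set u := U _.
  by rewrite le_eqVlt; apply/orP; left; apply/eqP; ring.
have := inv n; have := c_ge1 (maxn w n.+1).
have : 0 <= q ^+ n * U (lstep w n).
  by rewrite mulr_ge0 ?exprn_ge0 ?(le_trans _ (U_ge1 _))//; slra.
have -> : U w = U w.-1 + mu ^+ w * c w by rewrite -[in LHS](prednK w0) US prednK.
have := c_ge1 w; have : 1 <= mu ^+ w by rewrite exprn_ege1//; slra.
set s := \sum_(i < _) _; set m := mu ^+ w; set cw := c w.
move: q0 q1; nra.
Qed.

Let c01 : 1 <= c0. Proof. by apply: le_trans (c_ge1 0) (c_le 0). Qed.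

Let K1 : 1 < K.
Proof. by rewrite /K ltr_pdivlMr ?subr_gt0// mul1r; move: c01 mu1; nra. Qed.

(* U grows like mu ^ w with q mu < 1, and the decreasing factors c give a strict
   contraction at every level. *)
Lemma lyapunov_aux : exists (th : R) (V : nat -> R), [/\ 1 < th, forall w, 1 <= V w &
  forall w, (\esum_(z in setT) ((1 - q) * q ^+ z * V (lstep w z))%:E <=
    (th^-1 * V (maxn w 1))%:E)%E].
Proof.
(* The drift [- mu ^+ w] is at most [- U w / K], which gives the contraction factor 1 - 1 / K. *)
exists (K / (K - 1)), U; split => [||w].
- by rewrite ltr_pdivlMr; move: K1; slra.
- exact: U_ge1.
(* A step from level 0 has the same effect as a step from level 1, whence the [maxn w 1]. *)
have -> : lstep w = lstep (maxn w 1) by apply/funext => z; rewrite /lstep; case: w.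
set w' := maxn w 1; have w'0 : (0 < w')%N by rewrite /w'; lia.
apply: esum_nat_le => n.
  by rewrite lee_fin !mulr_ge0 ?exprn_ge0 ?(le_trans _ (U_ge1 _))//; slra.
rewrite sumEFin lee_fin; apply: le_trans (step_bound _ w'0) _.
have -> : (K / (K - 1))^-1 * U w' = U w' - U w' / K.
  by field; move: K1 => ?; apply/andP; split; apply: lt0r_neq0; slra.
by rewrite lerD2l lerN2 ler_pdivrMr ?(mulrC _ K)//; move: K1; slra.
Qed.

End lyapunov.

Lemma lyapunov (R : realType) (q : R) : 0 < q < 1 ->
  exists (th : R) (V : nat -> R), [/\ 1 < th, forall w, 1 <= V w &
  forall w, (\esum_(z in setT) ((1 - q) * q ^+ z * V (lstep w z))%:E <=
    (th^-1 * V (maxn w 1))%:E)%E].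
Proof.
move=> /andP[q0 q1]; have q10 : 0 < 1 + q by lra.
(* Any [mu] strictly between 1 and 1 / q would do. *)
apply: (@lyapunov_aux R q (2 / (1 + q)) (q * (2 / (1 + q)))) => //.
- by rewrite ltr_pdivlMr//; lra.
- by rewrite mulr_gt0// divr_gt0.
- by rewrite mulrA ltr_pdivrMr//; lra.
Qed.

(** * The negative binomial series *)

Section series.
Context {R : realType}.
Local Open Scope ereal_scope.

Lemma esum_natS (a : nat -> \bar R) : (forall n, 0 <= a n) ->
  \esum_(n in setT) a n = a 0%N + \esum_(n in setT) a n.+1.
Proof.
move=> a0; rewrite (esumID [set 0%N])//; congr (_ + _).
  by rewrite setTI esum_set1.
rewrite setTI; apply: (@reindex_esum R nat nat _ _ S a).
by split=> [n //=|m n _ _ []//|[|n] //= _]; exists n.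
Qed.

Lemma esum_nat_shift (m : nat) (a : nat -> \bar R) : (forall n, 0 <= a n) ->
  (forall n, (n < m)%N -> a n = 0) ->
  \esum_(n in setT) a n = \esum_(n in setT) a (m + n)%N.
Proof.
elim: m a => // m IH a a0 am.
by rewrite esum_natS// am// add0e (IH (fun n => a n.+1))// => n nm; apply: am.
Qed.

(** By Pascal's rule the series T_y satisfy T_(y+1) = T_y + c T_(y+1). This can be solved for
    T_(y+1) only when it is finite, so a bound on the partial sums ([fin]) comes before the
    value. *)
Lemma neg_binomial (c : R) (y : nat) : (0 <= c < 1)%R ->
  \esum_(k in setT) ('C(y + k, y)%:R * c ^+ k)%:E = ((1 - c) ^- y.+1)%:E.
Proof.
move=> /andP[c0 c1]; have c10 : (0 < 1 - c)%R by rewrite subr_gt0.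
have t0 y' k : (0 <= 'C(y' + k, y')%:R * c ^+ k)%R by rewrite mulr_ge0// exprn_ge0.
have pas y' k : ('C(y'.+1 + k.+1, y'.+1)%:R * c ^+ k.+1 =
    'C(y' + k.+1, y')%:R * c ^+ k.+1 + c * ('C(y'.+1 + k, y'.+1)%:R * c ^+ k))%R.
  by rewrite addSn binS addnS -addSn natrD exprS; ring.
have fin y' : \esum_(k in setT) ('C(y' + k, y')%:R * c ^+ k)%:E <= ((1 - c) ^- y'.+1)%:E.
  apply: esum_nat_le => [k|n]; first by rewrite lee_fin.
  rewrite sumEFin lee_fin.
  have step (a b : nat -> R) (M : R) : (forall k, 0 <= a k)%R -> a 0%N = b 0%N ->
      (forall k, a k.+1 = b k.+1 + c * a k)%R ->
      (forall n, (\sum_(k < n) b k <= M)%R) ->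
      forall n', (\sum_(k < n') a k <= (1 - c)^-1 * M)%R.
    move=> a0 ab0 ab bM n'; rewrite ler_pdivlMl//.
    case: n' => [|n']; first by rewrite !big_ord0 mulr0 (le_trans _ (bM 0%N))// big_ord0.
    apply: le_trans (bM n'.+1).
    rewrite [leRHS]big_ord_recl -ab0.
    have E : (\sum_(k < n'.+1) a k = a 0%N + (\sum_(k < n') b k.+1 + c * \sum_(k < n') a k))%R.
      rewrite big_ord_recl; congr (_ + _)%R; under eq_bigr do rewrite ab.
      by rewrite big_split /= mulr_sumr.
    have : (\sum_(i < n') a i <= \sum_(k < n'.+1) a k)%R by rewrite big_ord_recr lerDl.
    move=> /(ler_wpM2l c0); rewrite E => H.
    rewrite mulrBl mul1r; lra.
  elim: y' n => [|y' IHy] n.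
    rewrite expr1 -[leRHS]mulr1; apply: (step (fun k => 'C(0 + k, 0)%:R * c ^+ k)%R (fun k => (k == 0%N)%:R) 1%R) => //.
    - by rewrite bin0 mul1r.
    - by move=> k; rewrite !bin0 !mul1r add0r exprS.
    - by case=> [|m]; rewrite ?big_ord0// big_ord_recl big1 ?addr0.
  rewrite exprS invfM; apply: (step (fun k => 'C(y'.+1 + k, y'.+1)%:R * c ^+ k)%R (fun k => 'C(y' + k, y')%:R * c ^+ k)%R) => //.
  by rewrite !addn0 !binn.
have fin' y' : \esum_(k in setT) ('C(y' + k, y')%:R * c ^+ k)%:E \is a fin_num.
  rewrite ge0_fin_numE ?(le_lt_trans (fin y')) ?ltry//.
  by apply: esum_ge0 => k _; rewrite lee_fin.
have solve (T b : \bar R) (r : R) : T \is a fin_num -> T = b + c%:E * T ->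
    b = r%:E -> T = ((1 - c)^-1 * r)%:E.
  case: T => // t _ E bE; move: E; rewrite bE -EFinM -EFinD => -[tE].
  congr EFin; apply: (@mulfI _ (1 - c)%R); rewrite ?gt_eqF//.
  by rewrite mulrA mulfV ?gt_eqF// mul1r; lra.
elim: y => [|y IH].
  rewrite (solve _ 1 1%R (fin' 0%N)) ?mulr1 ?expr1//.
  rewrite [LHS]esum_natS => [|n]; last by rewrite lee_fin.
  rewrite bin0 expr0 mulr1; congr (_ + _); rewrite -esumZl//.
    by apply: eq_esum => k _; rewrite !bin0 !mul1r -EFinM exprS.
  by move=> k; rewrite lee_fin.
rewrite (solve _ _ _ (fin' y.+1) _ IH) ?exprS ?invfM//.
rewrite [LHS]esum_natS => [|n]; last by rewrite lee_fin.
rewrite [X in _ = X + _]esum_natS => [|n]; last by rewrite lee_fin.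
rewrite !addn0 !binn -esumZl//; last by move=> k; rewrite lee_fin.
rewrite -addeA -esumD; first last.
- by move=> k _; rewrite -EFinM lee_fin mulr_ge0.
- by move=> k _; rewrite lee_fin.
by congr (_ + _); apply: eq_esum => k _; rewrite -EFinM -EFinD pas.
Qed.

End series.

(** * The return time of the level *)

Section first_passage.
Context {R : realType}.
Variable q : R.
Hypothesis q01 : 0 < q < 1.
Local Open Scope ereal_scope.

Definition om1 (p : R) (z : nat) : R := ((1 - p) * p ^+ z)%R.

Lemma om1_ge0 (p : R) z : (0 <= p <= 1)%R -> (0 <= om1 p z)%R.
Proof. by move=> /andP[p0 p1]; rewrite mulr_ge0 ?exprn_ge0 ?subr_ge0. Qed.

Lemma om1_sum (p : R) : (0 <= p < 1)%R -> \esum_(z in setT) (om1 p z)%:E = 1.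
Proof.
move=> p01; have /andP[p0 p1] := p01.
under eq_esum do rewrite /om1 EFinM.
rewrite esumZl ?subr_ge0 1?ltW// => [|z]; last by rewrite lee_fin exprn_ge0.
have -> : \esum_(z in setT) (p ^+ z)%:E = \esum_(z in setT) ('C(0 + z, 0)%:R * p ^+ z)%:E.
  by apply: eq_esum => z _; rewrite bin0 mul1r.
by rewrite neg_binomial// -EFinM expr1 mulfV// subr_eq0 gt_eqF.
Qed.

Fixpoint alive (w : nat) (l : seq nat) : bool :=
  if l is z :: l' then (lstep w z != 0%N) && alive (lstep w z) l' else true.

Lemma esum_wt_nilp (A : choiceType) (om : A -> R) (F : seq A -> R) :
  (forall a, 0 <= om a)%R -> (0 <= F [::])%R ->
  \esum_(l in setT) (wt om l * ((nilp l)%:R * F l))%:E = (F [::])%:E.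
Proof.
move=> om0 F0; rewrite (esumID [set [::]])//; last first.
  move=> l _; rewrite lee_fin mulr_ge0// ?wt_ge0//; case: l => [|a l]; by rewrite ?mul1r// mul0r.
rewrite setTI esum_set1; last by rewrite wt_nil !mul1r.
rewrite wt_nil !mul1r esum1 ?adde0// => -[|a l] [] //= _ _.
by rewrite mul0r mulr0.
Qed.

Let om := om1 q.
Let om0 z : (0 <= om z)%R.
Proof. by apply: om1_ge0; have /andP[/ltW -> /ltW ->] := q01. Qed.

Let omsum : \esum_(z in setT) (om z)%:E = 1.
Proof. by apply: om1_sum; have /andP[/ltW -> ->] := q01. Qed.

Let mono_om (f g : nat -> \bar R) : (forall z, f z <= g z) ->
  \esum_(z in setT) ((om z)%:E * f z) <= \esum_(z in setT) ((om z)%:E * g z).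
Proof. by move=> fg; apply: le_esum => z _; apply: lee_wpmul2l; rewrite ?lee_fin. Qed.

(** Up to the return time, [th ^+ n] times [V] of the level is a supermartingale. The moments
    truncated at length [n] are therefore bounded by [V (maxn w 1)], uniformly in [n]. *)
Lemma hit_exp_moment : exists2 th : R, (1 < th)%R &
  forall w, \esum_(l in setT) (wt om l * ((hit w l)%:R * th ^+ size l))%:E < +oo.
Proof.
have [th [V [th1 V1 HV]]] := lyapunov q01; have th0 : (0 < th)%R by apply: lt_trans th1.
have V0 w : (0 <= V w)%R by apply: le_trans (V1 w).
exists th => // w; apply: (@le_lt_trans _ _ (V (maxn w 1))%:E); last exact: ltry.
have F0 w' (l : seq nat) : (0 <= (hit w' l)%:R * th ^+ size l)%R.
  by rewrite mulr_ge0// exprn_ge0// ltW.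
apply: esum_size_le => [l|n]; first by rewrite lee_fin mulr_ge0// wt_ge0.
have -> : \esum_(l in [set l | (size l <= n)%N]) (wt om l * ((hit w l)%:R * th ^+ size l))%:E =
   \esum_(l in setT) (wt om l * ((size l <= n)%:R * ((hit w l)%:R * th ^+ size l)))%:E.
  rewrite esum_mkcond; apply: eq_esum => l _; case: ifPn => [/set_mem /= ->|].
    by rewrite mul1r.
  by rewrite notin_setE /= => /negP/negPf ->; rewrite mul0r mulr0.
elim: n w => [|n IH] w; rewrite esum_wt_seq//=; try by move=> l; rewrite mulr_ge0.
  rewrite !(mulr0,mul0r) add0e esum1 ?lee_fin// => x _.
  by rewrite esum1 ?mule0// => l _; rewrite mul0r mulr0.
rewrite !(mulr0,mul0r) add0e.
apply: le_trans (mono_om (g := fun z => (th * V (lstep w z))%:E) _) _.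
  move=> z; case: (boolP (lstep w z == 0%N)) => w0.
    have -> : \esum_(l in setT) (wt om l * (((size l).+1 <= n.+1)%N%:R *
       ((nilp l)%:R * th ^+ (size l).+1)))%:E =
       \esum_(l in setT) (wt om l * ((nilp l)%:R * th ^+ (size l).+1))%:E.
      by apply: eq_esum => -[|x l] _ //=; rewrite ?mul1r// !(mul0r, mulr0).
    rewrite (esum_wt_nilp (F := fun l => (th ^+ (size l).+1)%R))/= ?expr1 ?(ltW th0)//.
    by rewrite lee_fin ler_peMr ?V1// ltW.
  have -> : \esum_(l in setT) (wt om l * (((size l).+1 <= n.+1)%N%:R *
       ((hit (lstep w z) l)%:R * th ^+ (size l).+1)))%:E =
    \esum_(l in setT) (th%:E * (wt om l * ((size l <= n)%N%:R *
       ((hit (lstep w z) l)%:R * th ^+ size l)))%:E).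
    by apply: eq_esum => l _; rewrite -EFinM ltnS exprS; congr EFin; ring.
  rewrite esumZl; [|exact: ltW|]; last first.
    by move=> l; rewrite lee_fin mulr_ge0 ?wt_ge0// mulr_ge0// F0.
  rewrite EFinM lee_wpmul2l ?lee_fin ?(ltW th0)//.
  by have := IH (lstep w z); rewrite (maxn_idPl _)// lt0n.
under eq_esum => z _ do rewrite -EFinM mulrCA EFinM.
rewrite esumZl ?(ltW th0)//; last by move=> z; rewrite lee_fin mulr_ge0.
apply: le_trans (lee_wpmul2l _ (HV w)) _; rewrite ?lee_fin ?(ltW th0)//.
by rewrite mulrA mulfV ?mul1r// gt_eqF.
Qed.

(** After [n] letters the level has either returned to 0 or not ([total]), and the second case has
    mass at most [th ^- n * V (maxn w 1)] ([dead]), which tends to 0. *)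
Lemma hit_sum1 w : \esum_(l in setT) (wt om l * (hit w l)%:R)%:E = 1.
Proof.
have [th [V [th1 V1 HV]]] := lyapunov q01; have th0 : (0 < th)%R by apply: lt_trans th1.
have V0 w' : (0 <= V w')%R by apply: le_trans (V1 w').
have thn0 k : (0 <= th ^- k)%R by rewrite invr_ge0 exprn_ge0// ltW.
have wF0 (F : seq nat -> R) l : (forall l, 0 <= F l)%R -> 0 <= (wt om l * F l)%:E.
  by move=> F0; rewrite lee_fin mulr_ge0// wt_ge0.
have nil1 : \esum_(l in setT) (wt om l * (nilp l)%:R)%:E = 1.
  under eq_esum do rewrite -[(nilp _)%:R]mulr1.
  exact: (@esum_wt_nilp _ om (fun=> 1%R)).
have total n : forall w, \esum_(l in setT)
    (wt om l * (((size l <= n)%N && hit w l)%:R + ((size l == n) && alive w l)%:R))%:E = 1.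
  elim: n => [|n IH] {}w; rewrite esum_wt_seq//=.
    rewrite add0r esum1 ?adde0// => x _.
    by rewrite esum1 ?mule0// => l _; rewrite addr0 mulr0.
  rewrite addr0 add0e -[RHS]omsum; apply: eq_esum => z _.
  suff -> : \esum_(l in setT) (wt om l * ((((size l).+1 <= n.+1)%N && (if lstep w z == 0%N then nilp l
      else hit (lstep w z) l))%:R + (((size l).+1 == n.+1) && ((lstep w z != 0%N) &&
      alive (lstep w z) l))%:R))%:E = 1 by rewrite mule1.
  case: (boolP (lstep w z == 0%N)) => w0 /=.
    rewrite -[RHS]nil1; apply: eq_esum => l _; rewrite andbF addr0.
    by case: l => //= a l; rewrite andbF.
  by rewrite -[RHS](IH (lstep w z)); apply: eq_esum => l _; rewrite ltnS eqSS.
have dead n : forall w, \esum_(l in setT) (wt om l * ((size l == n) && alive w l)%:R)%:E <=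
    (th ^- n * V (maxn w 1))%:E.
  elim: n => [|n IH] {}w; rewrite esum_wt_seq//=.
    rewrite esum1 ?adde0 ?expr0 ?invr1 ?mul1r ?lee_fin// => x _.
    by rewrite esum1 ?mule0// => l _; rewrite mulr0.
  rewrite add0e.
  apply: le_trans (mono_om (g := fun z => (th ^- n * V (lstep w z))%:E) _) _.
    move=> z; case: (eqVneq (lstep w z) 0%N) => w0 /=.
      rewrite esum1 ?lee_fin ?mulr_ge0// => l _.
      by rewrite andbF mulr0.
    have := IH (lstep w z); rewrite (maxn_idPl _) ?lt0n//; move=> H; apply: le_trans _ H.
  under eq_esum => z _ do rewrite -EFinM mulrCA EFinM.
  rewrite esumZl//; last by move=> z; rewrite lee_fin mulr_ge0.
  apply: le_trans (lee_wpmul2l _ (HV w)) _; rewrite ?lee_fin//.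
  by rewrite exprSr invfM mulrA.
apply/eqP; rewrite eq_le; apply/andP; split.
  apply: esum_size_le => [l|n]; first exact: (wF0 (fun l => (hit w l)%:R)).
  rewrite -(total n w) [leLHS]esum_mkcond; apply: le_esum => l _.
  case: ifPn => [/set_mem /= ->|_]; last first.
    by apply: (wF0 (fun l => ((size l <= n)%N && hit w l)%:R + ((size l == n) && alive w l)%:R)%R) => ?; rewrite addr_ge0.
  by rewrite lee_fin ler_wpM2l ?wt_ge0//= lerDl.
apply/lee_addgt0Pr => e e0.
have [n Hn] : exists n, (th ^- n * V (maxn w 1) <= e)%R.
  have bern n : (1 + n%:R * (th - 1) <= th ^+ n)%R.
    elim: n => [|n IH]; first by rewrite mul0r addr0 expr0.
    rewrite exprS -natr1; have := ler_wpM2l (ltW th0) IH.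
    have : (0 <= n%:R * (th - 1) ^+ 2)%R by rewrite mulr_ge0// sqr_ge0.
    rewrite expr2; set N := n%:R; nra.
  have Ve : (0 <= V (maxn w 1) / e / (th - 1))%R by rewrite !divr_ge0// ?subr_ge0 ltW.
  exists (Num.bound (V (maxn w 1) / e / (th - 1))).
  rewrite mulrC ler_pdivrMr ?exprn_gt0// mulrC -ler_pdivrMr//.
  apply: le_trans (bern _); rewrite -lerBlDl.
  apply: (@le_trans _ _ (V (maxn w 1) / e)%R); first by rewrite gerBl.
  by rewrite -ler_pdivrMr ?subr_gt0// ltW// archi_boundP.
rewrite -(total n w).
under eq_esum do rewrite mulrDr EFinD.
rewrite esumD; first last.
- by move=> l _; apply: (wF0 (fun l => ((size l == n) && alive w l)%:R)).
- by move=> l _; apply: (wF0 (fun l => ((size l <= n)%N && hit w l)%:R)).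
apply: leeD; last by apply: le_trans (dead n w) _; rewrite lee_fin.
apply: le_esum => l _; rewrite lee_fin ler_wpM2l ?wt_ge0//.
by case: (_ <= _)%N.
Qed.

End first_passage.

(** * Laws of the letters *)

Section letters.
Context {R : realType}.
Local Open Scope ereal_scope.

(* om2 s t and om3 s t q are the laws of (R_s - 1, R_t - 1) and of
   (R_s - 1, R_t - 1, R_q - 1) for a geometric birth process R. *)
Definition phi (s : R) : R := (s / (1 - s))%R.

Definition om2 (s t : R) (a : nat * nat) : R :=
  ((1 - t) ^+ a.2.+1 * 'C(a.2, a.1)%:R * phi s ^+ a.1 * (phi t - phi s) ^+ (a.2 - a.1))%R.

Definition om3 (s t q : R) (a : nat * nat * nat) : R :=
  ((1 - q) ^+ a.2.+1 * 'C(a.2, a.1.2)%:R * 'C(a.1.2, a.1.1)%:R *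
   phi s ^+ a.1.1 * (phi t - phi s) ^+ (a.1.2 - a.1.1) *
   (phi q - phi t) ^+ (a.2 - a.1.2))%R.

Lemma bin_trinomial (x k z : nat) : (x + k <= z)%N ->
  ('C(z, x + k) * 'C(x + k, x) = 'C(z, x) * 'C(z - x, k))%N.
Proof.
move=> xkz; apply/eqP; rewrite -(@eqn_pmul2r (x`! * (k`! * (z - (x + k))`!))); last first.
  by rewrite !muln_gt0 !fact_gt0.
have h1 := bin_fact xkz.
have h2 := @bin_fact (x + k) x (leq_addr _ _); rewrite addKn in h2.
have h3 := @bin_fact z x (leq_trans (leq_addr _ _) xkz).
have h4 : ('C(z - x, k) * (k`! * (z - (x + k))`!) = (z - x)`!)%N.
  by rewrite subnDA bin_fact//; lia.
apply/eqP; transitivity z`!%N; first by rewrite -h1 -h2; ring.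
by rewrite -h3 -h4; ring.
Qed.

Lemma esum_nat_fin n (a : nat -> \bar R) : (forall k, 0 <= a k) ->
  (forall k, (n < k)%N -> a k = 0) ->
  \esum_(k in setT) a k = \sum_(k < n.+1) a k.
Proof.
elim: n a => [|n IH] a a0 an; rewrite esum_natS// big_ord_recl /=.
  by rewrite esum1 ?big_ord0// => k _; apply: an.
by congr (_ + _); rewrite (IH (fun k => a k.+1))// => k nk; apply: an.
Qed.

Lemma phi_le (s t : R) : (s <= t)%R -> (t < 1)%R -> (phi s <= phi t)%R.
Proof.
move=> st t1; rewrite /phi ler_pdivrMr ?subr_gt0; last lra.
rewrite mulrAC ler_pdivlMr ?subr_gt0//; nra.
Qed.

Lemma phi_ge0 (s : R) : (0 <= s < 1)%R -> (0 <= phi s)%R.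
Proof. by move=> /andP[s0 s1]; rewrite divr_ge0// subr_ge0 ltW. Qed.

Lemma phiM (s : R) : (s < 1)%R -> ((1 - s) * phi s = s)%R.
Proof. by move=> s1; rewrite /phi mulrCA mulfV ?mulr1// subr_eq0 gt_eqF. Qed.

Section fixed.
Variables s t q : R.
Hypotheses (s0 : (0 <= s)%R) (st : (s <= t)%R) (tq : (t <= q)%R) (q1 : (q < 1)%R).

Let s1 : (s < 1)%R. Proof. by apply: le_lt_trans st _; apply: le_lt_trans tq _. Qed.
Let t1 : (t < 1)%R. Proof. by apply: le_lt_trans tq _. Qed.
Let ps0 : (0 <= phi s)%R. Proof. by apply: phi_ge0; rewrite s0 s1. Qed.
Let pst : (0 <= phi t - phi s)%R. Proof. by rewrite subr_ge0 phi_le. Qed.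
Let ptq : (0 <= phi q - phi t)%R. Proof. by rewrite subr_ge0 phi_le. Qed.
Let qq : (0 <= 1 - q)%R. Proof. by rewrite subr_ge0 ltW. Qed.
Let tt : (0 <= 1 - t)%R. Proof. by rewrite subr_ge0 ltW. Qed.

Lemma om2_ge0 a : (0 <= om2 s t a)%R.
Proof. by rewrite /om2 !mulr_ge0 ?exprn_ge0. Qed.

Lemma om3_ge0 a : (0 <= om3 s t q a)%R.
Proof. by rewrite /om3 !mulr_ge0 ?exprn_ge0. Qed.

Lemma om3_good a : ~~ (a.1.1 <= a.1.2 <= a.2)%N -> om3 s t q a = 0%R.
Proof.
rewrite negb_and -!ltnNge => /orP[] H; rewrite /om3 (bin_small H); ring.
Qed.

(** The sum over z is a negative binomial series of ratio c = (1 - q) (phi q - phi t), for which 1 -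
    c = (1 - q) / (1 - t). *)
Lemma om3_marg_xy b : \esum_(a in [set a | a.1 = b]) (om3 s t q a)%:E = (om2 s t b)%:E.
Proof.
case: b => x y.
rewrite (@reindex_esum R nat _ setT _ (fun z => (x, y, z))); last first.
  by split=> [z _ //|i j _ _ []//|[a z] /= ->]; exists z.
rewrite (@esum_nat_shift _ y) => [|n|n ny]; last 2 first.
- by rewrite lee_fin om3_ge0.
- by rewrite om3_good//= negb_and -!ltnNge ny orbT.
set c := ((1 - q) * (phi q - phi t))%R.
have c0 : (0 <= c)%R by rewrite mulr_ge0.
have d0 : (0 < 1 - t)%R by rewrite subr_gt0.
have cE : (1 - c = (1 - q) / (1 - t))%R.
  by rewrite /c mulrBr phiM// /phi; field; rewrite gt_eqF.
have c1 : (c < 1)%R by rewrite -subr_gt0 cE divr_gt0// subr_gt0.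
set K := ((1 - q) ^+ y.+1 * 'C(y, x)%:R * phi s ^+ x * (phi t - phi s) ^+ (y - x))%R.
have K0 : (0 <= K)%R by rewrite /K !mulr_ge0 ?exprn_ge0.
transitivity (\esum_(k in setT) (K%:E * ('C(y + k, y)%:R * c ^+ k)%:E)).
  apply: eq_esum => k _; rewrite -EFinM /om3 /= addKn /K /c -addSn exprD.
  by rewrite [(((1 - q) * _) ^+ k)%R]exprMn; congr EFin; ring.
rewrite esumZl//; last by move=> k; rewrite lee_fin mulr_ge0 ?exprn_ge0.
rewrite neg_binomial ?c0// -EFinM /K /om2 /= cE [((_ / (1 - t)) ^+ _)%R]expr_div_n invf_div.
congr EFin; field; rewrite !expf_neq0 ?gt_eqF// subr_gt0//.
Qed.

(** Trinomial revision takes out 'C(z, x); what remains is the binomial theorem for [phi q - phi s],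
    split at [phi t]. *)
Lemma om3_marg_xz b :
  \esum_(a in [set a | (a.1.1, a.2) = b]) (om3 s t q a)%:E = (om2 s q b)%:E.
Proof.
case: b => x z.
rewrite (@reindex_esum R nat _ setT _ (fun y => (x, y, z))); last first.
  by split=> [y _ //|i j _ _ []//|[[x' y'] z'] /= [-> ->]]; exists y'.
rewrite (@esum_nat_shift _ x) => [|n|n ny]; last 2 first.
- by rewrite lee_fin om3_ge0.
- by rewrite om3_good//= negb_and -!ltnNge ny.
case: (ltnP z x) => zx.
  rewrite esum1 => [|k _]; first by rewrite /om2 /= bin_small//; congr EFin; ring.
  by rewrite om3_good//= negb_and -!ltnNge; apply/orP; right; lia.
rewrite (@esum_nat_fin (z - x)) => [|n|k zk]; last 2 first.
- by rewrite lee_fin om3_ge0.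
- by rewrite om3_good//= negb_and -!ltnNge; apply/orP; right; lia.
rewrite sumEFin /om2 /=; congr EFin.
have -> : (phi q - phi s = (phi q - phi t) + (phi t - phi s))%R by ring.
rewrite [X in _ = (_ * X)%R]exprDn mulr_sumr; apply: eq_bigr => k _.
rewrite /om3 /= addKn -[(_ *+ 'C(z - x, k))%R]mulr_natr.
have -> : (z - (x + k) = z - x - k)%N by rewrite subnDA.
have kz : (k <= z - x)%N by rewrite -ltnS.
have -> : ((1 - q) ^+ z.+1 * 'C(z, x + k)%:R * 'C(x + k, x)%:R = (1 - q) ^+ z.+1 * ('C(z, x)%:R * 'C(z - x, k)%:R))%R.
  rewrite -mulrA -!natrM; congr (_ * _%:R)%R.
  by rewrite bin_trinomial//; lia.
ring.
Qed.

Lemma om3_marg_yz b :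
  \esum_(a in [set a | (a.1.2, a.2) = b]) (om3 s t q a)%:E = (om2 t q b)%:E.
Proof.
case: b => y z.
rewrite (@reindex_esum R nat _ setT _ (fun x => (x, y, z))); last first.
  by split=> [x _ //|i j _ _ []//|[[x' y'] z'] /= [-> ->]]; exists x'.
rewrite (@esum_nat_fin y) => [|n|k yk]; last 2 first.
- by rewrite lee_fin om3_ge0.
- by rewrite om3_good//= negb_and -!ltnNge yk.
rewrite sumEFin /om2 /=; congr EFin.
rewrite -[X in (_ * X ^+ y * _)%R](subrK (phi s)).
rewrite [X in _ = (_ * X * _)%R]exprDn mulr_sumr mulr_suml; apply: eq_bigr => k _.
rewrite /om3 /= -mulr_natr; ring.
Qed.

Lemma om2_marg_y b : \esum_(a in [set a | a.2 = b]) (om2 s t a)%:E = (om1 t b)%:E.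
Proof.
rewrite (@reindex_esum R nat _ setT _ (fun x => (x, b))); last first.
  by split=> [x _ //|i j _ _ []//|[x' y'] /= ->]; exists x'.
rewrite (@esum_nat_fin b) => [|n|k yk]; last 2 first.
- by rewrite lee_fin om2_ge0.
- by rewrite /om2 /= bin_small//; congr EFin; ring.
rewrite sumEFin /om1 /=; congr EFin.
have -> : ((1 - t) * t ^+ b = (1 - t) ^+ b.+1 * ((phi t - phi s) + phi s) ^+ b)%R.
  by rewrite subrK exprS -mulrA -exprMn phiM.
rewrite [X in _ = (_ * X)%R]exprDn mulr_sumr; apply: eq_bigr => k _.
rewrite /om2 /= -mulr_natr; ring.
Qed.

Definition om3d (a : nat * nat * nat) : R := (om3 s t q a * (a.1.1 == a.1.2)%:R)%R.

(** Given z, the vector (x, y - x, z - y) is multinomial with probabilities proportional to [phi s],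
    [phi t - phi s] and [phi q - phi t]. The event x = y means that none of the z units falls into
    the middle class. *)
Lemma om3_marg_diag b : (0 < q)%R ->
  \esum_(a in [set a | a.2 = b]) (om3d a)%:E =
  (om1 q b * (1 - (phi t - phi s) / phi q) ^+ b)%:E.
Proof.
move=> q0; have pq : (0 < phi q)%R by rewrite divr_gt0// subr_gt0.
have od0 a : (0 <= om3d a)%R by rewrite mulr_ge0// om3_ge0.
transitivity (\esum_(a in setT) if a.2 == b then (om3d a)%:E else 0).
  rewrite esum_mkcond; apply: eq_esum => a _.
  by case: ifPn => [/set_mem /= ->|]; rewrite ?eqxx// notin_setE /= => /eqP/negPf ->.
rewrite (esum_fiber (fun a : nat * nat * nat => a.1.1)); last first.
  by move=> a; case: ifP; rewrite ?lee_fin.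
transitivity (\esum_(x in setT) (om3 s t q (x, x, b))%:E).
  apply: eq_esum => x _.
  rewrite (esumID [set (x, x, b)]).
    have -> : [set a | a.1.1 = x] `&` [set (x, x, b)] = [set (x, x, b)].
      by apply/seteqP; split => [a [_ ->]//|a ->].
    rewrite esum_set1 /= ?eqxx /om3d ?eqxx/= ?mulr1 ?lee_fin ?om3_ge0//.
    rewrite esum1 ?adde0// => -[[x' y'] z'] /= [xx ne].
    case: (eqVneq z' b) => // zb; rewrite xx; case: (eqVneq x y'); rewrite ?mulr0// => xy.
    by case: ne; rewrite xx zb xy.
  by move=> a _; case: ifP; rewrite ?lee_fin.
rewrite (@esum_nat_fin b) => [|n|k yk]; last 2 first.
- by rewrite lee_fin om3_ge0.
- by rewrite om3_good//= negb_and -!ltnNge yk orbT.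
rewrite sumEFin; congr EFin.
have -> : (om1 q b * (1 - (phi t - phi s) / phi q) ^+ b =
  (1 - q) ^+ b.+1 * ((phi q - phi t) + phi s) ^+ b)%R.
  rewrite /om1 exprS -!mulrA -!exprMn; congr (_ * _ ^+ _)%R.
  by rewrite -{1}(phiM q1); field; rewrite gt_eqF.
rewrite [X in _ = (_ * X)%R]exprDn mulr_sumr; apply: eq_bigr => k _.
rewrite /om3 /= -mulr_natr subnn binn; ring.
Qed.

End fixed.
End letters.

(** * Renewal decomposition of words *)

Section closed_words.
Variables (A : Type) (f : A -> nat).
Local Open Scope nat_scope.

Definition cl (l : seq A) : bool := level 0 (map f l) == 0.
Definition blk (l : seq A) : bool := hit 0 (map f l).

Lemma blk_cl l : blk l -> cl l.
Proof. by move=> /hit_level/eqP. Qed.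

Lemma cl_cat p l : cl p -> cl (p ++ l) = cl l.
Proof. by rewrite /cl map_cat level_cat => /eqP ->. Qed.

Lemma cl_suffix p l : cl (p ++ l) -> cl l.
Proof. by rewrite /cl -!adm_level map_cat; apply: adm_catr. Qed.

Lemma blk_proper a1 a2 : blk (a1 ++ a2) -> 0 < size a1 -> 0 < size a2 -> ~~ cl a1.
Proof.
rewrite /blk /cl map_cat => /hit_neq0 H s1 s2; apply: H; rewrite -size_eq0 size_map -lt0n//.
Qed.

Lemma last_block l : cl l -> 0 < size l -> exists p a, [/\ l = p ++ a, cl p & blk a].
Proof.
have [n] := ubnP (size l); elim: n l => // n IH l ln cl_l l0.
have : adm (map f l) by rewrite adm_level.
move=> /hit_split[|l1 [l2 [E h1 a2]]]; first by rewrite -size_eq0 size_map -lt0n.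
have E1 : map f (take (size l1) l) = l1 by rewrite map_take E take_size_cat.
have E2 : map f (drop (size l1) l) = l2 by rewrite map_drop E drop_size_cat.
set m := size l1 in E1 E2.
have b1 : blk (take m l) by rewrite /blk E1.
have [l20|l20] := eqVneq (size (drop m l)) 0.
  exists [::], (take m l); split => //.
  by rewrite -[LHS](cat_take_drop m) (size0nil l20) cats0.
have m0 : 0 < m by rewrite lt0n size_eq0 (hit_nnil h1).
have dn : size (drop m l) < n by rewrite size_drop; lia.
have cd : cl (drop m l) by rewrite /cl E2 -adm_level.
rewrite -lt0n in l20; have [p' [a [E' cp ba]]] := IH _ dn cd l20.
exists (take m l ++ p'), a; split => //.
  by rewrite -catA -E' cat_take_drop.
by rewrite cl_cat// blk_cl.
Qed.

Lemma blk_nnil a : blk a -> 0 < size a.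
Proof. by move=> /hit_nnil; rewrite -size_eq0 size_map -lt0n. Qed.

Variables (R : nmodType) (k : seq A -> seq A -> R) (G : seq A -> R).
Local Open Scope ring_scope.

(** At most one cut contributes, the one before the last block of a closed word. Writing the value
    as a sum over all cuts allows [esum_cat] to turn it into a sum over pairs of words. *)
Definition blkT (l : seq A) : R :=
  \sum_(i < (size l).+1) if cl (take i l) && blk (drop i l) then k (take i l) (drop i l) else 0.

Lemma blkT0 l : ~~ cl l -> blkT l = 0.
Proof.
move=> ncl; apply: big1 => i _; case: ifP => // /andP[c b].
by have := cl_cat (drop i l) c; rewrite cat_take_drop (blk_cl b) (negPf ncl).
Qed.

(** Any other cut would produce a closed proper prefix of a block: of the final factor if it lies
    inside [p], of [a] itself if it lies inside [a]. Both contradict [blk_proper]. *)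
Lemma blkT_last p a : cl p -> blk a -> blkT (p ++ a) = k p a.
Proof.
move=> cp ba; have a0 := blk_nnil ba.
have pi : (size p < (size (p ++ a)).+1)%N by rewrite size_cat; lia.
rewrite /blkT (bigD1 (Ordinal pi))//= take_size_cat// drop_size_cat// cp ba /=.
rewrite big1 ?addr0// => i ip; case: ifP => // /andP[ci bi]; exfalso.
have ip' : (i : nat) != size p by apply: contra ip => /eqP ip; apply/eqP/val_inj.
have il : (i <= size p + size a)%N by rewrite -size_cat -ltnS.
case: (ltngtP i (size p)) ip' => // lti _.
  move: ci bi; rewrite take_cat drop_cat lti => ci bi.
  have := blk_proper bi; rewrite size_drop subn_gt0 lti a0 => /(_ isT isT) /negP[].
  by apply: (@cl_suffix (take i p)); rewrite cat_take_drop.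
have nlt : (i < size p)%N = false by lia.
move: ci bi; rewrite take_cat drop_cat nlt cl_cat// => ci bi.
have := blk_nnil bi; rewrite size_drop => sz.
move: ba; rewrite -(cat_take_drop (i - size p) a) => /blk_proper.
by rewrite size_takel ?size_drop; [rewrite ci; lia|lia].
Qed.

Hypothesis G0 : G [::] = 0.
Hypothesis GE : forall p a, cl p -> blk a -> G (p ++ a) = G p + k p a.

(** Only the prefixes that end with a complete block contribute, and [G] grows by [k] at each of
    them. *)
Lemma telescope_blocks l : cl l -> \sum_(j < (size l).+1) blkT (take j l) = G l.
Proof.
have [n] := ubnP (size l); elim: n l => // n IH l ln cl_l.
case: (posnP (size l)) => l0.
  rewrite (size0nil l0) G0 big_ord_recl big_ord0 addr0 /= /blkT big_ord_recl big_ord0.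
  by rewrite /= addr0.
have [p [a [E cp ba]]] := last_block cl_l l0.
have a0 := blk_nnil ba.
have pl : (size p < size l)%N by rewrite E size_cat; lia.
rewrite E GE// -(IH p) -?(blkT_last cp ba)//; last by lia.
rewrite size_cat -addSn.
rewrite -(big_mkord xpredT (fun j => blkT (take j (p ++ a)))).
rewrite (@big_cat_nat _ _ _ (size p).+1)//=; last lia.
rewrite big_mkord; congr (_ + _).
  by apply: eq_bigr => j _; rewrite takel_cat// -ltnS.
rewrite -(prednK a0) addnS big_nat_recr/=; last lia.
rewrite big_nat_cond big1 ?add0r; last first.
  move=> j; rewrite andbT => /andP[j1 j2]; apply: blkT0.
  rewrite take_cat ltnNge (ltnW j1) /= cl_cat//.
  have := @blk_proper (take (j - size p) a) (drop (j - size p) a).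
  by rewrite cat_take_drop; apply => //; rewrite ?size_takel ?size_drop; lia.
by rewrite addSnnS prednK// -size_cat take_size.
Qed.

End closed_words.

(** * Prefixes of block words *)

Section pre.
Local Open Scope nat_scope.

(* The word can be continued so that the level hits 0 for the first time at its end. *)
Fixpoint pre (w : nat) (l : seq nat) : bool :=
  if l is z :: l' then if lstep w z == 0 then nilp l' else pre (lstep w z) l'
  else true.

Lemma pre_cat w p a : a != [::] -> pre w (p ++ a) = alive w p && pre (level w p) a.
Proof.
move=> a0; elim: p w => //= z p IH w; rewrite /level /= -/(level _ p).
by case: (lstep w z == 0) => //=; case: p {IH} => //=; case: (a) a0.
Qed.

Lemma lstep_le w w' y z : w <= w' -> y <= z -> lstep w y <= lstep w' z.
Proof. by rewrite /lstep; lia. Qed.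

Definition good (l : seq (nat * nat * nat)) : bool :=
  all (fun a => a.1.1 <= a.1.2 <= a.2) l.

Definition xs (l : seq (nat * nat * nat)) := map (fun a => a.1.1) l.
Definition ys (l : seq (nat * nat * nat)) := map (fun a => a.1.2) l.
Definition zs (l : seq (nat * nat * nat)) := map snd l.

Lemma level_ys_zs w w' l : good l -> w <= w' -> level w (ys l) <= level w' (zs l).
Proof.
elim: l w w' => //= -[[x y] z] l IH w w' /= /andP[/andP[_ yz] gl] ww.
exact/IH/lstep_le.
Qed.

(** The z-level dominates the y-level, so it cannot return to 0 strictly before the y-level does. *)
Lemma hit_pre w w' l : good l -> w <= w' -> hit w (ys l) -> pre w' (zs l).
Proof.
elim: l w w' => //= -[[x y] z] l IH w w' /= /andP[/andP[_ yz] gl] ww.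
have st := lstep_le ww yz.
case: ifPn => [/eqP w0|w0] H.
  by move: H; case: l {IH gl} => //= _; case: ifP.
have -> : (lstep w' z == 0) = false by lia.
exact: IH H.
Qed.

(** The possibility of completing [p ++ a] to a q-block depends on [p] only. This decouples the last
    y-block from its past and makes the Wald identity possible. *)
Lemma pre_alive p a : good p -> good a -> hit 0 (ys a) ->
  pre 0 (zs (p ++ a)) = alive 0 (zs p).
Proof.
move=> gp ga ha; rewrite /zs map_cat pre_cat; last first.
  by move: (hit_nnil ha); rewrite -!size_eq0 !size_map.
by rewrite (hit_pre ga (leq0n _) ha) andbT.
Qed.

End pre.

(** * Moments of a q-block through its y-blocks *)

Section wald.
Context {R : realType}.
Local Open Scope ereal_scope.

(** Induction on [k] at base [Num.sqrt th]: one factor of the square absorbs the power [k], the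
    other one absorbs the additional linear factor by Bernoulli's inequality. *)
Lemma pow_le_exp (k : nat) (th : R) : (1 < th)%R ->
  exists2 C : R, (0 <= C)%R & forall n, (n.+1%:R ^+ k <= C * th ^+ n)%R.
Proof.
elim: k th => [|k IH] th th1.
  by exists 1%R => // n; rewrite expr0 mul1r exprn_ege1// ltW.
have r0 : (0 < th)%R by lra.
set r := Num.sqrt th; have rr : (r * r = th)%R by rewrite -expr2 sqr_sqrtr// ltW.
have rp : (0 <= r)%R by rewrite sqrtr_ge0.
have r1 : (1 < r)%R by nra.
have [C C0 HC] := IH r r1.
have bern n : (n%:R * (r - 1) <= r ^+ n)%R.
  have : (1 + n%:R * (r - 1) <= r ^+ n)%R.
    elim: n => [|n IHn]; first by rewrite mul0r addr0 expr0.
    rewrite exprS -natr1; have := ler_wpM2l rp IHn.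
    have : (0 <= n%:R * (r - 1) ^+ 2)%R by rewrite mulr_ge0// sqr_ge0.
    rewrite expr2; set N := n%:R%R; nra.
  lra.
have d0 : (0 < r - 1)%R by lra.
exists (C * (r / (r - 1)))%R; first by rewrite mulr_ge0// divr_ge0// ltW.
move=> n; rewrite exprSr -rr exprMn.
have -> : (C * (r / (r - 1)) * (r ^+ n * r ^+ n) = (C * r ^+ n) * (r ^+ n.+1 / (r - 1)))%R.
  by rewrite exprS; ring.
by apply: ler_pM => //; rewrite ?exprn_ge0// ler_pdivlMr.
Qed.

Definition poly_growth (A : Type) (f : seq A -> R) : Prop :=
  (forall l, 0 <= f l)%R /\ exists k (C : R), forall l, (f l <= C * (size l).+1%:R ^+ k)%R.

Lemma pbM A (f g : seq A -> R) : poly_growth f -> poly_growth g -> poly_growth (fun l => f l * g l)%R.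
Proof.
move=> [f0 [k [C fC]]] [g0 [k' [C' gC]]]; split=> [l|]; first exact: mulr_ge0.
exists (k + k')%N, (C * C')%R => l; rewrite exprD mulrACA.
exact: ler_pM.
Qed.

Lemma pb_size A : poly_growth (fun l : seq A => (size l)%:R)%R.
Proof.
split=> [l //|]; exists 1%N, 1%R => l; by rewrite mul1r expr1 ler_nat.
Qed.

Lemma pb_lift A B (h : A -> B) f : poly_growth f -> poly_growth (fun l => f (map h l)).
Proof.
move=> [f0 [k [C fC]]]; split=> [l //|]; exists k, C => l.
by apply: le_trans (fC _) _; rewrite size_map.
Qed.

Lemma esum_sep (T T' : choiceType) (w : T -> R) (b : T' -> R) (r : R) :
  (forall i, 0 <= w i)%R -> (forall j, 0 <= b j)%R ->
  \esum_(j in setT) (b j)%:E = r%:E ->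
  \esum_(i in setT) \esum_(j in setT) (w i * b j)%:E =
  r%:E * \esum_(i in setT) (w i)%:E.
Proof.
move=> w0 b0 br; have r0 : (0 <= r)%R.
  by rewrite -lee_fin -br; apply: esum_ge0 => j _; rewrite lee_fin.
rewrite -esumZl//.
apply: eq_esum => i _; by rewrite muleC -br -esumZl.
Qed.

(* E3 s t q F is the expectation of F at the word of the triples
   (R_(i,s) - 1, R_(i,t) - 1, r_i(B)) of a q-block process; E2 s t is the case q = t. *)
Definition E2 (s t : R) (f : seq (nat * nat) -> R) : \bar R :=
  \esum_(l in setT) (wt (om2 s t) l * ((hit 0 (map snd l))%:R * f l))%:E.

Definition E3 (s t q : R) (F : seq (nat * nat * nat) -> R) : \bar R :=
  \esum_(l in setT) (wt (om3 s t q) l * ((hit 0 (zs l))%:R * F l))%:E.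

Definition block_additive (f : seq (nat * nat) -> R) : Prop :=
  forall p a, cl snd p -> cl snd a -> f (p ++ a) = (f p + f a)%R.

Lemma addf0 f : block_additive f -> f [::] = 0%R.
Proof. by move=> /(_ [::] [::] isT isT) /=; lra. Qed.

Section fixed.
Variables s t q : R.
Hypotheses (s0 : (0 <= s)%R) (st : (s <= t)%R) (tq : (t <= q)%R) (q0 : (0 < q)%R) (q1 : (q < 1)%R).

Let om := om3 s t q.
Let omp0 a : (0 <= om a)%R. Proof. exact: om3_ge0. Qed.
Let om20 a : (0 <= om2 s t a)%R. Proof. exact: (om2_ge0 s0 st tq q1). Qed.
Let wt0 l : (0 <= wt om l)%R. Proof. exact: wt_ge0. Qed.
Let q01 : (0 < q < 1)%R. Proof. by rewrite q0 q1. Qed.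
Let t0 : (0 <= t)%R. Proof. exact: le_trans s0 st. Qed.

Lemma wt_good l : ~~ good l -> wt om l = 0%R.
Proof.
elim: l => //= a l IH; rewrite negb_and wt_cons => /orP[/om3_good H|/IH ->]; last by rewrite mulr0.
by rewrite /om H mul0r.
Qed.

Lemma E3_zs (F : seq nat -> R) : (forall l, 0 <= F l)%R ->
  \esum_(l in setT) (wt om l * F (zs l))%:E = \esum_(l in setT) (wt (om1 q) l * F l)%:E.
Proof.
move=> F0.
transitivity (\esum_(l in setT) (wt om l * F (map snd (map (fun a : nat * nat * nat => (a.1.2, a.2)) l)))%:E).
  by apply: eq_esum => l _; rewrite -map_comp.
have o20 a : (0 <= om2 t q a)%R by exact: om2_ge0.
rewrite (@esum_marg R _ _ _ om (om2 t q) omp0 o20 (om3_marg_yz s0 st tq q1) (fun l => F (map snd l)))//.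
rewrite (@esum_marg R _ _ _ (om2 t q) (om1 q) o20)// => [b|b].
  by apply: om1_ge0; rewrite !ltW.
exact: om2_marg_y.
Qed.

(** A prefix that can still be completed is completed with probability one, by [hit_sum1]. *)
Lemma completion1 w a :
  \esum_(m in setT) (wt (om1 q) m * (hit w (a ++ m))%:R)%:E = (pre w a)%:R%:E.
Proof.
have o0 b : (0 <= om1 q b)%R by apply: om1_ge0; rewrite !ltW.
elim: a w => [|z a IH] w /=; first exact: hit_sum1.
case: ifP => _; last exact: IH.
case: a {IH} => [|a' a] /=; last by rewrite esum1// => m _; rewrite mulr0.
under eq_esum do rewrite -[(nilp _)%:R]mulr1.
exact: (@esum_wt_nilp _ _ (om1 q) (fun=> 1%R)).
Qed.

Lemma completion u :
  \esum_(m in setT) (wt om m * (hit 0 (zs (u ++ m)))%:R)%:E = (pre 0 (zs u))%:R%:E.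
Proof.
rewrite -(completion1 0 (zs u)) -(@E3_zs (fun m => (hit 0 (zs u ++ m))%:R)%R)//.
by apply: eq_esum => m _; rewrite /zs map_cat.
Qed.

Lemma E3_fin F : poly_growth F -> E3 s t q F \is a fin_num.
Proof.
move=> [F0 [k [C FC]]].
have [th th1 thm] := hit_exp_moment q01.
have [C' C'0 HC] := pow_le_exp k th1.
have C0 : (0 <= C)%R.
  by have := le_trans (F0 [::]) (FC [::]); rewrite /= expr1n mulr1.
rewrite ge0_fin_numE; last by apply: esum_ge0 => l _; rewrite lee_fin !mulr_ge0.
apply: (@le_lt_trans _ _ ((C * C')%:E * \esum_(l in setT) (wt (om1 q) l * ((hit 0 l)%:R * th ^+ size l))%:E)).
  have th0 : (0 <= th)%R by rewrite ltW// (lt_trans _ th1).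
  rewrite -(@E3_zs (fun l => (hit 0 l)%:R * th ^+ size l)%R) => [|l]; last first.
    by rewrite mulr_ge0// exprn_ge0.
  rewrite -esumZl ?mulr_ge0//; last by move=> l; rewrite lee_fin !mulr_ge0 ?exprn_ge0.
  apply: le_esum => l _; rewrite -EFinM lee_fin [leRHS]mulrCA ler_wpM2l// [leRHS]mulrCA ler_wpM2l//.
  apply: le_trans (FC _) _; rewrite -mulrA ler_wpM2l// size_map; exact: HC.
by have := thm 0%N; rewrite -ge0_fin_numE; [move=> H; rewrite lte_mul_pinfty ?lee_fin ?mulr_ge0// ltey_eq H|apply: esum_ge0 => l _; rewrite lee_fin mulr_ge0 ?wt_ge0 ?mulr_ge0 ?exprn_ge0 ?(le_trans _ (ltW th1))// => b; apply: om1_ge0; rewrite !ltW].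
Qed.

(** The expectation over y-blocks written on triples; the third letters are unconstrained and sum
    out, as [MuE] shows. *)
Definition Mu (f : seq (nat * nat) -> R) : \bar R :=
  \esum_(a in setT) (wt om a * ((hit 0 (ys a))%:R * f (map fst a)))%:E.

Lemma MuE f : (forall l, 0 <= f l)%R -> Mu f = E2 s t f.
Proof.
move=> f0; rewrite /E2 -(@esum_marg R _ _ fst om (om2 s t) omp0 om20 (om3_marg_xy s0 st tq q1) (fun l => (hit 0 (map snd l))%:R * f l)%R) => [|l]; last exact: mulr_ge0.
by apply: eq_esum => l _; rewrite -map_comp.
Qed.

(** A y-block is a prefix of q-blocks, and its completions have total mass 1. The sum is thus at
    most that of [f] over all prefixes of a q-block. This route includes [t = 0], where
    [hit_exp_moment] does not apply. *)
Lemma E2_fin f : poly_growth f -> E2 s t f \is a fin_num.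
Proof.
move=> pf; have [f0 [k [C fC]]] := pf.
have C0 : (0 <= C)%R.
  by have := le_trans (f0 [::]) (fC [::]); rewrite /= expr1n mulr1.
rewrite -MuE// ge0_fin_numE; last by apply: esum_ge0 => l _; rewrite lee_fin !mulr_ge0.
pose F (l : seq (nat * nat * nat)) := ((size l).+1%:R * (C * (size l).+1%:R ^+ k))%R.
have pF : poly_growth F.
  split=> [l|]; first by rewrite !mulr_ge0// exprn_ge0.
  by exists k.+1, C => l; rewrite /F exprS mulrCA.
apply: (@le_lt_trans _ _ (E3 s t q F)); last by rewrite ltey_eq E3_fin.
pose h u v := (wt om (u ++ v) * ((hit 0 (zs (u ++ v)))%:R * ((hit 0 (ys u))%:R * f (map fst u))))%:E.
apply: (@le_trans _ _ (\esum_(u in setT) \esum_(v in setT) h u v)).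
  apply: le_esum => u _.
  case: (boolP (good u)) => gu; last first.
    by rewrite wt_good// mul0r; apply: esum_ge0 => v _; rewrite lee_fin !mulr_ge0.
  case: (boolP (hit 0 (ys u))) => hu; last first.
    by rewrite mul0r mulr0; apply: esum_ge0 => v _; rewrite lee_fin !mulr_ge0.
  apply: (@le_trans _ _ ((wt om u * f (map fst u))%:E * \esum_(m in setT) (wt om m * (hit 0 (zs (u ++ m)))%:R)%:E)).
    by rewrite completion (hit_pre gu (leqnn 0) hu) mule1 mul1r.
  rewrite -esumZl ?mulr_ge0//; last by move=> v; rewrite lee_fin mulr_ge0.
  by apply: le_esum => v _; rewrite -EFinM lee_fin wt_cat hu mul1r le_eqVlt; apply/orP; left; apply/eqP; ring.
rewrite -esum_cat; last by move=> u v; rewrite lee_fin !mulr_ge0.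
apply: le_esum => l _; rewrite /h sumEFin lee_fin.
under eq_bigr => j _ do rewrite cat_take_drop.
rewrite -mulr_sumr ler_wpM2l// -mulr_sumr ler_wpM2l//.
rewrite /F -[X in (X%:R * _)%R](card_ord (size l).+1) mulr_natl -sumr_const.
apply: ler_sum => j _; apply: (@le_trans _ _ (f (map fst (take j l)))).
  by rewrite ler_piMl//; case: (hit _ _).
apply: le_trans (fC _) _; rewrite ler_wpM2l// lerXn2r ?nnegrE// ler_nat size_map ltnS.
by rewrite size_take_min geq_minr.
Qed.

(** Weight of a past at the end of which a new y-block starts while the q-block is still
    unfinished. *)
Let W p := (wt om p * ((level 0 (ys p) == 0%N) && alive 0 (zs p))%:R)%R.

(* Sum over the decompositions of a block word as p ++ a ++ m with a the last
   y-block before m; the completions m have total mass 1. *)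
Lemma wald_kernel (k : seq (nat * nat * nat) -> seq (nat * nat * nat) -> R)
    (G : seq (nat * nat * nat) -> R) :
  (forall p a, 0 <= k p a)%R -> (forall l, 0 <= G l)%R -> G [::] = 0%R ->
  (forall p a, level 0 (ys p) == 0%N -> hit 0 (ys a) -> G (p ++ a) = G p + k p a)%R ->
  E3 s t q G = \esum_(p in setT) \esum_(a in setT)
     (W p * (wt om a * ((hit 0 (ys a))%:R * k p a)))%:E.
Proof.
move=> k0 G0 Gn Gk.
pose f (a : nat * nat * nat) := a.1.2.
have T0 u : (0 <= blkT f k u)%R by apply: sumr_ge0 => i _; case: ifP.
transitivity (\esum_(l in setT) \sum_(j < (size l).+1)
    (wt om (take j l) * wt om (drop j l) * ((hit 0 (zs (take j l ++ drop j l)))%:R * blkT f k (take j l)))%:E).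
  apply: eq_esum => l _; rewrite sumEFin.
  under eq_bigr => j _ do rewrite -wt_cat cat_take_drop.
  rewrite -mulr_sumr; case: (boolP (good l)) => gl; last by rewrite wt_good// !mul0r.
  congr (_ * _)%:E; rewrite -mulr_sumr.
  case: (boolP (hit 0 (zs l))) => hl; last by rewrite !mul0r.
  rewrite !mul1r (telescope_blocks (f := f) (G := G))//.
  have := level_ys_zs gl (leqnn 0); rewrite (hit_level hl).
  by rewrite /cl leqn0.
rewrite (esum_cat (h := fun u v => (wt om u * wt om v * ((hit 0 (zs (u ++ v)))%:R * blkT f k u))%:E)); last first.
  by move=> u v; rewrite lee_fin !mulr_ge0.
transitivity (\esum_(l in setT) \sum_(j < (size l).+1)
    (W (take j l) * (wt om (drop j l) * ((hit 0 (ys (drop j l)))%:R * k (take j l) (drop j l))))%:E).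
  apply: eq_esum => u _.
  transitivity ((wt om u * blkT f k u)%:E * \esum_(m in setT) (wt om m * (hit 0 (zs (u ++ m)))%:R)%:E).
    rewrite -esumZl ?mulr_ge0//; last by move=> v; rewrite lee_fin mulr_ge0.
    by apply: eq_esum => v _; rewrite -EFinM; congr EFin; ring.
  (* The completion [m] has been summed out; it remains to replace [pre] on [p ++ a] by [alive] on
     [p], so that the weight factorizes. *)
  rewrite completion -EFinM sumEFin; congr EFin.
  rewrite /blkT mulr_sumr mulr_suml; apply: eq_bigr => i _.
  have -> : wt om u = (wt om (take i u) * wt om (drop i u))%R by rewrite -wt_cat cat_take_drop.
  have -> : zs u = zs (take i u ++ drop i u) by rewrite cat_take_drop.
  rewrite /W; set p := take i u; set a := drop i u.
  rewrite /cl /blk -/(ys p) -/(ys a).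
  case: (boolP (level 0 (ys p) == 0%N)) => cp; last by rewrite !(mulr0, mul0r).
  case: (boolP (hit 0 (ys a))) => ha; last by rewrite !(mulr0, mul0r).
  case: (boolP (good p)) => gp; last by rewrite (wt_good gp) !mul0r.
  case: (boolP (good a)) => ga; last by rewrite (wt_good ga) !(mul0r, mulr0).
  by rewrite pre_alive//= mul1r; ring.
rewrite (esum_cat (h := fun u v => (W u * (wt om v * ((hit 0 (ys v))%:R * k u v)))%:E))//.
by move=> u v; rewrite lee_fin /W !mulr_ge0.
Qed.

Let W0 p : (0 <= W p)%R. Proof. by rewrite mulr_ge0. Qed.

(** The expected number of y-blocks in a q-block. [Gam f] is the expected sum, over these y-blocks,
    of [f] at the part of the word that precedes each of them. *)
Definition kap : \bar R := \esum_(p in setT) (W p)%:E.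
Definition Gam (f : seq (nat * nat) -> R) : \bar R :=
  \esum_(p in setT) (W p * f (map fst p))%:E.

Let muf (f : seq (nat * nat) -> R) : (forall l, 0 <= f l)%R -> poly_growth f ->
  \esum_(a in setT) (wt om a * ((hit 0 (ys a))%:R * f (map fst a)))%:E = (fine (E2 s t f))%:E.
Proof. by move=> f0 pf; rewrite fineK ?E2_fin// -MuE. Qed.

Lemma cl_ys p : (level 0 (ys p) == 0%N) = cl snd (map fst p).
Proof. by rewrite /cl -map_comp. Qed.

Lemma wald1_e f : block_additive f -> poly_growth f ->
  E3 s t q (fun l => f (map fst l)) = (fine (E2 s t f))%:E * kap.
Proof.
move=> af pf; have f0 := pf.1.
rewrite (@wald_kernel (fun p a => f (map fst a)))//=; last 2 first.
- exact: addf0.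
- by move=> p a cp ha; rewrite map_cat af// -cl_ys// hit_level.
by rewrite (esum_sep W0 _ (muf f0 pf))// => a; rewrite !mulr_ge0.
Qed.

(** The increment of the product when a block [a] is appended to [p] is f(a) g(p) + g(a) f(p) + f(a)
    g(a), and in each term the past separates from the block. *)
Lemma wald2_e f g : block_additive f -> poly_growth f -> block_additive g -> poly_growth g ->
  E3 s t q (fun l => f (map fst l) * g (map fst l))%R =
  (fine (E2 s t f))%:E * Gam g + (fine (E2 s t g))%:E * Gam f +
  (fine (E2 s t (fun l => f l * g l)%R))%:E * kap.
Proof.
move=> af pf ag pg; have f0 := pf.1; have g0 := pg.1.
pose k (p a : seq (nat * nat * nat)) := (f (map fst a) * g (map fst p) +
  g (map fst a) * f (map fst p) + f (map fst a) * g (map fst a))%R.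
rewrite (@wald_kernel k)//=; last 4 first.
- by move=> p a; rewrite /k !addr_ge0// mulr_ge0.
- by move=> l; rewrite mulr_ge0.
- by rewrite addf0// mul0r.
- move=> p a cp ha.
  have ca : cl snd (map fst a) by rewrite -cl_ys hit_level.
  by rewrite cl_ys in cp; rewrite map_cat af// ag// /k; ring.
have fg0 l : (0 <= f l * g l)%R by rewrite mulr_ge0.
have sep h (v : seq (nat * nat * nat) -> R) : (forall l, 0 <= h l)%R -> poly_growth h -> (forall p, 0 <= v p)%R ->
    \esum_(p in setT) \esum_(a in setT) (W p * v p * (wt om a * ((hit 0 (ys a))%:R * h (map fst a))))%:E =
    (fine (E2 s t h))%:E * \esum_(p in setT) (W p * v p)%:E.
  move=> h0 ph v0; rewrite (@esum_sep _ _ (fun p => W p * v p)%R _ _ _ _ (muf h0 ph))// => [p|a].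
    by rewrite mulr_ge0.
  by rewrite !mulr_ge0.
have kapE : kap = \esum_(p in setT) (W p * 1)%:E.
  by apply: eq_esum => p _; rewrite mulr1.
rewrite kapE /Gam -!sep//; last exact: pbM.
rewrite -!esumD; first last.
all: try (move=> p _; rewrite ?adde_ge0//; apply: esum_ge0 => a _; rewrite lee_fin !mulr_ge0//).
apply: eq_esum => p _; rewrite -!esumD; first last.
all: try (move=> a _; rewrite -?EFinD lee_fin ?addr_ge0 ?mulr_ge0//).
by apply: eq_esum => a _; rewrite -!EFinD /k; congr EFin; ring.
Qed.

Lemma addf_size : block_additive (fun l => (size l)%:R)%R.
Proof. by move=> p a _ _; rewrite size_cat natrD. Qed.

Lemma E2_size_gt0 : (0 < fine (E2 s t (fun l => (size l)%:R)))%R.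
Proof.
have t1 : (t < 1)%R by apply: le_lt_trans tq q1.
have fin := E2_fin (pb_size _).
rewrite fine_gt0// -ge0_fin_numE ?fin ?andbT; last first.
  by apply: esum_ge0 => l _; rewrite lee_fin mulr_ge0// wt_ge0.
apply: (@lt_le_trans _ _ (1 - t)%:E); first by rewrite lte_fin subr_gt0.
rewrite /E2 (esumID [set [:: (0%N, 0%N)]]); last first.
  by move=> l _; rewrite lee_fin mulr_ge0// wt_ge0.
rewrite setTI esum_set1 /= /wt ?big_seq1 /om2 /= ?bin0 ?expr0 ?expr1 ?mulr1.
  by rewrite leeDl// esum_ge0// => l _; rewrite lee_fin mulr_ge0// wt_ge0.
by rewrite lee_fin subr_ge0 ltW.
Qed.

Lemma kap_ge1 : 1 <= kap.
Proof.
rewrite /kap (esumID [set [::]]); last by move=> l _; rewrite lee_fin.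
rewrite setTI esum_set1 ?lee_fin// /W /= wt_nil mul1r /=.
by rewrite leeDl// esum_ge0// => l _; rewrite lee_fin; exact: W0.
Qed.

(** Read off from the first-moment identity for the size: its left side is finite and the mean size
    of a y-block is positive. *)
Lemma kap_fin : kap \is a fin_num.
Proof.
have := E3_fin (pb_lift fst (pb_size _)).
rewrite (wald1_e addf_size (pb_size _)); case: kap kap_ge1 => //.
by rewrite gt0_muley ?lte_fin ?E2_size_gt0.
Qed.

(** Read off from the second-moment identity for the size and [f], in which [Gam f] is multiplied by
    the positive mean size. *)
Lemma Gam_fin f : block_additive f -> poly_growth f -> Gam f \is a fin_num.
Proof.
move=> af pf; have f0 := pf.1.
have pl : poly_growth (fun l : seq (nat * nat * nat) => (size (map fst l))%:R * f (map fst l) : R)%R.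
  exact: (pb_lift fst (pbM (pb_size _) pf)).
have := E3_fin pl; rewrite (wald2_e addf_size (pb_size _) af pf).
have : 0 <= Gam f by apply: esum_ge0 => p _; rewrite lee_fin mulr_ge0.
have : 0 <= Gam (fun l => (size l)%:R)%R by apply: esum_ge0 => p _; rewrite lee_fin mulr_ge0.
have f20 : (0 <= fine (E2 s t f))%R by rewrite fine_ge0// esum_ge0// => l _; rewrite lee_fin !mulr_ge0 ?wt_ge0.
case: (Gam f) => [r//|Gs0 _|//].
by rewrite gt0_muley ?lte_fin ?E2_size_gt0// !fin_numD.
Qed.

(** On the right sides [q] enters only through [kappa] and [gamma], and each term with [gamma] is a
    product of a factor of [f] and a factor of [g]. *)
Lemma wald : exists (kappa : R) (gamma : (seq (nat * nat) -> R) -> R), (1 <= kappa)%R /\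
  forall f, block_additive f -> poly_growth f ->
    fine (E3 s t q (fun l => f (map fst l))) = (kappa * fine (E2 s t f))%R /\
    forall g, block_additive g -> poly_growth g ->
      fine (E3 s t q (fun l => f (map fst l) * g (map fst l))%R) =
      (kappa * fine (E2 s t (fun l => f l * g l)) + fine (E2 s t f) * gamma g
        + fine (E2 s t g) * gamma f)%R.
Proof.
exists (fine kap), (fun f => fine (Gam f)); split.
  by have := kap_ge1; rewrite -[kap](fineK kap_fin) lee_fin.
move=> f af pf; split => [|g ag pg].
  by rewrite wald1_e// -[kap in LHS](fineK kap_fin) -EFinM /= mulrC.
rewrite wald2_e// -[kap in LHS](fineK kap_fin) -[Gam g in LHS](fineK (Gam_fin ag pg)).
rewrite -[Gam f in LHS](fineK (Gam_fin af pf)) -!EFinM -!EFinD /=; ring.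
Qed.

End fixed.
End wald.

(** * Thinning *)

Section thinning.
Context {R : realType}.
Local Open Scope ereal_scope.

Section fixed.
Variables s t q : R.
Hypotheses (s0 : (0 <= s)%R) (st : (s <= t)%R) (tq : (t <= q)%R) (q0 : (0 < q)%R) (q1 : (q < 1)%R).

Let om := om3 s t q.
Let omp0 a : (0 <= om a)%R. Proof. exact: om3_ge0. Qed.
Let wt0 l : (0 <= wt om l)%R. Proof. exact: wt_ge0. Qed.
Let o10 b : (0 <= om1 q b)%R. Proof. by apply: om1_ge0; rewrite !ltW. Qed.
Let p := ((phi t - phi s) / phi q)%R.

Let sq : (s <= q)%R. Proof. exact: le_trans st tq. Qed.
Let t0 : (0 <= t)%R. Proof. exact: le_trans s0 st. Qed.
Let pq : (0 < phi q)%R. Proof. by rewrite divr_gt0// subr_gt0. Qed.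
Let p0 : (0 <= p)%R.
Proof. by rewrite divr_ge0 ?subr_ge0 ?phi_le ?(le_lt_trans tq)// ltW. Qed.
Let p1 : (p <= 1)%R.
Proof.
rewrite ler_pdivrMr// mul1r.
have := phi_le tq q1; have : (0 <= phi s)%R by rewrite phi_ge0// s0 (le_lt_trans sq).
lra.
Qed.

Lemma E3_xs (g : seq nat -> R) : (forall l, 0 <= g l)%R ->
  E3 s t q (fun l => g (xs l)) = E2 s q (fun l => g (map fst l)).
Proof.
move=> g0.
have o20 a : (0 <= om2 s q a)%R by exact: (om2_ge0 s0 sq (lexx q)).
rewrite /E2 -(@esum_marg R _ _ _ om (om2 s q) omp0 o20 (om3_marg_xz s0 st tq q1)
  (fun l => (hit 0 (map snd l))%:R * g (map fst l))%R) => [|l]; last exact: mulr_ge0.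
by apply: eq_esum => l _; rewrite -!map_comp.
Qed.

Lemma E3_ys (g : seq nat -> R) : (forall l, 0 <= g l)%R ->
  E3 s t q (fun l => g (ys l)) = E2 t q (fun l => g (map fst l)).
Proof.
move=> g0.
have o20 a : (0 <= om2 t q a)%R by exact: (om2_ge0 t0 tq (lexx q)).
rewrite /E2 -(@esum_marg R _ _ _ om (om2 t q) omp0 o20 (om3_marg_yz s0 st tq q1)
  (fun l => (hit 0 (map snd l))%:R * g (map fst l))%R) => [|l]; last exact: mulr_ge0.
by apply: eq_esum => l _; rewrite -!map_comp.
Qed.

Definition mom (k : nat) : \bar R :=
  \esum_(l in setT) (wt (om1 q) l * ((hit 0 l)%:R * (size l).+1%:R ^+ k))%:E.

Lemma E3_mom k : E3 s t q (fun l => (size l).+1%:R ^+ k)%R = mom k.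
Proof.
rewrite /mom -(E3_zs s0 st tq q0 q1 (F := fun l => (hit 0 l)%:R * (size l).+1%:R ^+ k)%R) => [|l].
  by apply: eq_esum => l _; rewrite size_map.
by rewrite mulr_ge0// exprn_ge0.
Qed.

Lemma sumn_hit l : hit 0 l -> (sumn l <= (size l).+1 ^ 2)%N.
Proof.
move=> /hit_adm /admP H.
have -> : sumn l = (\sum_(i < size l) nth 0%N l i)%N.
  by rewrite sumnE (big_nth 0%N) big_mkord.
apply: (@leq_trans (\sum_(i < size l) (size l).+1)%N).
  by apply: leq_sum => i _; have := H i (ltn_ord i); lia.
by rewrite sum_nat_const card_ord; nia.
Qed.

Lemma bernoulli_sub n : (1 - n%:R * p <= (1 - p) ^+ n)%R.
Proof.
elim: n => [|n IH]; first by rewrite mul0r subr0 expr0.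
rewrite exprS -natr1; have q' : (0 <= 1 - p)%R by rewrite subr_ge0.
have := ler_wpM2l q' IH; have : (0 <= n%:R * p ^+ 2)%R by rewrite mulr_ge0// sqr_ge0.
rewrite expr2; set N := n%:R%R; nra.
Qed.

Lemma wt_diag l : (wt om l * (xs l == ys l)%:R)%R = wt (om3d s t q) l.
Proof.
elim: l => [|a l IH]; first by rewrite !wt_nil mul1r.
rewrite !wt_cons -IH /om3d -/om /= eqseq_cons mulrACA.
by congr (_ * _)%R; case: (_ == _); case: (_ == _); rewrite /= ?mulr0 ?mul0r ?mulr1.
Qed.

(* Given z, the values x and y agree on a letter with probability (1 - p) ^ z. *)
Lemma wt_pow l : wt (fun b => om1 q b * (1 - p) ^+ b)%R l = (wt (om1 q) l * (1 - p) ^+ sumn l)%R.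
Proof.
elim: l => [|a l IH]; first by rewrite !wt_nil mul1r.
by rewrite !wt_cons IH /= exprD; ring.
Qed.

(** Given the z-word, x and y agree with probability (1 - p) ^ (sum of z), at least 1 - p times the
    sum. That sum is at most the square of the size plus one, which costs two more powers. The bound
    is proved for the complementary event and subtracted from the finite [mom k]. *)
Lemma E3_neq k :
  E3 s t q (fun l => (xs l != ys l)%:R * (size l).+1%:R ^+ k)%R <= p%:E * mom k.+2.
Proof.
have N0 (l : seq (nat * nat * nat)) j : (0 <= (size l).+1%:R ^+ j :> R)%R by rewrite exprn_ge0.
have N0' (l : seq nat) j : (0 <= (size l).+1%:R ^+ j :> R)%R by rewrite exprn_ge0.
have split : mom k = E3 s t q (fun l => (xs l != ys l)%:R * (size l).+1%:R ^+ k)%R +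
     E3 s t q (fun l => (xs l == ys l)%:R * (size l).+1%:R ^+ k)%R.
  rewrite -E3_mom /E3 -esumD; last 2 first.
  - by move=> l _; rewrite lee_fin !mulr_ge0.
  - by move=> l _; rewrite lee_fin !mulr_ge0.
  apply: eq_esum => l _; rewrite -EFinD; congr EFin.
  by case: (_ == _); rewrite /= ?mul0r ?mul1r ?mulr0 ?addr0 ?add0r.
have diag : E3 s t q (fun l => (xs l == ys l)%:R * (size l).+1%:R ^+ k)%R =
    \esum_(l in setT) (wt (om1 q) l * ((1 - p) ^+ sumn l * ((hit 0 l)%:R * (size l).+1%:R ^+ k)))%:E.
  have od0 a : (0 <= om3d s t q a)%R by rewrite mulr_ge0// omp0.
  have oe0 b : (0 <= om1 q b * (1 - p) ^+ b)%R.
    by rewrite mulr_ge0// exprn_ge0// subr_ge0.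
  transitivity (\esum_(l in setT) (wt (fun b => om1 q b * (1 - p) ^+ b)%R l * ((hit 0 l)%:R * (size l).+1%:R ^+ k))%:E).
    rewrite -(@esum_marg R _ _ snd (om3d s t q) _ od0 oe0 (fun b => om3_marg_diag s0 st tq q1 b q0)
      (fun l => ((hit 0 l)%:R * (size l).+1%:R ^+ k))%R) => [|l]; last exact: mulr_ge0.
    apply: eq_esum => l _; rewrite -wt_diag size_map; congr EFin.
    by rewrite -/(zs l); ring.
  by apply: eq_esum => l _; rewrite wt_pow -mulrA.
have fin : mom k \is a fin_num.
  rewrite -E3_mom; apply: (E3_fin s0 st tq q0 q1); split=> [l //|].
  by exists k, 1%R => l; rewrite mul1r.
have le : mom k <= E3 s t q (fun l => (xs l == ys l)%:R * (size l).+1%:R ^+ k)%R + p%:E * mom k.+2.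
  rewrite diag /mom -esumZl//; last first.
    by move=> l; rewrite lee_fin mulr_ge0// ?wt_ge0// mulr_ge0.
  rewrite -esumD; last 2 first.
  - by move=> l _; rewrite lee_fin !mulr_ge0 ?wt_ge0 ?exprn_ge0// subr_ge0.
  - by move=> l _; rewrite -EFinM lee_fin mulr_ge0// mulr_ge0 ?wt_ge0// mulr_ge0.
  apply: le_esum => l _; rewrite -EFinM -EFinD lee_fin.
  rewrite [(p * _)%R]mulrCA -mulrDr ler_wpM2l ?wt_ge0//.
  case: (boolP (hit 0 l)) => hl; last by rewrite !(mul0r, mulr0) addr0.
  rewrite !mul1r -[k.+2]addn2 exprD.
  set N := ((size l).+1%:R ^+ k)%R; have NN : (0 <= N)%R by apply: N0'.
  have : (1 <= (1 - p) ^+ sumn l + p * (size l).+1%:R ^+ 2)%R.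
    have := bernoulli_sub (sumn l).
    have : ((sumn l)%:R * p <= (size l).+1%:R ^+ 2 * p)%R.
      by rewrite ler_wpM2r// -natrX ler_nat sumn_hit.
    lra.
  move=> /(ler_wpM2l NN); lra.
move: le; rewrite {1}split addeC leeD2lE//.
move: fin; rewrite split fin_numD => /andP[_ ->]//.
Qed.

Lemma thinning (F F' : seq (nat * nat * nat) -> R) (k : nat) (C : R) :
  (0 <= C)%R -> (forall l, 0 <= F l <= C * (size l).+1%:R ^+ k)%R ->
  (forall l, 0 <= F' l <= C * (size l).+1%:R ^+ k)%R ->
  (forall l, xs l = ys l -> F l = F' l) ->
  (`|fine (E3 s t q F) - fine (E3 s t q F')| <= C * p * fine (mom k.+2))%R.
Proof.
have fin j : mom j \is a fin_num.
  rewrite -E3_mom; apply: (E3_fin s0 st tq q0 q1); split=> [l //|].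
  by exists j, 1%R => l; rewrite mul1r.
move=> C0.
have main (F1 F2 : seq (nat * nat * nat) -> R) : (forall l, 0 <= F1 l <= C * (size l).+1%:R ^+ k)%R ->
  (forall l, 0 <= F2 l <= C * (size l).+1%:R ^+ k)%R ->
  (forall l, xs l = ys l -> F1 l = F2 l) ->
  (fine (E3 s t q F1) <= fine (E3 s t q F2) + C * p * fine (mom k.+2))%R.
  move=> F1C F2C E.
  have f1 : E3 s t q F1 \is a fin_num.
    apply: (E3_fin s0 st tq q0 q1); split=> [l|]; first by have /andP[] := F1C l.
    by exists k, C => l; have /andP[] := F1C l.
  have f2 : E3 s t q F2 \is a fin_num.
    apply: (E3_fin s0 st tq q0 q1); split=> [l|]; first by have /andP[] := F2C l.
    by exists k, C => l; have /andP[] := F2C l.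
  rewrite -lee_fin EFinD !EFinM !fineK//.
  apply: (@le_trans _ _ (E3 s t q F2 + C%:E * E3 s t q (fun l => (xs l != ys l)%:R * (size l).+1%:R ^+ k)%R)); last first.
    by rewrite leeD2l// -muleA lee_wpmul2l ?lee_fin// E3_neq.
  have F10 l : (0 <= F1 l)%R by have /andP[] := F1C l.
  have F20 l : (0 <= F2 l)%R by have /andP[] := F2C l.
  have N0 (l : seq (nat * nat * nat)) j : (0 <= (size l).+1%:R ^+ j :> R)%R by rewrite exprn_ge0.
  rewrite /E3 -esumZl//; last by move=> l; rewrite lee_fin !mulr_ge0.
  rewrite -esumD; last 2 first.
  - by move=> l _; rewrite lee_fin !mulr_ge0.
  - by move=> l _; rewrite -EFinM lee_fin !mulr_ge0.
  apply: le_esum => l _; rewrite -EFinM -EFinD lee_fin.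
  rewrite [(C * _)%R]mulrCA -mulrDr ler_wpM2l// [(C * _)%R]mulrCA -mulrDr ler_wpM2l//.
  case: (eqVneq (xs l) (ys l)) => [/E ->|_] /=; first by rewrite mul0r mulr0 addr0.
  rewrite mul1r; have /andP[_ H] := F1C l; apply: le_trans H _.
  by rewrite lerDr.
move=> HF HF' E; rewrite ler_norml lerBlDl main// andbT lerBrDl.
by rewrite lerBlDr main// => l /E.
Qed.

End fixed.

Lemma phi_lip (s t q : R) : (0 <= s <= t)%R -> (t <= q < 1)%R ->
  (phi t - phi s <= (t - s) / (1 - q) ^+ 2)%R.
Proof.
move=> /andP[s0 st] /andP[tq q1]; rewrite /phi.
have hs : (0 < 1 - s)%R by lra.
have ht : (0 < 1 - t)%R by lra.
have hq : (0 < 1 - q)%R by lra.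
have -> : (t / (1 - t) - s / (1 - s) = (t - s) / ((1 - t) * (1 - s)))%R.
  by field; rewrite !gt_eqF.
rewrite ler_wpM2l ?subr_ge0// lef_pV2 ?posrE ?mulr_gt0 ?exprn_gt0// expr2.
by apply: ler_pM; lra.
Qed.

(** The mixed moment E[g(B_s) h(B_t)] along the q-block process, not centred. *)
Definition Acov (q : R) (g h : seq nat -> R) (s t : R) : R :=
  fine (E3 s t q (fun l => g (xs l) * h (ys l))%R).

(** For [s = t] the thinning bound is 0, so [xs] and [ys] can be exchanged inside expectations. *)
Lemma E3_diag (q : R) (g h : seq nat -> R) (s : R) : (0 <= s <= q)%R -> (0 < q < 1)%R ->
  poly_growth g -> poly_growth h ->
  Acov q g h s s = fine (E3 s s q (fun l => g (xs l) * h (xs l))%R) /\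
  Acov q g h s s = fine (E3 s s q (fun l => g (ys l) * h (ys l))%R).
Proof.
move=> /andP[s0 sq] /andP[q0 q1] [g0 [k [C gC]]] [h0 [k' [C' hC]]].
have bnd u v : (0 <= g u * h v <= C * C' * ((size u).+1%:R ^+ k * (size v).+1%:R ^+ k'))%R.
  rewrite mulr_ge0//= mulrACA; exact: ler_pM.
have C0 : (0 <= C * C')%R.
  have := bnd [::] [::]; rewrite /= !expr1n !mulr1 => /andP[]; exact: le_trans.
have T F F' := @thinning s s q s0 (lexx s) sq q0 q1 F F' (k + k') (C * C') C0.
rewrite subrr mul0r mulr0 mul0r in T.
by split; apply/eqP; rewrite -subr_eq0 -normr_le0; apply: T => l; rewrite /xs /ys;
  rewrite ?exprD; move: (bnd (xs l) (ys l)) (bnd (xs l) (xs l)) (bnd (ys l) (ys l)); rewrite /xs /ys !size_map// => *; congr (_ * _)%R; congruence.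
Qed.

Lemma Acov_lipschitz (q : R) (g h : seq nat -> R) : (0 < q < 1)%R -> poly_growth g -> poly_growth h ->
  exists2 C : R, (0 <= C)%R & forall s t, (0 <= s <= t)%R -> (t <= q)%R ->
   [/\ (0 <= Acov q g h s t <= C)%R, (`|Acov q g h s t - Acov q g h s s| <= C * (t - s))%R &
       (`|Acov q g h s t - Acov q g h t t| <= C * (t - s))%R].
Proof.
move=> q01 pg ph; have /andP[q0 q1] := q01.
have [g0 [k [C gC]]] := pg; have [h0 [k' [C' hC]]] := ph.
have bnd u v : (0 <= g u * h v <= C * C' * ((size u).+1%:R ^+ k * (size v).+1%:R ^+ k'))%R.
  rewrite mulr_ge0//= mulrACA; exact: ler_pM.
have C0 : (0 <= C * C')%R.
  have := bnd [::] [::]; rewrite /= !expr1n !mulr1 => /andP[]; exact: le_trans.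
have bnd' (l : seq (nat * nat * nat)) f1 f2 : (0 <= g (map f1 l) * h (map f2 l) <= C * C' * (size l).+1%:R ^+ (k + k'))%R.
  by have := bnd (map f1 l) (map f2 l); rewrite !size_map exprD.
have pq : (0 < phi q)%R by rewrite divr_gt0// subr_gt0.
have m0 j : (0 <= fine (mom q j))%R.
  apply: fine_ge0; apply: esum_ge0 => l _; rewrite lee_fin !mulr_ge0 ?exprn_ge0 ?wt_ge0// => b.
  by apply: om1_ge0; rewrite !ltW.
pose D := (C * C' * ((1 - q) ^- 2 / phi q) * fine (mom q (k + k').+2))%R.
pose D' := (C * C' * fine (mom q (k + k')))%R.
have D0 : (0 <= D)%R.
  by rewrite /D mulr_ge0// mulr_ge0// divr_ge0 ?invr_ge0 ?exprn_ge0 ?subr_ge0 ?(ltW pq) ?(ltW q1).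
have D'0 : (0 <= D')%R by rewrite /D' mulr_ge0.
exists (D + D')%R; first exact: addr_ge0.
move=> s t /andP[s0 st] tq.
have T F F' := @thinning s t q s0 st tq q0 q1 F F' (k + k') (C * C') C0.
have cle : (C * C' * ((phi t - phi s) / phi q) * fine (mom q (k + k').+2) <= (D + D') * (t - s))%R.
  apply: (@le_trans _ _ (D * (t - s))%R); last first.
    by rewrite ler_wpM2r ?subr_ge0// lerDl.
  have -> : (D * (t - s) = C * C' * ((t - s) / (1 - q) ^+ 2 / phi q) * fine (mom q (k + k').+2))%R.
    by rewrite /D; ring.
  rewrite ler_wpM2r// ler_wpM2l// ler_wpM2r ?invr_ge0 ?(ltW pq)//.
  by apply: phi_lip; rewrite ?s0 ?tq.
split.
- apply/andP; split.
    by apply: fine_ge0; apply: esum_ge0 => l _; rewrite lee_fin !mulr_ge0 ?wt_ge0// => a; apply: om3_ge0.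
  apply: (@le_trans _ _ D'); last by rewrite lerDr.
  have f1 : E3 s t q (fun l => g (xs l) * h (ys l))%R \is a fin_num.
    apply: (E3_fin s0 st tq q0 q1); split=> [l|]; first exact: mulr_ge0.
    by exists (k + k')%N, (C * C')%R => l; have /andP[] := bnd' l (fun a => a.1.1) (fun a => a.1.2).
  have f2 : mom q (k + k') \is a fin_num.
    rewrite -(E3_mom s0 st tq q0 q1); apply: (E3_fin s0 st tq q0 q1); split=> [l|].
      by rewrite exprn_ge0.
    by exists (k + k')%N, 1%R => l; rewrite mul1r.
  rewrite -lee_fin /D' EFinM !fineK//.
  rewrite -(E3_mom s0 st tq q0 q1) /E3 -esumZl//; last first.
    by move=> l; rewrite lee_fin !mulr_ge0 ?exprn_ge0 ?wt_ge0// => a; apply: om3_ge0.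
  apply: le_esum => l _; rewrite -EFinM lee_fin [leRHS]mulrCA ler_wpM2l ?wt_ge0//.
    by move=> a; apply: om3_ge0.
  rewrite [leRHS]mulrCA ler_wpM2l//.
  by have /andP[] := bnd' l (fun a => a.1.1) (fun a => a.1.2).
(* By marginalization the diagonal value at [s] is also an expectation over triples for the times s
   and t, where thinning compares it with the mixed moment; likewise below for the diagonal value at
   [t]. *)
- have sq : (0 <= s <= q)%R by rewrite s0 (le_trans st).
  have [-> _] := E3_diag sq q01 pg ph.
  have gh0 u : (0 <= g u * h u)%R by exact: mulr_ge0.
  rewrite (@E3_xs s s q s0 (lexx s) (le_trans st tq) q1 (fun u => g u * h u)%R gh0).
  rewrite -(@E3_xs s t q s0 st tq q1 (fun u => g u * h u)%R gh0).
  apply: le_trans (T _ _ _ _ _) cle => l; [exact: bnd'|exact: bnd'|].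
  by rewrite /xs /ys => ->.
- have tq' : (0 <= t <= q)%R by rewrite tq (le_trans s0).
  have [_ ->] := E3_diag tq' q01 pg ph.
  have gh0 u : (0 <= g u * h u)%R by exact: mulr_ge0.
  rewrite (@E3_ys t t q (le_trans s0 st) (lexx t) tq q1 (fun u => g u * h u)%R gh0).
  rewrite -(@E3_ys s t q s0 st tq q1 (fun u => g u * h u)%R gh0).
  apply: le_trans (T _ _ _ _ _) cle => l; [exact: bnd'|exact: bnd'|].
  by rewrite /xs /ys => ->.
Qed.

End thinning.

(** * Mallows blocks *)

Lemma blocksP p : block_decomposition p (blocks p).
Proof.
have [bs bsP] := block_decomposition_ex p.
by rewrite /blocks; apply: (@xgetPex _ [::] (fun bs => block_decomposition p bs)); exists bs.
Qed.

Lemma size_blocks_gt0 p : (0 < psize p)%N -> (0 < size (blocks p))%N.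
Proof.
by have [_ E] := blocksP p; rewrite {1}E; case: (blocks p).
Qed.

Lemma block_blocks p b : b \in blocks p -> is_block b.
Proof. by have [H _] := blocksP p; apply: H. Qed.

(** * Countably valued random variables *)

Section discrete.
Context d (T : measurableType d) (R : realType) (P : probability T R).
Local Open Scope ereal_scope.

Definition drv (I : Type) (X : T -> I) : Prop := forall i, measurable (X @^-1` [set i]).

Lemma drv_set (I : countType) (X : T -> I) (A : set I) : drv X -> measurable (X @^-1` A).
Proof.
move=> dX; have -> : X @^-1` A = \bigcup_(i : I) (if i \in A then X @^-1` [set i] else set0).
  apply/seteqP; split=> [w Aw|w [i _]] /=; first by exists (X w) => //=; rewrite mem_set.
  by case: ifPn => // /set_mem Ai ->.
apply: countable_bigcupT_measurable => [|i]; first exact: countableP.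
by case: ifP.
Qed.

Lemma drv_measurable (I : countType) (X : T -> I) (F : I -> R) : drv X ->
  measurable_fun setT (fun w => F (X w)).
Proof.
move=> dX _ /= Y mY; rewrite setTI; exact: (drv_set (F @^-1` Y) dX).
Qed.

Lemma integral_drv (I : countType) (X : T -> I) (F : I -> R) : drv X ->
  (forall i, 0 <= F i)%R ->
  \int[P]_w (F (X w))%:E = \esum_(i in setT) ((F i)%:E * P (X @^-1` [set i])).
Proof.
move=> dX F0.
pose A n := [set w | choice.pickle (X w) = n].
have mA n : measurable (A n) by apply: (drv_set ([set i | choice.pickle i = n]) dX).
have AT : \bigcup_n A n = setT.
  by apply/seteqP; split=> // w _; exists (choice.pickle (X w)).
have tA : trivIset setT A.
  by move=> m n _ _ [w [<- <-]].
rewrite -AT ge0_integral_bigcup//; last 2 first.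
- by rewrite AT; apply/measurable_EFinP; apply: drv_measurable.
- by move=> w _; rewrite lee_fin.
rewrite nneseries_esumT; last by move=> n; apply: integral_ge0 => w _; rewrite lee_fin.
rewrite (esumID [set choice.pickle i | i in [set: I]]); last first.
  by move=> n _; apply: integral_ge0 => w _; rewrite lee_fin.
rewrite setTI [X in _ + X]esum1 ?adde0; last first.
  move=> n [_ nr]; have -> : A n = set0.
    by apply/seteqP; split=> // w /= wn; apply: nr; exists (X w).
  by rewrite integral_set0.
rewrite esum_image; last by move=> i j _ _ /(pcan_inj choice.pickleK).
apply: eq_esum => i _.
have Ai : A (choice.pickle i) = X @^-1` [set i].
  by apply/seteqP; split=> w; rewrite /A /=; [move=> /(pcan_inj choice.pickleK)|move=> /= ->].
rewrite Ai (eq_integral (cst (F i)%:E)) ?integral_cst//.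
by move=> w /set_mem /= ->.
Qed.

Lemma drv_total (I : countType) (X : T -> I) (A : set T) : drv X -> measurable A ->
  P A = \esum_(i in setT) P (A `&` X @^-1` [set i]).
Proof.
move=> dX mA.
pose D n := A `&` [set w | choice.pickle (X w) = n].
have mD n : measurable (D n).
  by apply: measurableI => //; apply: (drv_set ([set i | choice.pickle i = n]) dX).
have tD : trivIset setT D by move=> m n _ _ [w [[_ <-] [_ <-]]].
have AD : A = \bigcup_n D n.
  by apply/seteqP; split=> [w Aw|w [n _ []]//]; exists (choice.pickle (X w)).
rewrite {1}AD measure_semi_bigcup//; last exact: bigcup_measurable.
rewrite nneseries_esumT//.
rewrite (esumID [set choice.pickle i | i in [set: I]])//.
rewrite setTI [X in _ + X]esum1 ?adde0; last first.
  move=> n [_ nr]; have -> : D n = set0.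
    by apply/seteqP; split=> // w /= [_ wn]; apply: nr; exists (X w).
  by rewrite measure0.
rewrite esum_image; last by move=> i j _ _ /(pcan_inj choice.pickleK).
apply: eq_esum => i _; congr (P (_ `&` _)).
by apply/seteqP; split=> w /=; [move=> /(pcan_inj choice.pickleK)|move=> /= ->].
Qed.

(** Lower bounds with the right total mass are equalities. Both the transition probabilities of the
    birth process and the law of the word of triples are identified in this way. *)
Lemma drv_dominate (I : countType) (X : T -> I) (A : set T) (p : I -> \bar R) :
  drv X -> measurable A -> (forall i, 0 <= p i) ->
  (forall i, p i <= P (A `&` X @^-1` [set i])) ->
  \esum_(i in setT) p i = P A -> forall i, P (A `&` X @^-1` [set i]) = p i.
Proof.
move=> dX mA p0 pP pA i.
apply/eqP; rewrite eq_le pP andbT.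
have := drv_total dX mA; rewrite -pA.
rewrite (esumID [set i])// [RHS](esumID [set i])// !setTI !esum_set1//.
set a := \esum_(i0 in _) p i0; set b := \esum_(i0 in _) P _ => E.
have ab : a <= b by apply: le_esum.
have finA : P A \is a fin_num by apply: fin_num_measure.
have finb : b \is a fin_num.
  move: finA; rewrite (drv_total dX mA) (esumID [set i])// !setTI fin_numD.
  by move=> /andP[].
by rewrite -(@leeD2rE _ b)// -E leeD2l.
Qed.

Lemma probability_ae_eq (A B : set T) (Q : set T) : measurable A -> measurable B ->
  {ae P, forall w, Q w} -> (forall w, Q w -> A w <-> B w) -> P A = P B.
Proof.
have main (A' B' : set T) : measurable A' -> measurable B' ->
    {ae P, forall w, Q w} -> (forall w, Q w -> A' w -> B' w) -> P A' <= P B'.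
  move=> mA mB [N [mN N0 QN]] AB.
  apply: (@le_trans _ _ (P (B' `|` N))).
    apply: le_measure; rewrite ?inE//; first exact: measurableU.
    move=> w Aw; case: (pselect (Q w)) => Qw; first by left; apply: AB.
    by right; apply: QN.
  have N0' : P N = 0 := N0.
  by apply: (@le_trans _ _ (P B' + P N)); [exact: measureU2|rewrite N0' adde0].
move=> mA mB aeQ AB; apply/eqP; rewrite eq_le !main// => w /AB[].
  by [].
by [].
Qed.

End discrete.

(** * The law of the first block of a Mallows permutation *)

Section mallows.
Local Open Scope nat_scope.

Lemma rinv_infty_finite (s : nat -> nat) i : injective s ->
  finite_set [set j : nat | (i < j) /\ (s j < s i)].
Proof.
move=> sinj; have : finite_set (s @^-1` `I_(s i)).
  by apply: finite_preimage => [x y _ _|]; [exact: sinj|exact: finite_II].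
by apply: sub_finite_set => j [].
Qed.

(** Positions after the first block carry values beyond it ([sge]), so the inversions of a position
    of this block stay inside it. *)
Lemma rinv_infty_dsum (s : nat -> nat) (b : nat -> finperm) i : injective s ->
  is_infinite_dsum s b -> i < psize (b 0) -> rinv_infty s i = nth 0 (pword (b 0)) i.
Proof.
move=> sinj sb im; set m := psize (b 0) in im *.
have sE (j : 'I_m) : s j = tagged (b 0) j.
  by have := sb 0 j; rewrite !big_ord0 !add0n.
have sge j : m <= j -> m <= s j.
  move=> mj; rewrite leqNgt; apply/negP => sjm.
  pose x := (tagged (b 0))^-1%g (Ordinal sjm).
  have : s x = s j by rewrite sE permKV.
  by move=> /sinj xj; have := ltn_ord x; rewrite xj ltnNge mj.
rewrite (nth_rword _ (Ordinal im)) /rinv /rinv_infty.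
set D := [set j : nat | _]%classic; set J := [set j : 'I_m | _]%SET.
have fD : finite_set D by exact: rinv_infty_finite.
have -> : fset_set D = [fset (val j) | j in J]%fset.
  apply/fsetP => j; rewrite in_fset_set//; apply/idP/imfsetP.
    move=> /set_mem [ij sij].
    have jm : j < m.
      rewrite ltnNge; apply/negP => /sge; have := sE (Ordinal im); rewrite /= in sij * => E.
      by rewrite leqNgt (leq_trans sij)// E ltnW.
    exists (Ordinal jm) => //=; rewrite !inE /= ij /=.
    by have := sE (Ordinal jm); have := sE (Ordinal im) => /= <- <-.
  move=> [x /=]; rewrite !inE => /andP[ix sx] ->; split=> //=.
  by have /= -> := sE (Ordinal im); rewrite sE.
by rewrite card_imfset//=; [rewrite cardE|exact: val_inj].
Qed.

End mallows.

Section mblock_law.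
Context (R : realType).
Local Open Scope ereal_scope.

Lemma mutually_independent_word d (T : measurableType d) (P : probability T R) (p : R)
    (X : nat -> T -> nat) (l : seq nat) :
  mutually_independent P (fun i w => (X i w).+1) ->
  (forall i, is_geometric P (1 - p) (fun w => (X i w).+1)) ->
  P [set w | forall i, (i < size l)%N -> X i w = nth 0%N l i] = (wt (om1 p) l)%:E.
Proof.
move=> ind geo.
have := ind (iota 0 (size l)) (fun i => [set (nth 0%N l i).+1]) (iota_uniq _ _).
have -> : \bigcap_(i in [set` iota 0 (size l)]) ((fun w => (X i w).+1) @^-1` [set (nth 0%N l i).+1]) =
    [set w | forall i, (i < size l)%N -> X i w = nth 0%N l i].
  apply/seteqP; split=> w /= H i.
    by move=> il; have := H i; rewrite /= mem_iota add0n => /(_ il) [].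
  by rewrite /= mem_iota add0n => il; rewrite H.
move=> ->; under eq_bigr => i _ do rewrite geo//.
rewrite /wt -prodEFin [RHS](big_nth 0%N) /index_iota subn0.
by apply: eq_bigr => i _; rewrite /om1 subSS subn0 subKr.
Qed.

(** By the prefix-code property, the first block is [b] exactly when the first right-inversion
    counts spell [pword b]; these counts are i.i.d. geometric. *)
Lemma mblock_law (q : R) d (T : measurableType d) (P : probability T R) (B : T -> finperm) b :
  is_MBlock q P B ->
  P (B @^-1` [set b]) = ((hit 0 (pword b))%:R * wt (om1 q) (pword b))%:E.
Proof.
move=> [dB [d' [T' [P' [S [Bs [[Sbij mS ind geo] dBs aeS law]]]]]]].
rewrite law.
have Sinj w : injective (S w) by apply: bij_inj.
have dS i : drv (fun w => S w i).
  by move=> j; have := mS i measurableT [set j] I; rewrite setTI.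
have dr i : drv (fun w => rinv_infty (S w) i).
  move=> k.
  (* Measurability: the finite set of inverted positions takes countably many values [J]. *)
  have -> : (fun w => rinv_infty (S w) i) @^-1` [set k] =
     \bigcup_(J : {fset nat}) (if #|` J| == k then
        \bigcap_j [set w | (j \in J) = ((i < j) && (S w j < S w i))%N] else set0).
    apply/seteqP; split=> [w /= wk|w [J _]].
      exists (fset_set [set j : nat | (i < j)%N /\ (S w j < S w i)%N]) => //.
      rewrite -/(rinv_infty (S w) i) wk eqxx => j _ /=.
      rewrite in_fset_set; last exact: rinv_infty_finite.
      by apply/idP/andP => [/set_mem//|[? ?]]; apply/mem_set.
    case: ifPn => // /eqP Jk H /=; rewrite -Jk /rinv_infty; congr (#|` _|).
    apply/fsetP => j; rewrite in_fset_set; last exact: rinv_infty_finite.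
    have /= -> := H j I.
    by apply/idP/andP => [/set_mem//|[? ?]]; apply/mem_set.
  apply: countable_bigcupT_measurable => [|J]; first exact: countableP.
  case: ifP => // _; apply: bigcapT_measurable => j.
  have dp : drv (fun w => (S w i, S w j)).
    move=> [x y].
    have -> : (fun w => (S w i, S w j)) @^-1` [set (x, y)] =
       (fun w => S w i) @^-1` [set x] `&` (fun w => S w j) @^-1` [set y].
      by apply/seteqP; split=> w /=; [move=> [-> ->]|move=> [-> ->]].
    by apply: measurableI; apply: dS.
  exact: (drv_set [set k | (j \in J) = ((i < j) && (k.2 < k.1))%N] dp).
case: (boolP (hit 0 (pword b))) => hb; last first.
  rewrite mul0r; transitivity (P' set0); last by rewrite measure0.
  apply: (probability_ae_eq _ _ aeS) => //; first exact: dBs.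
  move=> w [blk _] /=; split=> // Bb; move: hb; have := blk 0%N.
  by rewrite Bb => /is_blockP ->.
rewrite mul1r -(mutually_independent_word _ ind geo).
have mE : measurable [set w | forall i, (i < size (pword b))%N -> rinv_infty (S w) i = nth 0%N (pword b) i].
  have -> : [set w | forall i, (i < size (pword b))%N -> rinv_infty (S w) i = nth 0%N (pword b) i] =
    \bigcap_(i in `I_(size (pword b))) ((fun w => rinv_infty (S w) i) @^-1` [set nth 0%N (pword b) i]).
    by apply/seteqP; split=> w /= H i /=; apply: H.
  by apply: bigcap_measurableType => i _; apply: dr.
apply: (probability_ae_eq _ _ aeS) => //; first exact: dBs.
move=> w [blk dsumS] /=; split=> [Bb i|H].
  rewrite size_pword -Bb => ib; rewrite (rinv_infty_dsum _ dsumS)//.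
have hB : hit 0 (pword (Bs 0%N w)) by apply/is_blockP.
apply: pword_inj; apply: (hit_prefix_nth (r := rinv_infty (S w)) hB hb) => i il.
  by rewrite (rinv_infty_dsum _ dsumS)// -size_pword.
by rewrite H.
Qed.

Lemma esum_pword (a : seq nat -> \bar R) : (forall l, 0 <= a l) ->
  (forall l, ~~ adm l -> a l = 0) ->
  \esum_(b in [set: finperm]) a (pword b) = \esum_(l in setT) a l.
Proof.
move=> a0 na.
rewrite -(@esum_image R finperm _ setT pword a); last by move=> b c _ _ /pword_inj.
rewrite [RHS](esumID (range pword))// setTI [X in _ = _ + X]esum1 ?adde0// => l [_ nl].
case: (boolP (adm l)) => al; last exact: na.
by case: nl; exists (perm_of_word l) => //; rewrite perm_of_wordK.
Qed.

Lemma mblock_integral (q : R) d (T : measurableType d) (P : probability T R) (B : T -> finperm)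
    (F : seq nat -> R) : (0 <= q <= 1)%R -> is_MBlock q P B -> (forall l, 0 <= F l)%R ->
  \int[P]_w (F (pword (B w)))%:E =
  \esum_(l in setT) (wt (om1 q) l * ((hit 0 l)%:R * F l))%:E.
Proof.
move=> q01 mB F0; have o0 z : (0 <= om1 q z)%R by exact: om1_ge0.
rewrite (integral_drv P (X := B) (F := fun b => F (pword b)))//; last by case: mB.
under eq_esum => b _ do rewrite (mblock_law _ mB) -EFinM.
rewrite -[RHS]esum_pword => [|l|l nl]; first last.
- by rewrite (_ : hit 0 l = false) ?mul0r ?mulr0//; apply: contraNF nl; apply: hit_adm.
- by rewrite lee_fin mulr_ge0 ?mulr_ge0 ?wt_ge0.
by apply: eq_esum => b _; congr EFin; ring.
Qed.

End mblock_law.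

(** * The geometric birth process *)

Section birth_polynomials.
Context {R : realType}.

Lemma poly_bounded (p : {poly R}) : exists2 C : R, 0 <= C &
  forall a, 0 <= a <= 1 -> `|p.[a]| <= C.
Proof.
elim/poly_ind: p => [|p c [C C0 IH]].
  by exists 0 => // a _; rewrite horner0 normr0.
exists (C + `|c|); first by rewrite addr_ge0.
move=> a a01; rewrite hornerMXaddC (le_trans (ler_normD _ _))// lerD2r.
rewrite normrM -[leRHS]mulr1 ler_pM//; first exact: IH.
by rewrite ger0_norm; have /andP[] := a01.
Qed.

Lemma poly_taylor1 (p : {poly R}) : exists2 C : R, 0 <= C &
  forall a b, 0 <= a <= 1 -> 0 <= b <= 1 ->
    `|p.[b] - p.[a] - (b - a) * p^`().[a]| <= C * (b - a) ^+ 2.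
Proof.
elim/poly_ind: p => [|p c [C C0 IH]].
  by exists 0 => // a b _ _; rewrite deriv0 !horner0 mulr0 !subr0 normr0 mul0r.
have [D D0 HD] := poly_bounded p^`().
exists (C + D) => [|a b a01 b01]; first exact: addr_ge0.
rewrite derivD derivC addr0 derivM derivX mulr1 !hornerD !hornerMX !hornerC.
have -> : p.[b] * b + c - (p.[a] * a + c) - (b - a) * (p^`().[a] * a + p.[a]) =
   b * (p.[b] - p.[a] - (b - a) * p^`().[a]) + (b - a) ^+ 2 * p^`().[a] by ring.
apply: le_trans (ler_normD _ _) _; rewrite [leRHS]mulrDl; apply: lerD; rewrite normrM.
  rewrite -[leRHS]mul1r ler_pM//; last exact: IH.
  by rewrite ger0_norm; have /andP[] := b01.
by rewrite ger0_norm ?sqr_ge0// [leRHS]mulrC ler_wpM2l ?sqr_ge0// HD.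
Qed.

(* Transition from x + 1 to y + 1 individuals, as a function of
   a = (1 - u) / (1 - t). *)
Definition birthp (x y : nat) : {poly R} :=
  'C(y, x)%:R *: ('X^(x.+1) * (1 - 'X) ^+ (y - x)).

Lemma birthpE x y a : (birthp x y).[a] = 'C(y, x)%:R * a ^+ x.+1 * (1 - a) ^+ (y - x).
Proof. by rewrite /birthp !hornerE. Qed.

Lemma deriv_1subX n : ((1 - 'X) ^+ n : {poly R})^`() = - ((1 - 'X) ^+ n.-1 *+ n).
Proof. by rewrite deriv_exp derivB derivX derivC sub0r mulN1r mulNrn. Qed.

(** Kolmogorov's forward equation. For a = (1 - u) / (1 - t) one has da/du = - a / (1 - u); the
    state y + 1 is left at rate (y + 1) / (1 - u) and entered from y at rate y / (1 - u). For
    [y = 0] the factor [y%:R] cancels the term with [y.-1]. *)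
Lemma birthp_ode x y a :
  a * (birthp x y)^`().[a] = y.+1%:R * (birthp x y).[a] - y%:R * (birthp x y.-1).[a].
Proof.
have [yx|yx|yx] := ltngtP y x.
- rewrite /birthp !bin_small// ?(leq_ltn_trans (leq_pred _))//.
  by rewrite !scale0r deriv0 !horner0 !mulr0 subr0.
- case: y yx => // y yx; rewrite ltnS in yx.
  rewrite [y.+1.-1]/= !birthpE /birthp derivZ derivM derivXn deriv_1subX.
  rewrite subSn// !hornerE /= !hornerMn !hornerE.
  have E : (y.+1%:R * 'C(y, x)%:R = (y - x).+1%:R * 'C(y.+1, x)%:R :> R).
    by rewrite -!natrM; congr (_%:R); have := mul_bin_down y.+1 x; rewrite /= subSn.
  rewrite -[_ *+ x.+1]mulr_natr -[_ *+ (y - x).+1]mulr_natr ?mulrA.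
  rewrite E -[y.+2%:R]natr1 -[y.+1%:R]natr1 -[x.+1%:R]natr1 -[(y - x).+1%:R]natr1 natrB//.
  rewrite !exprS; ring.
- have -> : birthp x y = 'X^(x.+1).
    by rewrite /birthp yx binn subnn expr0 mulr1 scale1r.
  rewrite yx derivXn hornerMn !hornerXn /= -mulr_natr mulrA -exprS mulrC.
  case: x {yx} => [|x]; first by rewrite mul0r subr0.
  by rewrite birthpE /= bin_small// mulr0n !mul0r mulr0 subr0.
Qed.

Lemma birthp_1 x y : (birthp x y).[1] = (y == x)%:R.
Proof.
rewrite birthpE expr1n mulr1 subrr.
have [yx|yx|->] := ltngtP y x; first by rewrite bin_small// mul0r.
  by rewrite expr0n subn_eq0 leqNgt yx mulr0.
by rewrite binn subnn expr0 mulr1.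
Qed.

Lemma birthp_sum x a : 0 < a <= 1 ->
  (\esum_(y in setT) ((birthp x y).[a])%:E = 1)%E.
Proof.
move=> /andP[a0 a1].
rewrite (@esum_nat_shift _ x) => [|y|y yx]; last 2 first.
- by rewrite lee_fin birthpE !mulr_ge0 ?exprn_ge0 ?subr_ge0// ltW.
- by rewrite birthpE bin_small// !mul0r.
transitivity (\esum_(k in setT) ((a ^+ x.+1)%:E * ('C(x + k, x)%:R * (1 - a) ^+ k)%:E))%E.
  apply: eq_esum => k _; rewrite birthpE addKn -EFinM; congr EFin; ring.
rewrite esumZl ?exprn_ge0// 1?ltW//; last first.
  by move=> k; rewrite lee_fin mulr_ge0// exprn_ge0 ?subr_ge0.
rewrite neg_binomial; last by rewrite subr_ge0 a1 ltrBlDr ltrDl.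
by rewrite subKr -EFinM mulfV// expf_neq0// gt_eqF.
Qed.

End birth_polynomials.

(** Euler scheme with N equal steps h: as soon as h L <= 1, each factor 1 - h c lies in [0, 1], so
    earlier errors are not amplified and the total error is at most eps (u - t). *)
Lemma euler_ge0 (R : realType) (d c : R -> R) (t u L : R) : t <= u -> 0 <= d t ->
  (forall r, t <= r <= u -> 0 <= c r <= L) ->
  (forall eps, 0 < eps -> exists2 delta, 0 < delta & forall r h,
     t <= r -> 0 < h < delta -> r + h <= u ->
     d r * (1 - h * c r) - eps * h <= d (r + h)) ->
  0 <= d u.
Proof.
move=> tu dt cL H.
have [->//|tneu] := eqVneq u t.
have ltu : 0 < u - t by rewrite subr_gt0 lt_neqAle eq_sym tneu.
have L0 : 0 <= L by have /andP[] := cL t (introT andP (conj (lexx t) tu)); exact: le_trans.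
apply/ler_addgt0Pr => e e0.
have e'0 : 0 < e / (u - t) by rewrite divr_gt0.
have [delta del0 Hd] := H _ e'0.
pose N := (Num.bound ((u - t) / delta) + Num.bound ((u - t) * L)).+1.
have N0 : 0 < N%:R :> R by rewrite ltr0n.
have b1 : (u - t) / delta < N%:R.
  have := archi_boundP (divr_ge0 (ltW ltu) (ltW del0)); move=> /lt_le_trans; apply.
  by rewrite ler_nat /N leqW// ?leq_addr ?leq_addl.
have b2 : (u - t) * L < N%:R.
  have := archi_boundP (mulr_ge0 (ltW ltu) L0); move=> /lt_le_trans; apply.
  by rewrite ler_nat /N leqW// ?leq_addr ?leq_addl.
pose h := (u - t) / N%:R.
have h0 : 0 < h by rewrite divr_gt0.
have hd : h < delta by rewrite ltr_pdivrMr// mulrC -ltr_pdivrMr.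
have hL : h * L <= 1 by rewrite /h mulrAC ler_pdivrMr// mul1r ltW.
have Nh : N%:R * h = u - t by rewrite /h mulrCA mulfV ?mulr1// gt_eqF.
have step n : (n <= N)%N -> - (e / (u - t) * (n%:R * h)) <= d (t + n%:R * h).
  elim: n => [|n IH] nN; first by rewrite mul0r mulr0 oppr0 addr0.
  have tr : t <= t + n%:R * h by rewrite lerDl mulr_ge0// ltW.
  have nhu : t + n%:R * h + h <= u.
    have : (n%:R + 1) * h <= N%:R * h by rewrite ler_wpM2r ?(ltW h0)// natr1 ler_nat.
    by rewrite Nh mulrDl mul1r; clear; lra.
  have tu' : t + n%:R * h <= u by move: nhu h0; clear; lra.
  have /andP[c0 cl] := cL (t + n%:R * h) (introT andP (conj tr tu')).
  have := Hd _ h tr (introT andP (conj h0 hd)) nhu.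
  have -> : t + n.+1%:R * h = t + n%:R * h + h by rewrite -natr1 mulrDl mul1r addrA.
  have := IH (ltnW nN).
  set x := d (t + n%:R * h); set y := d _; set ee := e / _.
  have hc : 0 <= 1 - h * c (t + n%:R * h) <= 1.
    rewrite subr_ge0 gerBl mulr_ge0 ?(ltW h0)// andbT (le_trans _ hL)//.
    by rewrite ler_wpM2l// ltW.
  move: hc; set q := 1 - _ => /andP[q0 q1] Hx Hy.
  have nh0 : 0 <= ee * (n%:R * h).
    by rewrite mulr_ge0 ?(ltW e'0)// mulr_ge0 ?(ltW h0).
  have : - (ee * (n%:R * h)) <= x * q.
    have : ee * (n%:R * h) * q <= ee * (n%:R * h) by rewrite ler_piMr.
    by have := ler_wpM2r q0 Hx; rewrite mulNr; clear; lra.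
  by move: Hy; clear; rewrite -natr1; lra.
have := step N (leqnn N); rewrite Nh divfK ?gt_eqF// -lerBlDr sub0r.
by have -> : t + (u - t) = u by ring.
Qed.

Section birth.
Context d (T : measurableType d) (R : realType) (P : probability T R) (Z : R -> T -> nat).
Hypothesis GB : geometric_birth_process P Z.
Local Open Scope ereal_scope.

Let Zdrv t : (0 <= t < 1)%R -> drv (Z t).
Proof.
move=> t01 k; have [meas _ _ _ _] := GB; have [mt _] := meas t t01.
by have := mt measurableT [set k] I; rewrite setTI.
Qed.

Definition pastev (past : seq R) (v : R -> nat) : set T :=
  [set w | forall s, s \in past -> Z s w = v s].

Lemma measurable_pastev past v : (forall s, s \in past -> 0 <= s < 1)%R ->
  measurable (pastev past v).
Proof.
elim: past => [|s past IH] H.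
  by have -> : pastev [::] v = setT by apply/seteqP; split.
have -> : pastev (s :: past) v = Z s @^-1` [set v s] `&` pastev past v.
  apply/seteqP; split=> [w Hw|w [Hs Hw] r] /=.
    by split=> [|r rp]; apply: Hw; rewrite inE ?eqxx ?rp ?orbT.
  by rewrite inE => /orP[/eqP ->//|]; apply: Hw.
apply: measurableI; first by apply: Zdrv; apply: H; rewrite inE eqxx.
by apply: IH => r rp; apply: H; rewrite inE rp orbT.
Qed.

Lemma cprob_lb (C D : set T) (rho eh : R) : measurable C -> measurable D -> (0 <= eh)%R ->
  (0 < P C -> (rho - eh <= cprob P D C)%R) ->
  (fine (P C) * rho - eh <= fine (P (C `&` D)))%R.
Proof.
move=> mC mD eh0 H.
have PD0 : (0 <= fine (P (C `&` D)))%R by apply: fine_ge0.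
have [C0|C0] := eqVneq (P C) 0.
  by rewrite C0 /= mul0r sub0r (le_trans _ PD0)// oppr_le0.
have Cpos : 0 < P C by rewrite lt0e C0 measure_ge0.
have fC : P C \is a fin_num by apply: fin_num_measure.
have fC0 : (0 < fine (P C))%R by rewrite fine_gt0// Cpos -ge0_fin_numE.
have fC1 : (fine (P C) <= 1)%R by rewrite -lee_fin fineK// probability_le1.
have := H Cpos; rewrite /cprob ler_pdivlMr// setIC mulrC.
move=> Hr; apply: le_trans Hr; rewrite mulrBr lerD2l lerN2.
by rewrite ler_piMl.
Qed.

(* Euler iteration of the infinitesimal rates bounds the transition probabilities
   from below by the birth polynomials; these have total mass 1. *)
Lemma birth_step (past : seq R) (v : R -> nat) (t : R) (x : nat) :
  (forall s, s \in past -> 0 <= s <= t)%R -> (0 <= t < 1)%R -> t \in past -> v t = x.+1 ->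
  forall u y, (t <= u < 1)%R ->
    P (pastev past v `&` Z u @^-1` [set y.+1]) =
    P (pastev past v) * ((birthp x y).[(1 - u) / (1 - t)])%:E.
Proof.
move=> past_le t01 tp vt u.
have /andP[t0 t1] := t01.
have past1 s : s \in past -> (0 <= s < 1)%R.
  by move=> /past_le /andP[-> st]; apply: le_lt_trans t1.
set A := pastev past v.
have mA : measurable A by apply: measurable_pastev.
have fA : P A \is a fin_num by apply: fin_num_measure.
have t1' : (0 < 1 - t)%R by rewrite subr_gt0.
pose m := fine (P A).
have m0 : (0 <= m)%R by apply: fine_ge0.
have m1 : (m <= 1)%R by rewrite -lee_fin fineK// probability_le1.
pose f y r := fine (P (A `&` Z r @^-1` [set y.+1])).
pose g y r := (m * (birthp x y).[(1 - r) / (1 - t)])%R.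
have mZ r k : (t <= r < 1)%R -> measurable (Z r @^-1` [set k]).
  by move=> /andP[tr r1]; apply: Zdrv; rewrite (le_trans t0 tr) r1.
have mAZ r k : (t <= r < 1)%R -> measurable (A `&` Z r @^-1` [set k]).
  by move=> tr; apply: measurableI => //; apply: mZ.
have fin r k : (t <= r < 1)%R -> P (A `&` Z r @^-1` [set k]) \is a fin_num.
  by move=> tr; apply: fin_num_measure; apply: mAZ.
have fy0 y : f y t = (m * (y == x)%:R)%R.
  rewrite /f; have [->|yx] := eqVneq y x.
    rewrite mulr1; congr (fine (P _)); apply/seteqP; split=> [w []//|w Aw]; split=> //=.
    by rewrite Aw.
  rewrite mulr0 (_ : _ `&` _ = set0) ?measure0//.
  apply/seteqP; split=> // w [Aw /=]; rewrite Aw// vt => -[xy].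
  by move: yx; rewrite xy eqxx.
have [meas _ _ markov inf] := GB.
(* The forward equation is triangular: the bound at state [y.+1] uses only the one at state [y], so
   the states are treated in increasing order. *)
have step y : (forall r, (t <= r < 1)%R ->
    (y%:R * (m * (birthp x y.-1).[(1 - r) / (1 - t)]) <= y%:R * fine (P (A `&` Z r @^-1` [set y])))%R) ->
    forall u, (t <= u < 1)%R -> (g y u <= f y u)%R.
  move=> prev {}u /andP[tu u1]; rewrite -subr_ge0.
  have u1' : (0 < 1 - u)%R by rewrite subr_gt0.
  have [C C0 HC] := poly_taylor1 (birthp x y : {poly R}).
  apply: (@euler_ge0 R (fun r => f y r - g y r)%R (fun r => y.+1%:R / (1 - r))%R t u (y.+1%:R / (1 - u))) => //.
  - have E1 : ((1 - t) / (1 - t) = 1)%R by rewrite mulfV// gt_eqF.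
    by rewrite fy0 /g E1 (birthp_1 x y) subrr.
  - move=> r /andP[tr ru]; have r1 : (0 < 1 - r)%R by move: ru u1; clear -GB Zdrv; lra.
    by rewrite divr_ge0 ?(ltW r1)//= ler_wpM2l// lef_pV2 ?posrE//; move: ru u1; clear -GB Zdrv; lra.
  move=> eps eps0.
  have e1 : (0 < eps / 4)%R by move: eps0; clear -GB Zdrv; lra.
  have u01 : (0 <= u < 1)%R by rewrite u1 (le_trans t0).
  have [del1 del10 H1] := inf y.+1 u _ u01 e1.
  have [del2 del20 H2] := inf y u _ u01 e1.
  (* Here b - a = - h / (1 - t), so this bound on h makes the Taylor remainder at most eps / 2 times
     h. The two errors on the rates, eps / 4 times h each, use the rest of eps. *)
  pose del3 := (eps / 2 * (1 - t) ^+ 2 / (C + 1))%R.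
  have C1 : (0 < C + 1)%R by move: C0; clear -GB Zdrv; lra.
  have del30 : (0 < del3)%R by rewrite !divr_gt0 ?mulr_gt0 ?divr_gt0 ?exprn_gt0.
  exists (Num.min del1 (Num.min del2 del3)); first by rewrite !lt_min del10 del20.
  move=> r h tr; rewrite !lt_min => /andP[h0 /and3P[hd1 hd2 hd3]] rhu.
  have r0u : (0 <= r <= u)%R by apply/andP; split; move: t0 tr h0 rhu u1; clear -GB Zdrv; lra.
  have r1 : (0 < 1 - r)%R by move: t0 tr h0 rhu u1; clear -GB Zdrv; lra.
  have tr1 : (t <= r < 1)%R by apply/andP; split; move: t0 tr h0 rhu u1; clear -GB Zdrv; lra.
  have trh1 : (t <= r + h < 1)%R by apply/andP; split; move: t0 tr h0 rhu u1; clear -GB Zdrv; lra.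
  have rh1 : (r + h < 1)%R by move: t0 tr h0 rhu u1; clear -GB Zdrv; lra.
  set D := Z (r + h)%R @^-1` [set y.+1].
  have mD : measurable D by apply: mZ.
  have mk i : 0 < P (A `&` Z r @^-1` [set i]) ->
     cprob P D (A `&` Z r @^-1` [set i]) = cprob P D (Z r @^-1` [set i]) /\ 0 < P (Z r @^-1` [set i]).
    move=> Pi; split.
      apply: (markov past v r (r + h)%R i y.+1) => //; last by apply/andP; split; move: t0 tr h0 rhu u1; clear -GB Zdrv; lra.
      by move=> s /past_le /andP[-> st]; apply: le_trans tr.
    apply: lt_le_trans Pi _; apply: le_measure; rewrite ?inE; [exact: mAZ|exact: mZ|by move=> w []].
  have L1 := @cprob_lb (A `&` Z r @^-1` [set y.+1]) D (1 - h * (y.+1%:R / (1 - r)))%R (eps / 4 * h)%R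
    (mAZ _ _ tr1) mD (mulr_ge0 (ltW e1) (ltW h0)).
  have L2 := @cprob_lb (A `&` Z r @^-1` [set y]) D (h * (y%:R / (1 - r)))%R (eps / 4 * h)%R
    (mAZ _ _ tr1) mD (mulr_ge0 (ltW e1) (ltW h0)).
  have {}L1 := L1 _; have {}L2 := L2 _.
  have K1 : (fine (P (A `&` Z r @^-1` [set y.+1])) * (1 - h * (y.+1%:R / (1 - r))) - eps / 4 * h <=
     fine (P (A `&` Z r @^-1` [set y.+1] `&` D)))%R.
    apply: L1 => /mk[-> Pz].
    have [_] := H1 r h r0u (introT andP (conj h0 hd1)) rh1 Pz.
    by rewrite ler_norml => /andP[]; rewrite -/D; clear -GB Zdrv; lra.
  have K2 : (fine (P (A `&` Z r @^-1` [set y])) * (h * (y%:R / (1 - r))) - eps / 4 * h <=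
     fine (P (A `&` Z r @^-1` [set y] `&` D)))%R.
    apply: L2 => /mk[-> Pz].
    have [+ _] := H2 r h r0u (introT andP (conj h0 hd2)) rh1 Pz.
    by rewrite ler_norml => /andP[]; rewrite -/D; clear -GB Zdrv; lra.
  have K : (fine (P (A `&` Z r @^-1` [set y.+1] `&` D)) + fine (P (A `&` Z r @^-1` [set y] `&` D)) <= f y (r + h))%R.
    rewrite /f -/D -fineD; last 2 first.
    - by apply: fin_num_measure; apply: measurableI => //; apply: mAZ.
    - by apply: fin_num_measure; apply: measurableI => //; apply: mAZ.
    have mC i : measurable (A `&` Z r @^-1` [set i] `&` D) by apply: measurableI => //; apply: mAZ.
    rewrite -measureU//; last first.
      apply/seteqP; split=> // w [[[_ /= ->] _] [[_ /=] E _]].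
      by move: E; clear; lia.
    apply: fine_le.
    - by apply: fin_num_measure; apply: measurableU.
    - by apply: fin_num_measure; apply: measurableI.
    apply: le_measure; rewrite ?inE; [exact: measurableU|exact: measurableI|].
    by move=> w [[[Aw _] Dw]|[[Aw _] Dw]].
  have pr := prev r tr1.
  pose a := ((1 - r) / (1 - t))%R; pose b := ((1 - (r + h)) / (1 - t))%R.
  have a01 : (0 <= a <= 1)%R by rewrite divr_ge0 ?ler_pdivrMr ?mul1r//=; move: tr h0 rhu u1; clear -GB Zdrv; lra.
  have b01 : (0 <= b <= 1)%R by rewrite divr_ge0 ?ler_pdivrMr ?mul1r//=; move: tr h0 rhu u1; clear -GB Zdrv; lra.
  have := HC a b a01 b01; rewrite ler_norml => /andP[_].
  have -> : ((b - a) * (birthp x y)^`().[a] = - (h / (1 - r)) *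
     (y.+1%:R * (birthp x y).[a] - y%:R * (birthp x y.-1).[a]))%R.
    by rewrite -birthp_ode /a /b; field; rewrite !gt_eqF.
  have ba2 : (C * (b - a) ^+ 2 <= eps / 2 * h)%R.
    have -> : (b - a = - (h / (1 - t)))%R by rewrite /a /b; field; rewrite gt_eqF.
    rewrite sqrrN expr_div_n mulrA ler_pdivrMr ?exprn_gt0//.
    have : (h * (C + 1) <= eps / 2 * (1 - t) ^+ 2)%R.
      by move: hd3; rewrite /del3 ltr_pdivlMr// => /ltW.
    move=> /(ler_wpM2r (ltW h0)); have : (0 <= h ^+ 2)%R by apply: sqr_ge0.
    rewrite expr2; clear -GB Zdrv; nra.
  move=> HT.
  have {}HT : ((birthp x y).[b] <= (birthp x y).[a] * (1 - h * (y.+1%:R / (1 - r))) +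
     h / (1 - r) * (y%:R * (birthp x y.-1).[a]) + eps / 2 * h)%R by move: HT ba2; clear -GB Zdrv; lra.
  have {}HT := ler_wpM2l m0 HT.
  have hr : (0 <= h / (1 - r))%R by rewrite divr_ge0 ?(ltW h0) ?(ltW r1).
  have {}pr := ler_wpM2l hr pr.
  have em : (m * (eps / 2 * h) <= eps / 2 * h)%R by rewrite ler_piMl// mulr_ge0//; move: eps0 h0; clear -GB Zdrv; lra.
  rewrite /g -/a -/b {1}/f.
  set F1 := fine (P (A `&` Z r @^-1` [set y.+1])) in K1 *.
  set F2 := fine (P (A `&` Z r @^-1` [set y])) in K2 pr *.
  rewrite -/a in pr.
  set pb' := (birthp x y).[b] in HT *; set pa := (birthp x y).[a] in HT *.
  set pc := (birthp x y.-1).[a] in HT pr *.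
  have -> : ((F1 - m * pa) * (1 - h * (y.+1%:R / (1 - r))) =
    F1 * (1 - h * (y.+1%:R / (1 - r))) - m * (pa * (1 - h * (y.+1%:R / (1 - r)))))%R by ring.
  have E2 : (F2 * (h * (y%:R / (1 - r))) = h / (1 - r) * (y%:R * F2))%R by ring.
  have E3 : (h / (1 - r) * (y%:R * (m * pc)) = m * (h / (1 - r) * (y%:R * pc)))%R by ring.
  rewrite E2 in K2; rewrite E3 in pr; rewrite !mulrDr in HT.
  move: K K1 K2 pr HT em; clear -GB Zdrv; lra.
have lower y : forall r, (t <= r < 1)%R -> (g y r <= f y r)%R.
  elim: y => [|y IH]; first by apply: step => r _; rewrite !mul0r.
  by apply: step => r tr; rewrite ler_wpM2l//; apply: IH.
move=> y /andP[tu u1].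
have u01 : (0 <= u < 1)%R by rewrite u1 (le_trans t0 tu).
have a01 : (0 < (1 - u) / (1 - t) <= 1)%R.
  by rewrite divr_gt0 ?subr_gt0//= ler_pdivrMr ?mul1r ?subr_gt0//; move: tu u1; clear -GB Zdrv; lra.
(* The index of [g] is the state minus one. State 0 gets the trivial lower bound 0, which becomes
   exact because the other states exhaust the mass. *)
pose p (k : nat) : \bar R := if k is k'.+1 then (g k' u)%:E else 0.
have pos k : (0 <= g k u)%R.
  have /andP[/ltW a0 a1] := a01.
  by rewrite mulr_ge0// birthpE !mulr_ge0 ?exprn_ge0 ?subr_ge0.
have p0 k : 0 <= p k by case: k => //= k; rewrite lee_fin.
rewrite (@drv_dominate _ _ _ P nat (Z u) A p)//.
- by rewrite /p /g EFinM fineK.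
- exact: Zdrv.
- case=> [|k] /=; first exact: measure_ge0.
  by rewrite -[leRHS]fineK ?fin ?tu ?u1// lee_fin; apply: lower; rewrite tu u1.
- rewrite esum_natS//= add0e.
  under eq_esum do rewrite /g EFinM.
  rewrite esumZl//; last first.
    move=> k; have /andP[/ltW a0 a1] := a01.
    by rewrite lee_fin birthpE !mulr_ge0 ?exprn_ge0 ?subr_ge0.
  by rewrite birthp_sum// mule1 fineK.
Qed.

End birth.

(** * The law of the block process *)

Lemma birthp_prod {R : realType} (s t q : R) (x y z : nat) :
  0 <= s <= t -> t <= q < 1 ->
  (birthp 0 x).[1 - s] * (birthp x y).[(1 - t) / (1 - s)] * (birthp y z).[(1 - q) / (1 - t)]
  = om3 s t q (x, y, z).
Proof.
move=> /andP[s0 st] /andP[tq q1].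
have q1' : 1 - q != 0 by rewrite subr_eq0 gt_eqF.
have t1' : 1 - t != 0 by rewrite subr_eq0 gt_eqF// (le_lt_trans tq).
have s1' : 1 - s != 0 by rewrite subr_eq0 gt_eqF// (le_lt_trans st)// (le_lt_trans tq).
rewrite !birthpE /om3 /=.
have [xy|xy] := leqP x y; last by rewrite (bin_small xy); ring.
have [yz|yz] := leqP y z; last by rewrite (bin_small yz); ring.
have -> : phi t - phi s = (t - s) / ((1 - s) * (1 - t)).
  by rewrite /phi; field; rewrite s1' t1'.
have -> : phi q - phi t = (q - t) / ((1 - t) * (1 - q)).
  by rewrite /phi; field; rewrite q1' t1'.
have -> : 1 - (1 - t) / (1 - s) = (t - s) / (1 - s) by field.
have -> : 1 - (1 - q) / (1 - t) = (q - t) / (1 - t) by field.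
rewrite /phi bin0 subn0 subKr.
have [a ya] : exists a, y = (x + a)%N by exists (y - x)%N; rewrite subnKC.
have [b zb] : exists b, z = (x + a + b)%N by exists (z - y)%N; rewrite -ya subnKC.
rewrite {}zb {}ya in xy yz *; rewrite !addKn.
rewrite !expr_div_n !exprMn !exprS !exprD.
by field; rewrite ?s1' ?t1' ?q1' ?expf_neq0.
Qed.

Section birth_law.
Context d (T : measurableType d) (R : realType) (P : probability T R) (Z : R -> T -> nat).
Hypothesis GB : geometric_birth_process P Z.
Local Open Scope ereal_scope.

Lemma pastev1 s v x : v s = x -> pastev Z [:: s] v = Z s @^-1` [set x].
Proof.
move=> vs; apply/seteqP; split=> [w /(_ s)|w Zw r] /=; first by rewrite inE eqxx vs; apply.
by rewrite inE => /eqP->; rewrite vs.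
Qed.

Lemma pastev2 s t v y : v t = y -> pastev Z [:: s; t] v = pastev Z [:: s] v `&` Z t @^-1` [set y].
Proof.
move=> vt; apply/seteqP; split=> [w H|w [H1 /= H2] r] /=.
  split; last by rewrite -vt; apply: H; rewrite !inE eqxx orbT.
  by move=> r; rewrite inE => /eqP->; apply: H; rewrite !inE eqxx.
rewrite !inE => /orP[/eqP->|/eqP->]; last by rewrite vt.
by apply: H1; rewrite inE.
Qed.

Lemma birth_law u x : (0 <= u < 1)%R -> P (Z u @^-1` [set x.+1]) = ((birthp 0 x).[1 - u])%:E.
Proof.
move=> u01; have [_ _ Z0 _ _] := GB.
have pT : pastev Z [:: 0%R] (fun=> 1%N) = setT.
  by apply/seteqP; split=> // w _ r; rewrite inE => /eqP ->; rewrite Z0.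
have := @birth_step _ _ _ _ _ GB [:: 0%R] (fun=> 1%N) 0%R 0%N _ _ _ _ u x u01.
rewrite pT setTI probability_setT mul1e subr0 divr1; apply => //.
- by move=> r; rewrite inE => /eqP->; rewrite lexx.
- by rewrite lexx ltr01.
- by rewrite inE.
Qed.

Lemma birth_om1 q z : (0 <= q < 1)%R -> P (Z q @^-1` [set z.+1]) = (om1 q z)%:E.
Proof. by move=> q01; rewrite birth_law// birthpE bin0 subn0 subKr expr1 mul1r. Qed.

Lemma birth_cprob s t q v x y z : (0 <= s <= t)%R -> (t <= q < 1)%R -> (0 < q)%R ->
  v s = x.+1 -> v t = y.+1 ->
  (om1 q z * cprob P (pastev Z [:: s; t] v) (Z q @^-1` [set z.+1]) = om3 s t q (x, y, z))%R.
Proof.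
move=> st tq q0 vs vt.
have [/andP[s0 st'] /andP[tq' q1]] := (st, tq).
have q01 : (0 <= q < 1)%R by rewrite ltW.
have s01 : (0 <= s < 1)%R by rewrite s0 (le_lt_trans st')// (le_lt_trans tq').
have t01 : (0 <= t < 1)%R by rewrite (le_trans s0 st') (le_lt_trans tq').
have om0 : (0 < om1 q z)%R by rewrite mulr_gt0 ?exprn_gt0// subr_gt0.
rewrite /cprob birth_om1//= mulrCA mulfV ?mulr1 ?gt_eqF//.
rewrite (@birth_step _ _ _ _ _ GB _ _ t y)//; last 2 first.
- move=> r; rewrite !inE => /orP[/eqP->|/eqP->]; first by rewrite s0.
  by rewrite lexx andbT; case/andP: t01.
- by rewrite !inE eqxx orbT.
rewrite (pastev2 _ vt) (@birth_step _ _ _ _ _ GB _ _ s x)//; last 3 first.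
- by move=> r; rewrite inE => /eqP->; rewrite s0 lexx.
- by rewrite inE.
- by rewrite st'; case/andP: t01.
by rewrite (pastev1 vs) birth_law//= -birthp_prod.
Qed.

End birth_law.

(** * The word of triples of a q-block process *)

Section word_law.
Context (R : realType) (q : R) d (T : measurableType d) (P : probability T R)
  (B : T -> finperm) (Z : nat -> R -> T -> nat).
Hypotheses (q0 : (0 < q)%R) (q1 : (q < 1)%R) (QB : q_block_process q P B Z).
Local Open Scope ereal_scope.

Let q01 : (0 <= q <= 1)%R. Proof. by rewrite !ltW. Qed.

Definition block_word (s t : R) (w : T) : seq (nat * nat * nat) :=
  mkseq (fun i => ((Z i s w - 1, Z i t w - 1)%N, nth 0%N (pword (B w)) i)) (psize (B w)).

Lemma zs_block_word s t w : zs (block_word s t w) = pword (B w).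
Proof.
rewrite /zs -map_comp; apply: (@eq_from_nth _ 0%N); first by rewrite size_map size_iota size_pword.
move=> i; rewrite size_map size_iota => ib.
by rewrite (nth_map 0%N) ?size_iota//= nth_iota.
Qed.

Lemma size_block_word s t w : size (block_word s t w) = psize (B w).
Proof. by rewrite size_mkseq. Qed.

Lemma block_at_xs s t w : block_at B Z s w = perm_of_word (xs (block_word s t w)).
Proof. by rewrite /block_at perm_of_rinv_word /xs -map_comp. Qed.

Lemma block_at_ys s t w : block_at B Z t w = perm_of_word (ys (block_word s t w)).
Proof. by rewrite /block_at perm_of_rinv_word /ys -map_comp. Qed.

Lemma drv_block_word s t : (0 <= s <= q)%R -> (0 <= t <= q)%R -> drv (block_word s t).
Proof.
move=> sq tq l; have [[dB _] mZ _ _] := QB.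
have mZk i r k : (0 <= r <= q)%R -> measurable (Z i r @^-1` [set k]).
  by move=> rq; have := mZ i r rq measurableT [set k] I; rewrite setTI.
pose a0 := (0, 0, 0)%N.
have -> : block_word s t @^-1` [set l] = (B @^-1` [set b | pword b = zs l]) `&`
   \bigcap_(i in [set i | (i < size l)%N]) (
     (Z i s @^-1` [set k | (k - 1)%N = (nth a0 l i).1.1]) `&`
     (Z i t @^-1` [set k | (k - 1)%N = (nth a0 l i).1.2])).
  apply/seteqP; split=> [w /= wl|w [/= Bl H]].
    split; first by rewrite /= -(zs_block_word s t) wl.
    move=> i /= il; rewrite -wl nth_mkseq//.
    by rewrite -(size_block_word s t) wl.
  have sl : psize (B w) = size l by rewrite -size_pword Bl size_map.
  apply: (@eq_from_nth _ a0); first by rewrite size_block_word.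
  rewrite size_block_word sl => i il; have [/= E1 E2] := H i il.
  rewrite nth_mkseq ?sl// E1 E2 Bl /zs (nth_map a0)//.
  by case: (nth a0 l i) => [[]].
apply: measurableI; first exact: drv_set.
apply: bigcap_measurableType => i _; apply: measurableI.
  by apply: drv_set => k; apply: mZk.
by apply: drv_set => k; apply: mZk.
Qed.

(** Only an inequality at this point, because the truncated subtraction in [block_word] does not
    distinguish Z = 0 from Z = 1; the total mass makes it an equality in [block_word_law]. *)
Lemma block_word_ge s t l : (0 <= s <= t)%R -> (t <= q)%R ->
  (wt (om3 s t q) l * (hit 0 (zs l))%:R)%:E <= P (block_word s t @^-1` [set l]).
Proof.
move=> st tq.
have [[/andP[s0 st'] tq']] := (st, tq).
case: (boolP (hit 0 (zs l))) => hl; last by rewrite mulr0 measure_ge0.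
rewrite mulr1.
(* For [s = t] the prescribed values must be a function of time. Words with x different from y at
   some letter are set apart: their weight is 0, as it contains a positive power of [phi t - phi s]
   or a vanishing binomial coefficient. *)
have [sxy|] := boolP ((s == t) ==> all (fun a => a.1.1 == a.1.2) l); last first.
  rewrite negb_imply => /andP[/eqP ste /allPn[[[x y] z] al xy]].
  suff -> : wt (om3 s t q) l = 0%R by exact: measure_ge0.
  apply/eqP; rewrite /wt prodf_seq_eq0; apply/hasP; exists (x, y, z) => //=.
  rewrite /om3 /= ste subrr.
  have [xy'|xy'] := leqP x y; last by rewrite (bin_small xy'); apply/eqP; ring.
  by rewrite expr0n subn_eq0 leqNgt ltn_neqAle xy xy'/= !(mulr0, mul0r).
have [mB mZ _ [d' [T' [P' [G [GB law]]]]]] := QB.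
pose b := perm_of_word (zs l).
have bl : pword b = zs l by rewrite perm_of_wordK// hit_adm.
have sb : psize b = size l by rewrite psize_perm_of_word size_map.
pose a0 := (0, 0, 0)%N.
pose v i r := if r == s then (nth a0 l i).1.1.+1 else (nth a0 l i).1.2.+1.
have vs i : v i s = (nth a0 l i).1.1.+1 by rewrite /v eqxx.
have vt i : (i < size l)%N -> v i t = (nth a0 l i).1.2.+1.
  move=> il; rewrite /v; case: eqP => // ts; move: sxy; rewrite ts eqxx /= => /allP/(_ _ (mem_nth a0 il)).
  by move=> /eqP ->.
have := law b [:: s; t] v.
rewrite (mblock_law _ mB) bl hl mul1r.
set S := [set w | _]; move=> H.
have {}H : P (B @^-1` [set b] `&` S) = (wt (om3 s t q) l)%:E.
  rewrite {}H; last by move=> r; rewrite !inE => /orP[/eqP->|/eqP->]; apply/andP; split; lra.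
  rewrite -EFinM; congr EFin.
  under eq_bigr => i _ do rewrite -nth_rword -/(pword b) bl.
  rewrite -(big_mkord xpredT (fun i => cprob P' [set w | forall r, r \in [:: s; t] -> G r w = v i r]
     (G q @^-1` [set (nth 0%N (zs l) i).+1]))).
  rewrite -/(psize b) sb big_mkord /wt {1}/zs big_map !(big_nth a0) !big_mkord -big_split/=.
  apply: eq_bigr => i _; rewrite /zs (nth_map a0)//.
  case E: (nth a0 l i) => [[x y] z].
  have := @birth_cprob _ _ _ _ _ GB s t q (v i) x y z st.
  by rewrite vs vt// E /=; apply; rewrite ?tq.
rewrite -H; apply: le_measure; rewrite ?inE.
- have -> : (B @^-1` [set b]) `&` S = (B @^-1` [set b]) `&` \bigcap_(i in [set i | (i < psize b)%N])
       ((Z i s @^-1` [set v i s]) `&` (Z i t @^-1` [set v i t])).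
    apply/seteqP; split=> w /= [Bw Sw]; split=> // i.
      by move=> ib; split; apply: Sw; rewrite // !inE eqxx ?orbT.
    by move=> r /Sw[/= ? ?]; rewrite !inE => /orP[/eqP->|/eqP->].
  have [dB _] := mB.
  apply: measurableI; first exact: dB.
  have mZk i r k : (0 <= r <= q)%R -> measurable (Z i r @^-1` [set k]).
    by move=> rq; have := mZ i r rq measurableT [set k] I; rewrite setTI.
  apply: bigcap_measurableType => i _.
  by apply: measurableI; apply: mZk; apply/andP; split; lra.
- by apply: drv_block_word; apply/andP; split; lra.
move=> w [/= Bw Sw]; apply: (@eq_from_nth _ a0); first by rewrite size_block_word Bw.
rewrite size_block_word Bw sb => i il.
rewrite nth_mkseq ?Bw ?sb// bl (nth_map a0)//.
rewrite (Sw i s) ?sb ?inE ?eqxx// (Sw i t) ?sb ?inE ?eqxx ?orbT//.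
by rewrite vs vt// !subSS !subn0; case: (nth a0 l i) => [[]].
Qed.

End word_law.

Section pb_closure.
Context (R : realType) (A : Type).

Lemma pb_cst (c : R) : 0 <= c -> poly_growth (fun _ : seq A => c).
Proof. by move=> c0; split=> //; exists 0%N, c => l; rewrite expr0 mulr1. Qed.

Lemma pbZ (c : R) (f : seq A -> R) : 0 <= c -> poly_growth f -> poly_growth (fun l => c * f l).
Proof. by move=> c0 pf; apply: pbM => //; apply: pb_cst. Qed.

Lemma pbD (f g : seq A -> R) : poly_growth f -> poly_growth g -> poly_growth (fun l => f l + g l).
Proof.
move=> [f0 [k [C fC]]] [g0 [k' [C' gC]]]; split=> [l|]; first by rewrite addr_ge0.
exists (maxn k k'), (`|C| + `|C'|) => l.
have s1 : 1 <= (size l).+1%:R :> R by rewrite ler1n.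
rewrite mulrDl; apply: lerD.
  apply: le_trans (fC l) _; apply: (@le_trans _ _ (`|C| * (size l).+1%:R ^+ k)).
    by rewrite ler_wpM2r ?exprn_ge0// ler_norm.
  by rewrite ler_wpM2l// ler_weXn2l// leq_maxl.
apply: le_trans (gC l) _; apply: (@le_trans _ _ (`|C'| * (size l).+1%:R ^+ k')).
  by rewrite ler_wpM2r ?exprn_ge0// ler_norm.
by rewrite ler_wpM2l// ler_weXn2l// leq_maxr.
Qed.

End pb_closure.

Section word_law.
Context (R : realType) (q : R) d (T : measurableType d) (P : probability T R)
  (B : T -> finperm) (Z : nat -> R -> T -> nat).
Hypotheses (q0 : (0 < q)%R) (q1 : (q < 1)%R) (QB : q_block_process q P B Z).
Variables (s t : R).
Hypotheses (s0 : (0 <= s)%R) (st : (s <= t)%R) (tq : (t <= q)%R).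
Local Open Scope ereal_scope.

Let dW : drv (block_word B Z s t).
Proof. by apply: (drv_block_word QB); apply/andP; split; move: s0 st tq; lra. Qed.

Lemma block_word_law l :
  P (block_word B Z s t @^-1` [set l]) = (wt (om3 s t q) l * (hit 0 (zs l))%:R)%:E.
Proof.
rewrite -[X in P X]setTI (@drv_dominate _ _ _ P _ (block_word B Z s t) setT
  (fun l => (wt (om3 s t q) l * (hit 0 (zs l))%:R)%:E))//.
- by move=> i; rewrite lee_fin mulr_ge0// wt_ge0// => a; apply: om3_ge0.
- by move=> i; rewrite setTI; apply: block_word_ge; rewrite ?s0.
rewrite probability_setT (E3_zs s0 st tq q0 q1 (F := fun z => (hit 0 z)%:R))//.
by apply: hit_sum1; rewrite q0 q1.
Qed.

Lemma block_word_integral (F : seq (nat * nat * nat) -> R) : (forall l, 0 <= F l)%R ->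
  \int[P]_w (F (block_word B Z s t w))%:E = E3 s t q F.
Proof.
move=> F0; rewrite (integral_drv P dW)//; apply: eq_esum => l _.
by rewrite block_word_law -EFinM; congr EFin; ring.
Qed.

Lemma block_word_expectation F : (forall l, 0 <= F l)%R ->
  'E_P[fun w => F (block_word B Z s t w)] = E3 s t q F.
Proof. by move=> F0; rewrite unlock block_word_integral. Qed.

Lemma block_word_Lfun F : poly_growth F -> (fun w => F (block_word B Z s t w)) \in Lfun P 1.
Proof.
move=> pF; have [F0 _] := pF; apply/Lfun1_integrable/integrableP; split.
  by apply/measurable_EFinP; apply: drv_measurable.
under eq_integral do rewrite gee0_abs ?lee_fin//.
under eq_integral do rewrite /=.
rewrite block_word_integral//; have := E3_fin s0 st tq q0 q1 pF.
by rewrite fin_numElt => /andP[].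
Qed.

Lemma block_word_cov F G : poly_growth F -> poly_growth G ->
  fine (covariance P (fun w => F (block_word B Z s t w)) (fun w => G (block_word B Z s t w))) =
  (fine (E3 s t q (fun l => F l * G l)) - fine (E3 s t q F) * fine (E3 s t q G))%R.
Proof.
move=> pF pG; have [F0 _] := pF; have [G0 _] := pG.
have pFG := pbM pF pG.
rewrite covarianceE ?block_word_Lfun//; last exact: (block_word_Lfun pFG).
rewrite (@block_word_expectation (fun l => F l * G l)%R); last by case: pFG.
rewrite !block_word_expectation// fineB ?fineM ?fin_numM ?E3_fin//.
Qed.

Lemma E3Z (c : R) F : (0 <= c)%R -> poly_growth F ->
  fine (E3 s t q (fun l => c * F l)%R) = (c * fine (E3 s t q F))%R.
Proof.
move=> c0 pF; have [F0 _] := pF.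
transitivity (fine (c%:E * E3 s t q F)); last by rewrite fineM// E3_fin.
congr fine; rewrite /E3 -esumZl// => [|l].
  by apply: eq_esum => l _; rewrite -EFinM; congr EFin; ring.
by rewrite lee_fin !mulr_ge0// wt_ge0// => a; apply: om3_ge0.
Qed.

Lemma E3D F G : poly_growth F -> poly_growth G ->
  fine (E3 s t q (fun l => F l + G l)%R) = (fine (E3 s t q F) + fine (E3 s t q G))%R.
Proof.
move=> pF pG; have [F0 _] := pF; have [G0 _] := pG.
rewrite -fineD ?(E3_fin s0 st tq q0 q1)// /E3 -esumD => [|l _|l _].
- by congr fine; apply: eq_esum => l _; rewrite -EFinD; congr EFin; ring.
- by rewrite lee_fin !mulr_ge0// wt_ge0// => a; apply: om3_ge0.
- by rewrite lee_fin !mulr_ge0// wt_ge0// => a; apply: om3_ge0.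
Qed.

End word_law.

(** * The covariance function *)

Section binomials.
Local Open Scope nat_scope.

Lemma upper_vandermonde N a b :
  \sum_(j < N.+1) 'C(j, a) * 'C(N - j, b) = 'C(N.+1, (a + b).+1).
Proof.
elim: N a b => [|N IH] a b.
  by rewrite big_ord1 !bin0n; case: a b => [|a] [|b].
case: b => [|b].
  rewrite big_ord_recr /= subnn.
  under eq_bigr => j _ do rewrite bin0 -(bin0 (N - j)).
  by rewrite IH bin0 muln1 addn0 binS.
rewrite big_ord_recr /= subnn bin0n muln0 addn0.
under eq_bigr => j _ do rewrite (subSn (leq_ord j)) binS mulnDr.
by rewrite big_split/= !IH !addnS [RHS]binS.
Qed.

(** Letting the shifted index i + j - 2 run over all of 0, ..., 2n - 2 adds only zero terms, and the
    full sum is [upper_vandermonde]. *)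
Lemma sum_bin_row n i : 0 < i <= n ->
  \sum_(1 <= j < n.+1) 'C(i + j - 2, i - 1) * 'C(2 * n - i - j, n - i) = 'C(2 * n - 1, n).
Proof.
move=> /andP[i0 ile].
have n0 : 0 < n by apply: leq_trans ile.
have := upper_vandermonde (2 * n - 2) (i - 1) (n - i).
have -> : (2 * n - 2).+1 = 2 * n - 1 by lia.
have -> : ((i - 1) + (n - i)).+1 = n by lia.
move=> <-; rewrite -(big_mkord xpredT (fun j => 'C(j, i - 1) * 'C(2 * n - 2 - j, n - i))).
rewrite [RHS](@big_cat_nat _ _ _ (i - 1)) //=; last by lia.
rewrite [X in _ = X + _]big_nat_cond [X in _ = X + _]big1 => [|j /andP[/andP[_ ji] _]]; last by rewrite bin_small.
rewrite add0n [RHS](@big_cat_nat _ _ _ (i - 1 + n))//=; [|lia|lia].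
rewrite [X in _ = _ + X]big_nat_cond [X in _ = _ + X]big1 => [|j /andP[/andP[ji ju] _]]; last first.
  by rewrite [X in _ * X]bin_small ?muln0//; move: ji ju ile i0; clear; lia.
rewrite addn0 -{1}(add0n 1) -[n.+1]addn1 big_addn -{2}(add0n (i - 1)) (addnC (i - 1)) big_addn !addnK.
apply: eq_big_nat => j _; congr ('C(_, _) * 'C(_, _)); lia.
Qed.

Lemma sum_bin_col n j : 0 < j <= n ->
  \sum_(1 <= i < n.+1) 'C(i + j - 2, i - 1) * 'C(2 * n - i - j, n - i) = 'C(2 * n - 1, n).
Proof.
move=> jn; rewrite -(sum_bin_row jn); apply: eq_big_nat => i ilt.
rewrite [i + j]addnC (_ : 2 * n - j - i = 2 * n - i - j); last lia.
rewrite -(@bin_sub (j + i - 2)); last lia.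
rewrite -(@bin_sub (2 * n - i - j)); last lia.
congr ('C(_, _) * 'C(_, _)); lia.
Qed.

End binomials.

Section core.
Context {R : realType}.
Variable n : nat.
Hypothesis n0 : (0 < n)%N.

(* The bracket in the covariance function, as a linear function of the second moments. *)
Definition core (A : nat -> nat -> R) (W : nat -> R) (V : R) : R :=
  (((2 * n - 1)`!)%:R)^-1 *
     (\sum_(1 <= i < n.+1) \sum_(1 <= j < n.+1)
        ('C(i + j - 2, i - 1) * 'C(2 * n - i - j, n - i))%:R * A j i)
   - (((n - 1)`! * n`!)%:R)^-1 * (\sum_(1 <= i < n.+1) W i)
   + ((((n - 1)`!) ^ 2)%:R)^-1 * V.

Lemma core_ext A A' W W' V V' :
  (forall i j, (0 < i <= n)%N -> (0 < j <= n)%N -> A j i = A' j i) ->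
  (forall i, (0 < i <= n)%N -> W i = W' i) -> V = V' -> core A W V = core A' W' V'.
Proof.
move=> AA WW ->; rewrite /core; congr (_ * _ - _ * _ + _).
  by apply: eq_big_nat => i ilt; apply: eq_big_nat => j jlt; rewrite AA.
by apply: eq_big_nat => i ilt; rewrite WW.
Qed.

Lemma coreZ c A W V :
  core (fun j i => c * A j i) (fun i => c * W i) (c * V) = c * core A W V.
Proof.
rewrite /core -[X in _ - _ * X]mulr_sumr.
under eq_bigr => i _.
  under eq_bigr => j _ do rewrite mulrCA.
  rewrite -mulr_sumr; over.
by rewrite -mulr_sumr; ring.
Qed.

(* The coefficients cancel on separable terms; hence second moments may replace
   covariances, and the boundary terms of the Wald identity drop out. *)
Lemma core_shift A W V (g : R) (gx gy : nat -> R) :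
  core (fun j i => A j i + gx i + gy j) (fun i => W i + (2 * g + gx i + gy i)) (V + 2 * g) =
  core A W V.
Proof.
rewrite /core.
have -> : \sum_(1 <= i < n.+1) \sum_(1 <= j < n.+1)
   ('C(i + j - 2, i - 1) * 'C(2 * n - i - j, n - i))%:R * (A j i + gx i + gy j) =
  \sum_(1 <= i < n.+1) \sum_(1 <= j < n.+1)
   ('C(i + j - 2, i - 1) * 'C(2 * n - i - j, n - i))%:R * A j i +
   ('C(2 * n - 1, n))%:R * (\sum_(1 <= i < n.+1) (gx i + gy i)) :> R.
  under eq_bigr => i _ do under eq_bigr => j _ do rewrite !mulrDr.
  under eq_bigr => i _ do rewrite !big_split/=.
  rewrite !big_split/= -addrA; congr (_ + _); rewrite mulrDr; congr (_ + _).
    rewrite mulr_sumr; apply: eq_big_nat => i ilt.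
    by rewrite -mulr_suml -natr_sum sum_bin_row.
  rewrite exchange_big_nat/= mulr_sumr; apply: eq_big_nat => j jlt.
  by rewrite -mulr_suml -natr_sum sum_bin_col.
rewrite [\sum_(_ <= _ < _) (W _ + _)]big_split/=.
set S1 := \sum_(_ <= _ < _) \sum_(_ <= _ < _) _; set S2 := \sum_(_ <= _ < _) W _.
have -> : \sum_(1 <= i < n.+1) (2 * g + gx i + gy i) = n%:R * (2 * g) + \sum_(1 <= i < n.+1) (gx i + gy i).
  under eq_bigr => i _ do rewrite -addrA.
  by rewrite big_split/= sumr_const_nat subn1 /= -[in LHS](mulr_natl _ n).
set S3 := \sum_(_ <= _ < _) (gx _ + _).
have nf k : (k`!%:R : R) != 0 by rewrite pnatr_eq0 -lt0n fact_gt0.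
(* The prefactors match: the constant row sum turns the first one into the second, and a sum of [n]
   equal terms turns the second one into the third ([fE]). *)
have binE : (((2 * n - 1)`!)%:R)^-1 * ('C(2 * n - 1, n))%:R = (((n - 1)`! * n`!)%:R)^-1 :> R.
  rewrite -(@bin_fact (2 * n - 1) n); last lia.
  rewrite (_ : (2 * n - 1 - n = n - 1)%N); last lia.
  rewrite !natrM.
  have c0 : ('C(2 * n - 1, n)%:R : R) != 0 by rewrite pnatr_eq0 -lt0n bin_gt0; lia.
  by field; rewrite !nf c0.
have fE : (((n - 1)`! * n`!)%:R)^-1 * n%:R = ((((n - 1)`!) ^ 2)%:R)^-1 :> R.
  have nn : (n%:R : R) != 0 by rewrite pnatr_eq0 -lt0n.
  have -> : n`! = (n * (n - 1)`!)%N by case: (n) n0 => // m _; rewrite subn1 factS.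
  by rewrite natrX !natrM; field; rewrite nf nn.
rewrite -fE -binE; ring.
Qed.

End core.

(** * Pattern counts as functions of words *)

Section pattern_words.
Context {R : realType}.

Definition occw (b : finperm) (l : seq nat) : R := (Occ b (perm_of_word l))%:R.

Lemma pb_occw b : poly_growth (occw b).
Proof.
split=> [l|]; first by rewrite /occw.
exists (psize b), 1 => l; rewrite mul1r /occw -natrX ler_nat (leq_trans (Occ_le _ _))//.
by rewrite psize_perm_of_word; case: (psize b) => // k; rewrite leq_exp2r.
Qed.

Lemma occw_cat b l l' : is_block b -> adm l -> adm l' -> occw b (l ++ l') = occw b l + occw b l'.
Proof. by move=> bb al al'; rewrite /occw perm_of_word_cat// Occ_dsum// natrD. Qed.

Definition minw (l : seq (nat * nat)) : seq nat := [seq minn a.1 a.2 | a <- l].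

(* On words with x <= y letterwise, minw is the word of the x; the minimum makes
   it admissible as soon as the word of the y is. *)
Definition occx (b : finperm) (l : seq (nat * nat)) : R := occw b (minw l).
Definition occy (b : finperm) (l : seq (nat * nat)) : R := occw b (map snd l).

Lemma adm_minw l : adm (map snd l) -> adm (minw l).
Proof.
move=> /admP H; apply/admP => i; rewrite size_map => il.
have := H i; rewrite size_map => /(_ il); apply: leq_ltn_trans.
by rewrite !(nth_map (0, 0)%N)// leq_add2r geq_minr.
Qed.

Lemma addf_occx b : is_block b -> block_additive (occx b).
Proof.
move=> bb l l'; rewrite /cl -!adm_level => al al'.
by rewrite /occx /minw map_cat occw_cat// adm_minw.
Qed.

Lemma addf_occy b : is_block b -> block_additive (occy b).
Proof.
by move=> bb l l'; rewrite /cl -!adm_level => al al'; rewrite /occy map_cat occw_cat.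
Qed.

Lemma pb_occx b : poly_growth (occx b). Proof. exact: (@pb_lift R (nat * nat)%type nat (fun a => minn a.1 a.2) (occw b) (pb_occw b)). Qed.
Lemma pb_occy b : poly_growth (occy b). Proof. exact: (@pb_lift R (nat * nat)%type nat snd (occw b) (pb_occw b)). Qed.

Lemma minw_good l : good l -> minw (map fst l) = xs l.
Proof.
elim: l => //= -[[x y] z] l IH /andP[/andP[/= xy _] gl].
by rewrite (minn_idPl xy) IH.
Qed.

Definition szw (l : seq nat) : R := (size l)%:R.
Definition onew (l : seq nat) : R := 1.

Lemma pb_szw : poly_growth szw. Proof. exact: pb_size. Qed.
Lemma pb_onew : poly_growth onew. Proof. by apply: pb_cst. Qed.

Section fixed.
Variables s t q : R.
Hypotheses (s0 : 0 <= s) (st : s <= t) (tq : t <= q) (q0 : 0 < q) (q1 : q < 1).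

Lemma E3_good_eq F F' : (forall l, good l -> F l = F' l) -> E3 s t q F = E3 s t q F'.
Proof.
move=> FF; apply: eq_esum => l _; congr EFin.
by case: (boolP (good l)) => gl; [rewrite FF|rewrite (wt_good _ _ _ gl) !mul0r].
Qed.

(** Keeps the single word in which the permutation equals [b] at the three times. The bound
    increases with [s] but vanishes at [s = 0] if [b] has an inversion; hence it is uniform only
    away from 0. *)
Lemma Acov_lower (g h : seq nat -> R) b : poly_growth g -> poly_growth h -> is_block b ->
  1 <= g (pword b) -> 1 <= h (pword b) ->
  \prod_(z <- pword b) ((1 - q) ^+ z.+1 * phi s ^+ z) <= Acov q g h s t.
Proof.
move=> pg ph bb g1 h1.
have [g0 _] := pg; have [h0 _] := ph.
have pF : poly_growth (fun l : seq (nat * nat * nat) => g (xs l) * h (ys l)).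
  apply: pbM; first exact: (@pb_lift R _ _ (fun a : nat * nat * nat => a.1.1) _ pg).
  exact: (@pb_lift R _ _ (fun a : nat * nat * nat => a.1.2) _ ph).
pose l0 := [seq (z, z, z) | z <- pword b].
have x0 : xs l0 = pword b by rewrite /xs -map_comp map_id.
have y0 : ys l0 = pword b by rewrite /ys -map_comp map_id.
have z0 : zs l0 = pword b by rewrite /zs -map_comp map_id.
have w0 : wt (om3 s t q) l0 = \prod_(z <- pword b) ((1 - q) ^+ z.+1 * phi s ^+ z).
  rewrite /wt big_map; apply: eq_bigr => z _.
  by rewrite /om3 /= !binn !subnn !expr0 !mulr1.
have wge l : 0 <= wt (om3 s t q) l by apply: wt_ge0 => a; apply: om3_ge0.
rewrite -lee_fin fineK ?E3_fin//.
apply: (@le_trans _ _ (\esum_(l in [set l0]) (wt (om3 s t q) l *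
   ((hit 0 (zs l))%:R * (g (xs l) * h (ys l))))%:E)%E).
  rewrite esum_set1; last by rewrite lee_fin !mulr_ge0.
  rewrite lee_fin x0 y0 z0 -w0 (_ : hit 0 (pword b)) ?mul1r; last exact/is_blockP.
  by rewrite ler_peMr// mulr_ege1.
have pos l : (0 <= (wt (om3 s t q) l * ((hit 0 (zs l))%:R * (g (xs l) * h (ys l))))%:E)%E.
  by rewrite lee_fin !mulr_ge0.
rewrite /E3 [leRHS](esumID [set l0])// setTI leeDl//.
by apply: esum_ge0 => l _; apply: pos.
Qed.

End fixed.
End pattern_words.

(** After normalization each [gamma] term depends on one of the two patterns only, which is the form
    that [core_shift] removes. *)
Lemma wald_ratio (F : fieldType) (k u v U gu gv : F) : k != 0 -> u != 0 -> v != 0 ->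
  (k * U + u * gv + v * gu) / (k * u * (k * v)) =
  k^-1 * (U / (u * v)) + gu / (k ^+ 2 * u) + gv / (k ^+ 2 * v).
Proof. by move=> k0 u0 v0; field; rewrite k0 u0 v0. Qed.

(** * Independence of the covariance function from q *)

Section Hval.
Context {R : realType}.
Variable bs : seq finperm.
Let bn (i : nat) : finperm := nth (mkperm (1%g : 'S_0)) bs (i - 1).
Let n := size bs.
Hypothesis bsP : forall b, b \in bs -> is_block b.
Hypothesis n0 : (0 < n)%N.
Let f (i : nat) : seq nat -> R := occw (bn i).

Let bnP i : (0 < i <= n)%N -> is_block (bn i).
Proof. by case: i => // i /= il; apply: bsP; apply: mem_nth; rewrite subn1. Qed.

Definition bracket (q s t : R) : R :=
  core n (fun j i => Acov q (f i) (f j) s t / (Acov q (f i) onew s t * Acov q onew (f j) s t))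
    (fun i => Acov q (f i) szw s t / (Acov q (f i) onew s t * Acov q onew szw s t) +
              Acov q szw (f i) s t / (Acov q szw onew s t * Acov q onew (f i) s t))
    (Acov q szw szw s t / (Acov q szw onew s t * Acov q onew szw s t)).

Definition Hval (q : R) (e : R -> R) (s t : R) : R :=
  Acov q szw onew s t * e s * e t * bracket q s t.

Section moments.
Variables s t q : R.
Hypotheses (s0 : 0 < s) (st : s <= t) (tq : t <= q) (q1 : q < 1).
Let s0' := ltW s0.
Let q0 : 0 < q. Proof. by apply: lt_le_trans s0 _; apply: le_trans tq. Qed.

Let pbX g : poly_growth g -> poly_growth (fun l : seq (nat * nat * nat) => g (xs l) : R).
Proof. exact: (@pb_lift R _ _ (fun a : nat * nat * nat => a.1.1) g). Qed.
Let pbY g : poly_growth g -> poly_growth (fun l : seq (nat * nat * nat) => g (ys l) : R).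
Proof. exact: (@pb_lift R _ _ (fun a : nat * nat * nat => a.1.2) g). Qed.

Lemma Acov_pos g h b : poly_growth g -> poly_growth h -> is_block b ->
  1 <= g (pword b) -> 1 <= h (pword b) -> 0 < Acov q g h s t.
Proof.
move=> pg ph bb g1 h1; apply: lt_le_trans (Acov_lower s0' st tq q0 q1 pg ph bb g1 h1).
apply: prodr_gt0 => z _.
rewrite mulr_gt0 ?exprn_gt0 ?subr_gt0// divr_gt0// subr_gt0.
by apply: le_lt_trans q1; apply: le_trans tq.
Qed.

Lemma occw_self b : 1 <= occw b (pword b) :> R.
Proof. by rewrite /occw pwordK ler1n Occ_self. Qed.

Lemma szw_self b : is_block b -> 1 <= szw (pword b) :> R.
Proof. by move=> [b0 _]; rewrite /szw size_pword ler1n. Qed.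

Lemma mean_gt0 i : (0 < i <= n)%N -> 0 < Acov q (f i) onew s t /\ 0 < Acov q onew (f i) s t.
Proof.
move=> il; have bi := bnP il.
by split; apply: (Acov_pos _ _ bi); rewrite ?occw_self ?lexx//; apply: pb_occw || apply: pb_onew.
Qed.

Lemma size_gt0 : 0 < Acov q szw onew s t /\ 0 < Acov q onew szw s t.
Proof.
have bi := @bnP 1 n0.
by split; apply: (Acov_pos _ _ bi); rewrite ?szw_self ?lexx//; apply: pb_szw || apply: pb_onew.
Qed.

Lemma Acov_szw g : poly_growth g -> Acov q szw g s t = fine (E3 s t q (fun l => (size l)%:R * g (ys l))) /\
  Acov q g szw s t = fine (E3 s t q (fun l => g (xs l) * (size l)%:R)).
Proof. by move=> pg; split; congr (fine (E3 s t q _)); apply/funext => l; rewrite /szw size_map. Qed.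

Lemma Acov_onew g : Acov q onew g s t = fine (E3 s t q (fun l => g (ys l))) /\
  Acov q g onew s t = fine (E3 s t q (fun l => g (xs l))).
Proof.
by split; congr (fine (E3 s t q _)); apply/funext => l; rewrite /onew ?mul1r ?mulr1.
Qed.

(** After the factor [kappa^-1] the right side is free of [q], while the mean size carries the
    factor [kappa]. In their product [kappa] cancels, which is [Hval_indep]. *)
Lemma bracket_wald : exists2 kappa : R, 0 < kappa &
  Acov q szw onew s t = kappa * fine (E2 s t (fun l => (size l)%:R)) /\
  bracket q s t = kappa^-1 *
    core n (fun j i => fine (E2 s t (fun l => occx (bn i) l * occy (bn j) l)) /
                       (fine (E2 s t (occx (bn i))) * fine (E2 s t (occy (bn j)))))
      (fun i => fine (E2 s t (fun l => occx (bn i) l * (size l)%:R)) /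
                (fine (E2 s t (occx (bn i))) * fine (E2 s t (fun l => (size l)%:R))) +
                fine (E2 s t (fun l => (size l)%:R * occy (bn i) l)) /
                (fine (E2 s t (fun l => (size l)%:R)) * fine (E2 s t (occy (bn i)))))
      (fine (E2 s t (fun l => (size l)%:R * (size l)%:R)) /
       (fine (E2 s t (fun l => (size l)%:R)) * fine (E2 s t (fun l => (size l)%:R)))).
Proof.
have [kappa [gam [k1 W]]] := wald s0' st tq q0 q1.
have k0 : 0 < kappa by apply: lt_le_trans k1.
have Eq F F' := @E3_good_eq R s t q F F'.
have pbs : poly_growth (fun l : seq (nat * nat) => (size l)%:R : R) by apply: pb_size.
have ads : block_additive (fun l : seq (nat * nat) => (size l)%:R : R) by apply: addf_size.
have fX i l : good l -> f i (xs l) = occx (bn i) (map fst l).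
  by move=> gl; rewrite /occx minw_good.
have fY i l : f i (ys l) = occy (bn i) (map fst l) by rewrite /occy -map_comp.
pose m := fine (E2 s t (fun l : seq (nat * nat) => (size l)%:R)).
have [m1 m2] : Acov q szw onew s t = kappa * m /\ Acov q onew szw s t = kappa * m.
  have [+ _] := Acov_szw pb_onew; have [_ +] := Acov_szw pb_onew => -> ->.
  have [<- _] := W _ ads pbs.
  by split; congr (fine (E3 s t q _)); apply/funext => l; rewrite /onew size_map ?mulr1 ?mul1r.
have [m0 _] := size_gt0.
have mne : m != 0 by move: m0; rewrite m1 pmulr_rgt0// => /gt_eqF ->.
exists kappa => //; split=> //.
have aX i : (0 < i <= n)%N -> Acov q (f i) onew s t = kappa * fine (E2 s t (occx (bn i))).
  move=> il; have [_ ->] := Acov_onew (f i).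
  have [<- _] := W _ (addf_occx (bnP il)) (pb_occx _).
  by congr fine; apply: Eq => l gl; rewrite fX.
have aY i : (0 < i <= n)%N -> Acov q onew (f i) s t = kappa * fine (E2 s t (occy (bn i))).
  move=> il; have [-> _] := Acov_onew (f i).
  have [<- _] := W _ (addf_occy (bnP il)) (pb_occy _).
  by congr fine; apply: Eq => l gl; rewrite fY.
have neX i : (0 < i <= n)%N -> fine (E2 s t (occx (R := R) (bn i))) != 0.
  by move=> il; have [+ _] := mean_gt0 il; rewrite aX// pmulr_rgt0// => /gt_eqF ->.
have neY i : (0 < i <= n)%N -> fine (E2 s t (occy (R := R) (bn i))) != 0.
  by move=> il; have [_ +] := mean_gt0 il; rewrite aY// pmulr_rgt0// => /gt_eqF ->.
have kne : kappa != 0 by rewrite gt_eqF.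
pose gs := gam (fun l => (size l)%:R) / (kappa ^+ 2 * m).
pose gx i := gam (occx (bn i)) / (kappa ^+ 2 * fine (E2 s t (occx (bn i)))).
pose gy i := gam (occy (bn i)) / (kappa ^+ 2 * fine (E2 s t (occy (bn i)))).
rewrite -coreZ -[RHS](core_shift n0 _ _ _ gs gx gy) /bracket m1 m2 -/m.
apply: core_ext => [i j il jl|i il|].
- rewrite aX// aY//.
  have -> : Acov q (f i) (f j) s t = fine (E3 s t q (fun l => occx (bn i) (map fst l) * occy (bn j) (map fst l))).
    by congr fine; apply: Eq => l gl; rewrite fX// fY.
  have [_ /(_ _ (addf_occy (bnP jl)) (pb_occy _)) ->] := W _ (addf_occx (bnP il)) (pb_occx _).
  rewrite /gx /gy; exact: (wald_ratio _ _ _ kne (neX i il) (neY j jl)).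
- rewrite aX// aY//.
  have -> : Acov q (f i) szw s t = fine (E3 s t q (fun l => occx (bn i) (map fst l) * (size (map fst l))%:R)).
    by congr fine; apply: Eq => l gl; rewrite fX// /szw !size_map.
  have -> : Acov q szw (f i) s t = fine (E3 s t q (fun l => (size (map fst l))%:R * occy (bn i) (map fst l))).
    by congr fine; apply: Eq => l gl; rewrite fY// /szw !size_map.
  have [_ /(_ _ ads pbs) ->] := W _ (addf_occx (bnP il)) (pb_occx _).
  have [_ /(_ _ (addf_occy (bnP il)) (pb_occy _)) ->] := W _ ads pbs.
  rewrite -/m.
  rewrite (wald_ratio _ _ _ kne (neX i il) mne) (wald_ratio _ _ _ kne mne (neY i il)) -/(gx i) -/(gy i) -/gs.
  rewrite [in RHS]mulrDr; move: (kappa^-1 * _) (kappa^-1 * _) (gx i) (gy i) gs; clear => A B a b c; ring.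
have -> : Acov q szw szw s t = fine (E3 s t q (fun l => (size (map fst l))%:R * (size (map fst l))%:R)).
  by congr (fine (E3 s t q _)); apply/funext => l; rewrite /szw !size_map.
have [_ /(_ _ ads pbs) ->] := W _ ads pbs.
by rewrite -/m (wald_ratio _ _ _ kne mne mne) -/gs; move: gs; clear; move=> c; ring.
Qed.

End moments.

Lemma Hval_indep q q' e s t : 0 < s -> s <= t -> t <= q -> q < 1 -> t <= q' -> q' < 1 ->
  Hval q e s t = Hval q' e s t.
Proof.
move=> s0 st tq q1 tq' q1'.
have [k k0 [m b]] := bracket_wald s0 st tq q1.
have [k' k'0 [m' b']] := bracket_wald s0 st tq' q1'.
by rewrite /Hval m m' b b'; field; rewrite !gt_eqF.
Qed.

End Hval.

Section H_formula_val.
#[local] Opaque E3.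
Context {R : realType}.
Variable p : finperm.
Let bs := blocks p.
Let bn (i : nat) : finperm := nth (mkperm (1%g : 'S_0)) bs (i - 1).
Let n := size bs.
Hypothesis bsP : forall b, b \in bs -> is_block b.
Hypothesis n0 : (0 < n)%N.
Variables (e : R -> R) (s t q : R).
Hypotheses (s0 : 0 < s) (st : s <= t) (tq : t <= q) (q1 : q < 1).
Let s0' := ltW s0.
Let q0 : 0 < q. Proof. by apply: lt_le_trans s0 _; apply: le_trans tq. Qed.

Let pbX g : poly_growth g -> poly_growth (fun l : seq (nat * nat * nat) => g (xs l) : R).
Proof. exact: (@pb_lift R _ _ (fun a : nat * nat * nat => a.1.1) g). Qed.
Let pbY g : poly_growth g -> poly_growth (fun l : seq (nat * nat * nat) => g (ys l) : R).
Proof. exact: (@pb_lift R _ _ (fun a : nat * nat * nat => a.1.2) g). Qed.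

(** Normalized variables have mean 1, so covariances are second moments minus 1, 2 and 1 in the
    three parts of the bracket. These constants have the shape absorbed by [core_shift] with all
    shifts equal to -1/2. *)
Let h1 (x : R) : x - 1 = x + - 2^-1 + - 2^-1. Proof. lra. Qed.
Let h2 (x : R) : x - 2 = x + (2 * - 2^-1 + - 2^-1 + - 2^-1). Proof. lra. Qed.
Let h3 (x : R) : x - 1 = x + 2 * - 2^-1. Proof. lra. Qed.

Lemma H_formula_Hval d (T : measurableType d) (P : probability T R) (B : T -> finperm)
    (Z : nat -> R -> T -> nat) : q_block_process q P B Z ->
  H_formula p e P B Z s t = Hval bs q e s t.
Proof.
move=> QB.
have t0 : 0 < t by apply: lt_le_trans st.
have pbs : poly_growth (fun l : seq (nat * nat * nat) => (size l)%:R : R) by apply: pb_size.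
have [oY oX] : (forall g, Acov q onew g s t = fine (E3 s t q (fun l => g (ys l)))) /\
    (forall g, Acov q g onew s t = fine (E3 s t q (fun l => g (xs l)))).
  by split=> g; have [] := Acov_onew s t q g.
pose f i : seq nat -> R := occw (bn i).
have pf i : poly_growth (f i) by apply: pb_occw.
pose W := block_word B Z s t.
have EX := block_word_expectation q0 q1 QB s0' st tq.
have cov := block_word_cov q0 q1 QB s0' st tq.
have EZ := E3Z q0 q1 s0' st tq.
have ED := E3D q0 q1 s0' st tq.
pose m := Acov q szw onew s t.
have mE : fine (E3 s t q (fun l => (size l)%:R)) = m.
  by rewrite /m oX; congr (fine (E3 s t q _)); apply/funext => l; rewrite /szw size_map.
have mE' : Acov q onew szw s t = m.
  by rewrite oY -mE; congr (fine (E3 s t q _)); apply/funext => l; rewrite /szw size_map.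
have EB : fine 'E_P[fun w => (psize (B w))%:R] = m.
  rewrite -mE -EX//; congr (fine 'E_P[_]); apply/funext => w.
  by rewrite size_block_word.
pose a i := Acov q (f i) onew s t; pose c i := Acov q onew (f i) s t.
have occs i : normalized_Occ P (block_at B Z) (bn i) s = fun w => (a i)^-1 * f i (xs (W w)).
  apply/funext => w; rewrite /normalized_Occ (gt_eqF s0) /= mulrC (block_at_xs B Z s t).
  congr (_^-1 * _); rewrite /a oX -EX => [|l]; last by case: (pf i).
  by congr (fine 'E_P[_]); apply/funext => w'; rewrite (block_at_xs B Z s t).
have occt i : normalized_Occ P (block_at B Z) (bn i) t = fun w => (c i)^-1 * f i (ys (W w)).
  apply/funext => w; rewrite /normalized_Occ (gt_eqF t0) /= mulrC (block_at_ys B Z s t).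
  congr (_^-1 * _); rewrite /c oY -EX => [|l]; last by case: (pf i).
  by congr (fine 'E_P[_]); apply/funext => w'; rewrite (block_at_ys B Z s t).
have a0 i : (0 < i <= n)%N -> 0 < a i.
  by move=> il; have [] := mean_gt0 bsP s0 st tq q1 il.
have c0 i : (0 < i <= n)%N -> 0 < c i.
  by move=> il; have [] := mean_gt0 bsP s0 st tq q1 il.
have m0 : 0 < m by have [] := size_gt0 bsP n0 s0 st tq q1.
have pX i : (0 < i <= n)%N -> poly_growth (fun l => (a i)^-1 * f i (xs l)).
  by move=> il; apply: pbZ; [rewrite invr_ge0 ltW ?a0|exact: pbX].
have pY i : (0 < i <= n)%N -> poly_growth (fun l => (c i)^-1 * f i (ys l)).
  by move=> il; apply: pbZ; [rewrite invr_ge0 ltW ?c0|exact: pbY].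
have pS : poly_growth (fun l : seq (nat * nat * nat) => m^-1 * (size l)%:R).
  by apply: pbZ => //; rewrite invr_ge0 ltW.
have eX i : (0 < i <= n)%N -> fine (E3 s t q (fun l => (a i)^-1 * f i (xs l))) = 1.
  move=> il; rewrite EZ ?invr_ge0 ?(ltW (a0 i il))//; last exact: pbX.
  by rewrite -oX -/(a i) mulVf// gt_eqF// a0.
have eY i : (0 < i <= n)%N -> fine (E3 s t q (fun l => (c i)^-1 * f i (ys l))) = 1.
  move=> il; rewrite EZ ?invr_ge0 ?(ltW (c0 i il))//; last exact: pbY.
  by rewrite -oY -/(c i) mulVf// gt_eqF// c0.
have eS : fine (E3 s t q (fun l => m^-1 * (size l)%:R)) = 1.
  by rewrite EZ ?invr_ge0 ?(ltW m0)// mE mulVf// gt_eqF.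
have sizeE : (fun w => (psize (B w))%:R / m) = (fun w => m^-1 * (size (W w))%:R).
  by apply/funext => w; rewrite size_block_word mulrC.
have EXY (g h : seq nat -> R) (k k' : R) : poly_growth g -> poly_growth h -> 0 < k -> 0 < k' ->
    fine (E3 s t q (fun l => (k^-1 * g (xs l)) * (k'^-1 * h (ys l)))) = Acov q g h s t / (k * k').
  move=> pg ph k0 k'0.
  transitivity (fine (E3 s t q (fun l => (k^-1 * k'^-1) * (g (xs l) * h (ys l))))).
    by congr (fine (E3 s t q _)); apply/funext => l; ring.
  rewrite EZ; [by rewrite -invfM mulrC| |by apply: pbM; [exact: pbX|exact: pbY]].
  by rewrite mulr_ge0// invr_ge0 ltW.
rewrite /H_formula /Hval /bracket EB -/m mE' -/n.
congr (_ * _).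
transitivity (core n (fun j i => Acov q (f i) (f j) s t / (a i * c j) - 1)
  (fun i => Acov q (f i) szw s t / (a i * m) + Acov q szw (f i) s t / (m * c i) - 2)
  (Acov q szw szw s t / (m * m) - 1)); last first.
  rewrite -[RHS](core_shift n0 _ _ _ (- 2^-1) (fun=> - 2^-1) (fun=> - 2^-1)).
  by apply: core_ext => [i j _ _|i _|]; [exact: h1|exact: h2|exact: h3].
rewrite /core; congr (_ * _ - _ * _ + _ * _).
- apply: eq_big_nat => i il; apply: eq_big_nat => j jl; congr (_ * _).
  rewrite -/(bn i) -/(bn j) occs occt covarianceC (cov _ _ (pX i il) (pY j jl)).
  rewrite (eX i il).
  rewrite (eY j jl).
  rewrite mulr1.
  by rewrite (EXY (f i) (f j) (a i) (c j) (pf i) (pf j) (a0 i il) (c0 j jl)).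
- apply: eq_big_nat => i il; rewrite -/(bn i) occs occt sizeE.
  rewrite (cov _ (fun l => (a i)^-1 * f i (xs l) + (c i)^-1 * f i (ys l)) pS); last first.
    by apply: pbD; [exact: pX|exact: pY].
  rewrite (ED _ _ (pX i il) (pY i il)) (eX i il) (eY i il) eS mul1r; congr (_ - _).
  transitivity (fine (E3 s t q (fun l => ((a i)^-1 * f i (xs l)) * (m^-1 * szw (ys l)) +
     (m^-1 * szw (xs l)) * ((c i)^-1 * f i (ys l))))).
    by congr (fine (E3 s t q _)); apply/funext => l; rewrite /szw !size_map; ring.
  have pSX : poly_growth (fun l : seq (nat * nat * nat) => m^-1 * szw (xs l)).
    by apply: pbZ; [rewrite invr_ge0 ltW|exact: (pbX pb_szw)].
  have pSY : poly_growth (fun l : seq (nat * nat * nat) => m^-1 * szw (ys l)).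
    by apply: pbZ; [rewrite invr_ge0 ltW|exact: (pbY pb_szw)].
  rewrite (ED _ _ (pbM (pX i il) pSY) (pbM pSX (pY i il))).
  by rewrite (EXY (f i) szw (a i) m (pf i) pb_szw (a0 i il) m0) (EXY szw (f i) m (c i) pb_szw (pf i) m0 (c0 i il)).
rewrite sizeE /variance (cov _ _ pS pS) eS mulr1; congr (_ - _).
transitivity (fine (E3 s t q (fun l => (m^-1 * szw (xs l)) * (m^-1 * szw (ys l))))).
  by congr (fine (E3 s t q _)); apply/funext => l; rewrite /szw !size_map.
exact: (EXY szw szw m m pb_szw pb_szw m0 m0).
Qed.

End H_formula_val.

(** * Lipschitz estimates *)

Section e_formula.
Context {R : realType}.

Lemma E2_snd (t q : R) (g : seq nat -> R) : 0 <= t -> t <= q -> q < 1 -> (forall l, 0 <= g l) ->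
  E2 t t (fun l => g (map snd l)) =
  (\esum_(l in setT) (wt (om1 t) l * ((hit 0 l)%:R * g l))%:E)%E.
Proof.
move=> t0 tq q1 g0.
have t1 : t < 1 by apply: le_lt_trans tq q1.
rewrite /E2 -(@esum_marg R _ _ snd (om2 t t) (om1 t) _ _ _ (fun l => (hit 0 l)%:R * g l)) //.
- by move=> a; apply: (om2_ge0 t0 (lexx t) tq q1).
- by move=> z; apply: om1_ge0; rewrite t0 ltW.
- by move=> b; apply: (om2_marg_y t0 (lexx t) tq q1).
- by move=> l; rewrite mulr_ge0.
Qed.

(** The factor [kappa] cancels in each quotient, so [e] can be computed under one fixed [q], where
    the thinning estimate applies. *)
Lemma e_Acov (p : finperm) (q t x : R) : 0 <= t -> t <= q -> 0 < q -> q < 1 -> 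
  (forall b, b \in blocks p -> is_block b) -> is_e p t x ->
  x = \prod_(b <- blocks p) (Acov q onew (occw b) t t / Acov q onew szw t t).
Proof.
move=> t0 tq q0 q1 bsP [d [T [P [B [mB ->]]]]].
have [kappa [gam [k1 W]]] := wald t0 (lexx t) tq q0 q1.
have k0 : kappa != 0 by rewrite gt_eqF// (lt_le_trans _ k1).
have t01 : 0 <= t <= 1 by rewrite t0 (le_trans tq)// ltW.
have key (g : seq nat -> R) : poly_growth g -> block_additive (fun l : seq (nat * nat) => g (map snd l)) ->
    Acov q onew g t t = kappa * fine 'E_P[fun w => g (pword (B w))].
  move=> pg ag; have [g0 _] := pg.
  have [-> _] := Acov_onew t t q g.
  rewrite unlock (mblock_integral t01 mB g0) -(E2_snd t0 tq q1 g0).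
  have [<- _] := W _ ag (@pb_lift R _ _ (fun a : nat * nat => a.2) _ pg).
  by congr (fine (E3 t t q _)); apply/funext => l; rewrite /ys -map_comp.
rewrite (key szw pb_szw); last first.
  by move=> l l' cl cl'; rewrite /szw !size_map size_cat natrD.
rewrite !big_seq; apply: eq_bigr => b bb.
rewrite (key _ (pb_occw b) (addf_occy (bsP b bb))).
have -> : (fun w => occw b (pword (B w))) = (fun w => (Occ b (B w))%:R : R).
  by apply/funext => w; rewrite /occw pwordK.
have -> : (fun w => szw (pword (B w))) = (fun w => (psize (B w))%:R : R).
  by apply/funext => w; rewrite /szw size_pword.
by rewrite invfM mulrACA mulfV// mul1r.
Qed.

End e_formula.

(** * Stability of the Lipschitz class *)

Section tame.
Context {R : realType}.
Variables a b : R.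

(* On this class the increments of F(s, t) from either end of the diagonal are O(t - s). *)
Definition tame (F : R -> R -> R) : Prop :=
  exists2 C : R, 0 <= C & forall s t, a <= s -> s <= t -> t <= b ->
    [/\ `|F s t| <= C, `|F s s| <= C, `|F t t| <= C, `|F s t - F s s| <= C * (t - s) &
        `|F s t - F t t| <= C * (t - s)].

Lemma tame_cst c : tame (fun _ _ => c).
Proof.
exists `|c| => // s t _ st _; rewrite subrr normr0 lexx.
by split=> //; rewrite mulr_ge0// subr_ge0.
Qed.

Lemma tameD F G : tame F -> tame G -> tame (fun s t => F s t + G s t).
Proof.
move=> [C C0 HF] [D D0 HG]; exists (C + D) => [|s t as_ st tb]; first exact: addr_ge0.
have [f1 f2 f3 f4 f5] := HF s t as_ st tb; have [g1 g2 g3 g4 g5] := HG s t as_ st tb.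
split; try by apply: le_trans (ler_normD _ _) _; apply: lerD.
  rewrite opprD addrACA mulrDl; apply: le_trans (ler_normD _ _) _; exact: lerD.
rewrite opprD addrACA mulrDl; apply: le_trans (ler_normD _ _) _; exact: lerD.
Qed.

Lemma tameM F G : tame F -> tame G -> tame (fun s t => F s t * G s t).
Proof.
move=> [C C0 HF] [D D0 HG]; exists (C * D * 2) => [|s t as_ st tb]; first by rewrite !mulr_ge0.
have [f1 f2 f3 f4 f5] := HF s t as_ st tb; have [g1 g2 g3 g4 g5] := HG s t as_ st tb.
have CD : C * D <= C * D * 2 by rewrite ler_peMr ?mulr_ge0// ler1n.
have ts : 0 <= t - s by rewrite subr_ge0.
have bd x y : `|x| <= C -> `|y| <= D -> `|x * y| <= C * D * 2.
  by move=> xC yD; rewrite normrM (le_trans _ CD)// ler_pM.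
have df x y x' y' : `|x| <= C -> `|y'| <= D -> `|x - x'| <= C * (t - s) -> `|y - y'| <= D * (t - s) ->
    `|x * y - x' * y'| <= C * D * 2 * (t - s).
  move=> xC yD xx yy.
  have -> : x * y - x' * y' = x * (y - y') + (x - x') * y' by ring.
  have -> : C * D * 2 * (t - s) = C * (D * (t - s)) + C * (t - s) * D by ring.
  by apply: le_trans (ler_normD _ _) _; rewrite !normrM; apply: lerD; apply: ler_pM.
by split; [exact: bd|exact: bd|exact: bd|exact: df|exact: df].
Qed.

Lemma tameV F c : 0 < c -> (forall s t, a <= s -> s <= t -> t <= b -> c <= F s t) ->
  tame F -> tame (fun s t => (F s t)^-1).
Proof.
move=> c0 Fc [C C0 HF]; exists (c^-1 + C / c ^+ 2) => [|s t as_ st tb].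
  by rewrite addr_ge0 ?invr_ge0 ?divr_ge0 ?exprn_ge0 ?(ltW c0).
have [f1 f2 f3 f4 f5] := HF s t as_ st tb.
have c1 := Fc s t as_ st tb.
have c2 := Fc s s as_ (lexx s) (le_trans st tb).
have c3 := Fc t t (le_trans as_ st) (lexx t) tb.
have ts : 0 <= t - s by rewrite subr_ge0.
have p1 : 0 <= C / c ^+ 2 by rewrite divr_ge0 ?exprn_ge0 ?(ltW c0).
have p2 : 0 <= c^-1 by rewrite invr_ge0 ltW.
have bd x : c <= x -> `|x^-1| <= c^-1 + C / c ^+ 2.
  move=> cx; have x0 : 0 < x by apply: lt_le_trans cx.
  by rewrite gtr0_norm ?invr_gt0// (@le_trans _ _ c^-1) ?lerDl// lef_pV2.
have df x y : c <= x -> c <= y -> `|x - y| <= C * (t - s) ->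
    `|x^-1 - y^-1| <= (c^-1 + C / c ^+ 2) * (t - s).
  move=> cx cy xy; have x0 : 0 < x by apply: lt_le_trans cx.
  have y0 : 0 < y by apply: lt_le_trans cy.
  have -> : x^-1 - y^-1 = (y - x) / (x * y) by field; rewrite !gt_eqF.
  rewrite normrM distrC (@ger0_norm _ (x * y)^-1) ?invr_ge0 ?mulr_ge0 ?(ltW x0) ?(ltW y0)//.
  apply: (@le_trans _ _ (C * (t - s) * (c ^+ 2)^-1)).
    apply: ler_pM => //; first by rewrite invr_ge0 mulr_ge0 ?(ltW x0) ?(ltW y0).
    by rewrite lef_pV2 ?posrE ?exprn_gt0 ?mulr_gt0// expr2 ler_pM// ltW.
  by rewrite mulrAC ler_wpM2r// lerDr.
by split; [exact: bd|exact: bd|exact: bd|exact: df|exact: df].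
Qed.

Lemma tame_ext F G : (forall s t, a <= s -> s <= t -> t <= b -> F s t = G s t) -> tame F -> tame G.
Proof.
move=> FG [C C0 HF]; exists C => // s t as_ st tb.
have := HF s t as_ st tb.
by rewrite !FG ?(le_trans as_ st) ?(le_trans st tb).
Qed.

Lemma tame_sum (r : seq nat) (F : nat -> R -> R -> R) : (forall i, i \in r -> tame (F i)) ->
  tame (fun s t => \sum_(i <- r) F i s t).
Proof.
elim: r => [|i r IH] tF.
  by apply: tame_ext (tame_cst 0) => s t _ _ _; rewrite big_nil.
have := tameD (tF i (mem_head _ _)) (IH (fun j jr => tF j (mem_behead (s := i :: r) jr))).
by apply: tame_ext => s t _ _ _; rewrite big_cons.
Qed.

Lemma tame_prod (A : eqType) (r : seq A) (F : A -> R -> R -> R) :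
  (forall i, i \in r -> tame (F i)) -> tame (fun s t => \prod_(i <- r) F i s t).
Proof.
elim: r => [|i r IH] tF.
  by apply: tame_ext (tame_cst 1) => s t _ _ _; rewrite big_nil.
have := tameM (tF i (mem_head _ _)) (IH (fun j jr => tF j (mem_behead (s := i :: r) jr))).
by apply: tame_ext => s t _ _ _; rewrite big_cons.
Qed.

(** Two diagonal values are compared through the off-diagonal value [F s t]. *)
Lemma tame_diag F : tame F -> tame (fun s _ => F s s) /\ tame (fun _ t => F t t).
Proof.
move=> [C C0 HF]; split; (exists (C * 2) => [|s t as_ st tb]; first by rewrite mulr_ge0).
  have [f1 f2 f3 f4 f5] := HF s t as_ st tb.
  have CC : C <= C * 2 by rewrite ler_peMr// ler1n.
  split; [exact: le_trans CC|exact: le_trans CC|exact: le_trans CC| |].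
    by rewrite subrr normr0 !mulr_ge0// subr_ge0.
  have -> : F s s - F t t = (F s t - F t t) - (F s t - F s s) by ring.
  by apply: le_trans (ler_normB _ _) _; rewrite (mulrC C) -mulrA mulr2n mulrDl mul1r; exact: lerD.
have [f1 f2 f3 f4 f5] := HF s t as_ st tb.
have CC : C <= C * 2 by rewrite ler_peMr// ler1n.
split; [exact: le_trans CC|exact: le_trans CC|exact: le_trans CC| |].
  have -> : F t t - F s s = (F s t - F s s) - (F s t - F t t) by ring.
  by apply: le_trans (ler_normB _ _) _; rewrite (mulrC C) -mulrA mulr2n mulrDl mul1r; exact: lerD.
by rewrite subrr normr0 !mulr_ge0// subr_ge0.
Qed.

Lemma tame_Acov q g h : 0 <= a -> b <= q -> 0 < q < 1 -> poly_growth g -> poly_growth h -> tame (Acov q g h).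
Proof.
move=> a0 bq q01 pg ph; have [C C0 HC] := Acov_lipschitz q01 pg ph.
exists C => // s t as_ st tb.
have s0 : 0 <= s by apply: le_trans as_.
have t0 : 0 <= t by apply: le_trans st.
have tq : t <= q by apply: le_trans bq.
have [/andP[l1 u1] h1 h2] := HC s t (introT andP (conj s0 st)) tq.
have [/andP[l2 u2] _ _] := HC s s (introT andP (conj s0 (lexx s))) (le_trans st tq).
have [/andP[l3 u3] _ _] := HC t t (introT andP (conj t0 (lexx t))) tq.
by split=> //; rewrite ger0_norm.
Qed.

End tame.

Section regularity.
Context {R : realType}.
Variables (p : finperm) (e : R -> R) (H : R -> R -> R).
Hypotheses (bsP : forall b, b \in blocks p -> is_block b) (n0 : (0 < size (blocks p))%N).
Hypothesis eP : forall t, 0 <= t < 1 -> is_e p t (e t).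
Hypothesis HP : forall s t, 0 <= s < 1 -> 0 <= t < 1 -> is_H p e s t (H s t).

(** A block is non-empty and the total mass is 1. Unlike [Acov_lower] this holds down to time 0, so
    that [e] is controlled on [0, b]. *)
Lemma Acov_size_ge1 q s t : 0 <= s -> s <= t -> t <= q -> 0 < q -> q < 1 ->
  (1 : R) <= Acov q onew szw s t.
Proof.
move=> s0 st tq q0 q1; have [-> _] := Acov_onew s t q szw.
have fin := @E3_fin R s t q s0 st tq q0 q1 _ (@pb_size R (nat * nat * nat)%type).
have -> : E3 s t q (fun l => szw (ys l)) = E3 s t q (fun l => (size l)%:R).
  by congr (E3 s t q _); apply/funext => l; rewrite /szw size_map.
rewrite -lee_fin fineK// -(hit_sum1 (q := q) _ 0%N) ?q0 ?q1//.
rewrite -(E3_zs s0 st tq q0 q1 (F := fun z => (hit 0 z)%:R))//.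
apply: le_esum => l _; rewrite lee_fin.
apply: ler_wpM2l; first by apply: wt_ge0 => a; apply: om3_ge0.
case: (boolP (hit 0 (zs l))) => [/hit_nnil|_]; last by rewrite mul0r.
by case: l => // a l _; rewrite mul1r ler1n.
Qed.

Lemma tame_size q b : 0 < q < 1 -> b <= q -> tame 0 b (fun s t => (Acov q onew szw s t)^-1 : R).
Proof.
move=> q01 bq; have /andP[q0 q1] := q01.
apply: (@tameV _ _ _ _ 1) => [//|s t s0 st tb|].
  by apply: Acov_size_ge1 => //; apply: le_trans bq.
by apply: tame_Acov => //; [exact: pb_onew|exact: pb_szw].
Qed.

Lemma tame_e b : 0 < b < 1 -> tame 0 b (fun s _ => e s) /\ tame 0 b (fun _ t => e t).
Proof.
move=> b01; have /andP[b0 b1] := b01.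
pose F s t : R := \prod_(c <- blocks p) (Acov b onew (occw c) s t * (Acov b onew szw s t)^-1).
have tF : tame 0 b F.
  apply: tame_prod => c cb; apply: tameM; last exact: tame_size.
  by apply: tame_Acov => //; [exact: pb_onew|exact: pb_occw].
have FE t : 0 <= t -> t <= b -> F t t = e t.
  move=> t0 tb; apply/esym; apply: e_Acov => //; apply: eP.
  by rewrite t0 (le_lt_trans tb).
have [t1 t2] := tame_diag tF; split.
  by apply: tame_ext t1 => s t s0 st tb; apply: FE => //; apply: le_trans tb.
by apply: tame_ext t2 => s t s0 st tb; apply: FE => //; apply: le_trans st.
Qed.

Lemma tame_sub (a b a' b' : R) F : a <= a' -> b' <= b -> tame a b F -> tame a' b' F.
Proof.
move=> aa bb [C C0 HC]; exists C => // s t as_ st tb.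
by apply: HC => //; [exact: le_trans as_|exact: le_trans bb].
Qed.

Lemma e_hoelder gamma : 0 < gamma < 1 -> locally_hoelder gamma `[0, 1[ e.
Proof.
move=> /andP[g0 g1] x /=; rewrite in_itv/= => /andP[x0 x1].
pose b := (x + 1) / 2.
have b01 : 0 < b < 1 by rewrite /b; apply/andP; split; lra.
have [[C C0 HC] _] := tame_e b01.
exists (b - x); first by rewrite /b; lra.
exists C.
have main s t : 0 <= s -> s <= t -> t <= b -> `|e s - e t| <= C * `|s - t| `^ gamma.
  move=> s0 st tb; have [_ _ _ _ h] := HC s t s0 st tb.
  apply: le_trans h _; rewrite distrC ger0_norm ?subr_ge0// ler_wpM2l//.
  have [->|ts] := eqVneq t s; first by rewrite subrr powR_ge0.
  have ts0 : 0 < t - s by rewrite subr_gt0 lt_neqAle eq_sym ts.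
  (* As t - s <= 1, lowering the exponent from 1 to [gamma] increases the power. *)
  rewrite -{1}(powRr1 (ltW ts0)); apply: ger_powR; last exact: ltW.
  by rewrite ts0 /=; move: tb s0 b01 => /[swap] ? /[swap] /andP[_]; lra.
move=> s t; rewrite !in_itv/= => /andP[s0 s1] /andP[t0 t1].
rewrite !ltr_norml => /andP[_ sx] /andP[_ tx].
have [st|ts] := leP s t; first by apply: main => //; lra.
by rewrite distrC (distrC s); apply: main => //; [exact: ltW|lra].
Qed.

(** The parameter [q] provided by [HP] varies with (s, t); [Hval_indep] replaces it by the common
    value [b]. The denominators are bounded below on [a, b] by [lb], which needs a > 0. *)
Lemma tame_H a b : 0 < a -> a <= b -> b < 1 -> tame a b H.
Proof.
move=> a0 ab b1.
have b01 : 0 < b < 1 by rewrite b1 (lt_le_trans a0).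
have b0 : 0 < b by case/andP: b01.
set bs := blocks p.
apply: (@tame_ext _ _ _ (Hval bs b e)).
  move=> s t as_ st tb.
  have s0 : 0 < s by apply: lt_le_trans as_.
  have t0 : 0 < t by apply: lt_le_trans st.
  have s01 : 0 <= s < 1 by rewrite (ltW s0) (le_lt_trans _ b1)// (le_trans st).
  have t01 : 0 <= t < 1 by rewrite (ltW t0) (le_lt_trans _ b1).
  have [q [d [T [P [B [Z [/andP[q0 q1] mq QB ->]]]]]]] := HP s01 t01.
  have tq : t <= q by apply: le_trans mq; rewrite le_max lexx orbT.
  rewrite (H_formula_Hval bsP n0 e s0 st tq q1 QB).
  by apply: (Hval_indep bsP n0).
have tA g h : poly_growth g -> poly_growth h -> tame a b (Acov b g h) by apply: tame_Acov => //; exact: ltW.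
have [te1 te2] := tame_e b01.
have bP i : (0 < i < (size bs).+1)%N -> is_block (nth (mkperm (1%g : 'S_0)) bs (i - 1)).
  by case: i => // i il; apply: bsP; apply: mem_nth; rewrite subn1.
pose lb c : R := \prod_(z <- pword c) ((1 - b) ^+ z.+1 * phi a ^+ z).
have lb0 c : 0 < lb c.
  apply: prodr_gt0 => z _; rewrite mulr_gt0 ?exprn_gt0 ?subr_gt0// divr_gt0// subr_gt0.
  exact: le_lt_trans b1.
have tVg g h c : poly_growth g -> poly_growth h -> is_block c -> 1 <= g (pword c) -> 1 <= h (pword c) ->
    tame a b (fun s t => (Acov b g h s t)^-1).
  move=> pg ph bc g1 h1; apply: (tameV (lb0 c)) => [s t as_ st tb|]; last exact: tA.
  have s0 : 0 <= s by apply: le_trans as_; exact: ltW.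
  apply: le_trans (Acov_lower s0 st tb b0 b1 pg ph bc g1 h1).
  have pa : 0 <= phi a by apply: phi_ge0; rewrite ltW//= (le_lt_trans ab).
  apply: ler_prod => z _; apply/andP; split.
    by rewrite mulr_ge0 ?exprn_ge0 ?subr_ge0 ?(ltW b1).
  rewrite ler_wpM2l ?exprn_ge0 ?subr_ge0 ?(ltW b1)//.
  by apply: lerXn2r; rewrite ?nnegrE ?phi_le//; [rewrite (le_trans pa)// phi_le//|];
     apply: le_lt_trans b1; apply: le_trans tb.
have tX c : is_block c -> tame a b (fun s t => (Acov b (occw c) onew s t)^-1).
  by move=> bc; apply: (tVg _ _ c) => //; [exact: pb_occw|exact: pb_onew|exact: occw_self].
have tY c : is_block c -> tame a b (fun s t => (Acov b onew (occw c) s t)^-1).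
  by move=> bc; apply: (tVg _ _ c) => //; [exact: pb_onew|exact: pb_occw|exact: occw_self].
have bc := bP 1%N n0.
have tS : tame a b (fun s t => (Acov b onew szw s t)^-1).
  by apply: (tVg _ _ _ _ _ bc) => //; [exact: pb_onew|exact: pb_szw|exact: szw_self].
have tS' : tame a b (fun s t => (Acov b szw onew s t)^-1).
  by apply: (tVg _ _ _ _ _ bc) => //; [exact: pb_szw|exact: pb_onew|exact: szw_self].
have tI g h (F G : R -> R -> R) : poly_growth g -> poly_growth h -> tame a b (fun s t => (F s t)^-1) ->
    tame a b (fun s t => (G s t)^-1) -> tame a b (fun s t => Acov b g h s t / (F s t * G s t)).
  move=> pg ph tF tG; apply: (tame_ext _ (tameM (tA g h pg ph) (tameM tF tG))) => s t _ _ _.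
  by rewrite invfM.
have ps := @pb_szw R; have po := @pb_occw R; have p1 := @pb_onew R.
apply: tameM; first apply: tameM; first apply: tameM.
- exact: tA.
- by apply: tame_sub te1 => //; exact: ltW.
- by apply: tame_sub te2 => //; exact: ltW.
apply: tameD; first apply: tameD.
- apply: tameM; first exact: tame_cst.
  apply: tame_sum => i; rewrite mem_index_iota => il; apply: tame_sum => j; rewrite mem_index_iota => jl.
  apply: tameM; first exact: tame_cst.
  by apply: tI => //; [apply: tX|apply: tY]; apply: bP.
- suff tt : tame a b (fun s t => - ((((size bs - 1)`! * (size bs)`!)%:R : R)^-1) * \sum_(1 <= i < (size bs).+1)
     (Acov b (occw (nth (mkperm (1%g : 'S_0)) bs (i - 1))) szw s t /
      (Acov b (occw (nth (mkperm (1%g : 'S_0)) bs (i - 1))) onew s t * Acov b onew szw s t) +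
      Acov b szw (occw (nth (mkperm (1%g : 'S_0)) bs (i - 1))) s t /
      (Acov b szw onew s t * Acov b onew (occw (nth (mkperm (1%g : 'S_0)) bs (i - 1))) s t))).
    by apply: tame_ext tt => s t _ _ _; rewrite mulNr.
  apply: tameM; first exact: tame_cst.
  apply: tame_sum => i; rewrite mem_index_iota => il.
  by apply: tameD; apply: tI => //; [apply: tX; apply: bP|apply: tY; apply: bP].
- by apply: tameM; [exact: tame_cst|apply: tI].
Qed.

Lemma increment_bound a b : 0 < a -> a <= b -> b < 1 -> exists2 C : R, 0 <= C &
  forall s t, a <= s -> s <= t -> t <= b -> H s s - 2 * H s t + H t t <= C * (t - s).
Proof.
move=> a0 ab b1; have [C C0 HC] := tame_H a0 ab b1.
exists (2 * C) => [|s t as_ st tb]; first by rewrite mulr_ge0.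
have [_ _ _ h1 h2] := HC s t as_ st tb.
move: h1 h2; rewrite !ler_norml => /andP[h1 _] /andP[h2 _]; lra.
Qed.

End regularity.

(** * Chaining *)

Section chaining_path.
Context {R : realType}.

Definition dyad (n : nat) (t : R) : R := (Num.truncn (2 ^+ n * t))%:R / 2 ^+ n.

(* The threshold n 2^(-n/2), summable against every Hoelder rate below 1/2. *)
Definition delta (n : nat) : R := n.+1%:R / Num.sqrt 2 ^+ n.

Let p2 n : 0 < 2 ^+ n :> R. Proof. by rewrite exprn_gt0. Qed.

Lemma dyad_itv n t : 0 <= t -> dyad n t <= t < dyad n t + (2 ^+ n)^-1.
Proof.
move=> t0; have /truncn_itv/andP[h1 h2] : 0 <= 2 ^+ n * t by rewrite mulr_ge0// ltW.
apply/andP; split; first by rewrite /dyad ler_pdivrMr// [t * _]mulrC.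
by rewrite /dyad -[X in _ + X]div1r -mulrDl ltr_pdivlMr// [t * _]mulrC natr1.
Qed.

Lemma dyad_step n t : 0 <= t -> exists k : nat,
  dyad n t = k%:R / 2 ^+ n.+1 /\
  (dyad n.+1 t = dyad n t \/ dyad n.+1 t = k.+1%:R / 2 ^+ n.+1).
Proof.
move=> t0; set k := Num.truncn (2 ^+ n * t).
have /truncn_itv/andP[h1 h2] : 0 <= 2 ^+ n * t by rewrite mulr_ge0// ltW.
have E : k%:R / 2 ^+ n = (2 * k)%:R / 2 ^+ n.+1 :> R.
  by rewrite exprS natrM invfM mulrACA mulfV ?mul1r.
exists (2 * k)%N; split=> //.
have t0' : 0 <= 2 ^+ n.+1 * t by rewrite mulr_ge0// ltW.
have : Num.truncn (2 ^+ n.+1 * t) = (2 * k)%N \/ Num.truncn (2 ^+ n.+1 * t) = (2 * k).+1.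
  have k1 : (2 * k <= Num.truncn (2 ^+ n.+1 * t))%N.
    by rewrite truncn_ge_nat// natrM exprS -mulrA ler_wpM2l.
  have k2 : (Num.truncn (2 ^+ n.+1 * t) < 2 * k.+1)%N.
    rewrite ltnNge truncn_ge_nat// -ltNge natrM exprS -mulrA ltr_pM2l//.
  move: k1 k2; clear; lia.
rewrite /dyad -/k E => -[->|->]; by [left|right].
Qed.

Lemma dyad_near n s t : 0 <= s -> s <= t -> t - s <= (2 ^+ n)^-1 ->
  exists k : nat, dyad n s = k%:R / 2 ^+ n /\ (dyad n t = dyad n s \/ dyad n t = k.+1%:R / 2 ^+ n).
Proof.
move=> s0 st ts; have t0 : 0 <= t by apply: le_trans st.
have s0' : 0 <= 2 ^+ n * s by rewrite mulr_ge0// ltW.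
have t0' : 0 <= 2 ^+ n * t by rewrite mulr_ge0// ltW.
exists (Num.truncn (2 ^+ n * s)); split=> //.
have k1 : (Num.truncn (2 ^+ n * s) <= Num.truncn (2 ^+ n * t))%N.
  by apply: le_truncn; rewrite ler_pM2l.
have k2 : (Num.truncn (2 ^+ n * t) < (Num.truncn (2 ^+ n * s)).+2)%N.
  rewrite ltnNge truncn_ge_nat// -ltNge -natr1.
  have : 2 ^+ n * t <= 2 ^+ n * s + 1.
    have : (t - s) * 2 ^+ n <= 1 by rewrite -ler_pdivlMr// div1r.
    by rewrite mulrBl [t * _]mulrC [s * _]mulrC; lra.
  have /truncn_itv/andP[_ h2] := s0'.
  lra.
have : Num.truncn (2 ^+ n * t) = Num.truncn (2 ^+ n * s) \/
       Num.truncn (2 ^+ n * t) = (Num.truncn (2 ^+ n * s)).+1 by move: k1 k2; clear; lia.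
by rewrite /dyad => -[->|->]; [left|right].
Qed.

Lemma powR2_gt1 (x : R) : 0 < x -> 1 < 2 `^ x.
Proof.
move=> x0; rewrite /powR pnatr_eq0 /= expR_gt1 mulr_gt0// ln_gt0//.
by rewrite ltr1n.
Qed.

(** As gamma < 1/2, the number 2^(-gamma) sqrt 2 exceeds 1, and its powers absorb the factor n +
    1. *)
Lemma delta_geometric gamma : 0 < gamma < 2^-1 ->
  [/\ 0 < 2 `^ (- gamma) :> R, 2 `^ (- gamma) < 1 :> R &
    exists2 C : R, 0 <= C & forall n, delta n <= C * (2 `^ (- gamma)) ^+ n].
Proof.
move=> /andP[g0 g1].
have r0 : 0 < 2 `^ (- gamma) :> R by rewrite powR_gt0.
split=> //.
  by rewrite powRN invf_lt1 ?powR_gt0// powR2_gt1.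
have th1 : 1 < 2 `^ (- gamma) * Num.sqrt 2 :> R.
  rewrite -powR12_sqrt// -powRD ?pnatr_eq0 ?implybT//.
  by apply: powR2_gt1; lra.
have [C C0 HC] := pow_le_exp 1 th1.
exists C => // n; rewrite /delta ler_pdivrMr ?exprn_gt0 ?sqrtr_gt0//.
by rewrite -mulrA -exprMn -[n.+1%:R]expr1.
Qed.

Variables (f : R -> R) (a b : R) (N : nat).
Hypothesis a0 : 0 <= a.
Hypothesis fN : forall n k, (N <= n)%N -> a <= k%:R / 2 ^+ n -> k.+1%:R / 2 ^+ n <= b ->
  `|f (k.+1%:R / 2 ^+ n) - f (k%:R / 2 ^+ n)| <= delta n.

Lemma delta_ge0 n : 0 <= delta n.
Proof. by rewrite /delta divr_ge0 ?exprn_ge0. Qed.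

Section rate.
Variables (C r : R).
Hypotheses (C0 : 0 <= C) (r0 : 0 < r) (r1 : r < 1) (Cr : forall n, delta n <= C * r ^+ n).

(** The margin [(2 ^+ n)^-1] above [a] keeps the approximation of level n, which lies below [t], in
    the range where [fN] applies. *)
Lemma dyad_path_step n t : (N <= n)%N -> a + (2 ^+ n)^-1 <= t -> t <= b ->
  `|f (dyad n.+1 t) - f (dyad n t)| <= C * r ^+ n.
Proof.
move=> Nn at_ tb.
have t0 : 0 <= t by apply: le_trans at_; rewrite addr_ge0 ?invr_ge0 ?(ltW (p2 n)).
have [k [E [->|E']]] := dyad_step n t0.
  by rewrite subrr normr0 mulr_ge0 ?exprn_ge0// ltW.
have /andP[_ h] := dyad_itv n t0; have /andP[h' _] := dyad_itv n.+1 t0.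
rewrite E' E; apply: (@le_trans _ _ (delta n.+1)).
  apply: fN; first exact: leqW.
    by rewrite -E; move: h at_; lra.
  by rewrite -E'; apply: le_trans tb.
apply: le_trans (Cr n.+1) _; rewrite ler_wpM2l// exprS ler_piMl ?exprn_ge0 ?(ltW r0)//; exact: ltW.
Qed.

Lemma dyad_path_tail n p t : (N <= n)%N -> a + (2 ^+ n)^-1 <= t -> t <= b ->
  `|f (dyad (n + p) t) - f (dyad n t)| <= C / (1 - r) * r ^+ n.
Proof.
move=> Nn at_ tb; have r1' : 0 < 1 - r by rewrite subr_gt0.
(* The partial geometric sum is the form of the bound that goes through the induction on [p]. *)
suff H : `|f (dyad (n + p) t) - f (dyad n t)| <= C / (1 - r) * r ^+ n * (1 - r ^+ p).
  apply: le_trans H _; rewrite ler_piMr ?mulr_ge0 ?invr_ge0 ?exprn_ge0 ?(ltW r0) ?(ltW r1')//.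
  by rewrite gerBl exprn_ge0 ?(ltW r0).
elim: p => [|p IH]; first by rewrite addn0 subrr normr0 subrr mulr0.
rewrite addnS.
have -> : f (dyad (n + p).+1 t) - f (dyad n t) =
  (f (dyad (n + p).+1 t) - f (dyad (n + p) t)) + (f (dyad (n + p) t) - f (dyad n t)) by ring.
apply: le_trans (ler_normD _ _) _.
have h : `|f (dyad (n + p).+1 t) - f (dyad (n + p) t)| <= C * r ^+ (n + p).
  apply: dyad_path_step => //; first exact: leq_trans (leq_addr _ _).
  apply: le_trans at_; rewrite lerD2l lef_pV2 ?posrE ?p2// ler_weXn2l ?ler1n//.
  exact: leq_addr.
apply: le_trans (lerD h IH) _.
have -> : C / (1 - r) * r ^+ n * (1 - r ^+ p.+1) = C * r ^+ (n + p) + C / (1 - r) * r ^+ n * (1 - r ^+ p).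
  by rewrite exprD exprS; field; rewrite gt_eqF.
by [].
Qed.

Lemma dyad_path_cvg t : a < t -> t <= b -> cvg (f (dyad n t) @[n --> \oo]).
Proof.
move=> at_ tb; have r1' : 0 < 1 - r by rewrite subr_gt0.
have [M HM] : exists M, (N <= M)%N /\ a + (2 ^+ M)^-1 <= t.
  have ta : 0 < t - a by rewrite subr_gt0.
  have := archi_boundP (ltW (_ : 0 < (t - a)^-1)); rewrite invr_gt0 => /(_ ta).
  set B := Num.bound _ => HB; exists (maxn N B); split; first exact: leq_maxl.
  rewrite addrC -lerBrDr -[t - a]invrK lef_pV2 ?posrE ?p2 ?invr_gt0//.
  apply: ltW; apply: lt_le_trans HB _; apply: (@le_trans _ _ (2 ^+ B)).
    by rewrite -natrX ler_nat ltnW// ltn_expl.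
  by rewrite ler_weXn2l ?ler1n// leq_maxr.
apply/cauchy_cvgP; apply: cauchy_exP => eps eps0.
have [n [Mn Hn]] : exists n, (M <= n)%N /\ C / (1 - r) * r ^+ n < eps.
  have rc : (C / (1 - r) * r ^+ n) @[n --> \oo] --> C / (1 - r) * 0.
    by apply: cvgMl_tmp; apply: cvg_expr; rewrite ger0_norm ?(ltW r0).
  rewrite mulr0 in rc.
  have : \forall n \near \oo, C / (1 - r) * r ^+ n < eps.
    by apply: (cvgr_lt _ rc).
  move=> [n0 _ H]; exists (maxn M n0); split; first exact: leq_maxl.
  by apply: H; rewrite /= leq_maxr.
exists (f (dyad n t)); exists n => // p /= np.
rewrite -ball_normE /ball_ /= distrC -(subnKC np).
have [NM aM] := HM.
apply: le_lt_trans (dyad_path_tail _ _ _ tb) Hn; first exact: leq_trans Mn.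
apply: le_trans aM; rewrite lerD2l lef_pV2 ?posrE ?p2// ler_weXn2l ?ler1n//.
Qed.

Lemma dyad_path_lim n t : (N <= n)%N -> a + (2 ^+ n)^-1 <= t -> t <= b ->
  `|lim (f (dyad n t) @[n --> \oo]) - f (dyad n t)| <= C / (1 - r) * r ^+ n.
Proof.
move=> Nn at_ tb.
have at' : a < t by apply: lt_le_trans at_; rewrite ltrDl invr_gt0.
have cv := dyad_path_cvg at' tb.
apply/ler_addgt0Pr => eps eps0.
have : \forall p \near \oo, `|lim (f (dyad n t) @[n --> \oo]) - f (dyad p t)| < eps.
  by move/cvgrPdist_lt: cv; apply.
move=> [p0 _ H]; have {}H := H (n + p0)%N (leq_addl _ _).
have -> : lim (f (dyad n t) @[n --> \oo]) - f (dyad n t) =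
  (lim (f (dyad n t) @[n --> \oo]) - f (dyad (n + p0) t)) + (f (dyad (n + p0) t) - f (dyad n t)) by ring.
apply: le_trans (ler_normD _ _) _; rewrite addrC; apply: lerD (ltW H).
exact: dyad_path_tail.
Qed.

End rate.

Definition dyad_lim (t : R) : R := lim (f (dyad n t) @[n --> \oo]).

Lemma dyad_lim_hoelder gamma a' : 0 < gamma < 2^-1 -> a < a' ->
  exists2 eta : R, 0 < eta & exists2 C : R, 0 <= C & forall s t,
    a' <= s -> s <= t -> t <= b -> t - s < eta ->
    `|dyad_lim s - dyad_lim t| <= C * `|s - t| `^ gamma.
Proof.
move=> g01 aa'; have [r0 r1 [C C0 HC]] := delta_geometric g01.
set r := 2 `^ (- gamma) in r0 r1 HC.
have r1' : 0 < 1 - r by rewrite subr_gt0.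
have g0 : 0 < gamma by case/andP: g01.
have [M [NM HM]] : exists M, (N <= M)%N /\ a + (2 ^+ M)^-1 <= a'.
  have ta : 0 < a' - a by rewrite subr_gt0.
  have := archi_boundP (ltW (_ : 0 < (a' - a)^-1)); rewrite invr_gt0 => /(_ ta).
  set B := Num.bound _ => HB; exists (maxn N B); split; first exact: leq_maxl.
  rewrite addrC -lerBrDr -[a' - a]invrK lef_pV2 ?posrE ?p2 ?invr_gt0//.
  apply: ltW; apply: lt_le_trans HB _; apply: (@le_trans _ _ (2 ^+ B)).
    by rewrite -natrX ler_nat ltnW// ltn_expl.
  by rewrite ler_weXn2l ?ler1n// leq_maxr.
exists (2 ^+ M)^-1; first by rewrite invr_gt0.
(* Two tails beyond level n and one increment between neighbours at level n. The factor 2^gamma used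
   with it comes from 2^(-n) < 2 (t - s). *)
pose D := C / (1 - r) * 2 + C.
have D0 : 0 <= D by rewrite addr_ge0// mulr_ge0// divr_ge0// ltW.
exists (D * 2 `^ gamma); first by rewrite mulr_ge0// powR_ge0.
move=> s t as_ st tb tsM.
have [->|ts] := eqVneq s t; first by rewrite !subrr normr0 mulr_ge0 ?mulr_ge0 ?powR_ge0.
have ts0 : 0 < t - s by rewrite subr_gt0 lt_neqAle ts.
have ex : exists m, (2 ^+ m)^-1 < t - s.
  have := archi_boundP (ltW (_ : 0 < (t - s)^-1)); rewrite invr_gt0 => /(_ ts0).
  set B := Num.bound _ => HB; exists B.
  rewrite -[t - s]invrK ltf_pV2 ?posrE ?p2 ?invr_gt0//.
  apply: lt_le_trans HB _; by rewrite -natrX ler_nat ltnW// ltn_expl.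
(* With m = n + 1 minimal, 2^(-n-1) < t - s <= 2^(-n), so the approximations of s and t at level n
   coincide or are neighbours. *)
have [m Hm mmin] := ex_minnP ex.
have Mm : (M < m)%N.
  rewrite ltnNge; apply/negP => mM; move: (lt_trans Hm tsM).
  by rewrite ltf_pV2 ?posrE ?p2// ltNge ler_weXn2l ?ler1n.
case: m => [//|n] in Hm mmin Mm *.
have Mn : (M <= n)%N by [].
have Hn : t - s <= (2 ^+ n)^-1.
  by rewrite leNgt; apply/negP => /mmin; rewrite ltnn.
have Nn : (N <= n)%N by apply: leq_trans Mn.
have an : a + (2 ^+ n)^-1 <= a'.
  by apply: le_trans HM; rewrite lerD2l lef_pV2 ?posrE ?p2// ler_weXn2l ?ler1n.
have ls := dyad_path_lim C0 r0 r1 HC Nn (le_trans an as_) (le_trans st tb).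
have lt := dyad_path_lim C0 r0 r1 HC Nn (le_trans an (le_trans as_ st)) tb.
have s0 : 0 <= s by apply: le_trans as_; apply: le_trans an; rewrite addr_ge0// invr_ge0 ltW.
have t0 : 0 <= t by apply: le_trans st.
have mid : `|f (dyad n t) - f (dyad n s)| <= C * r ^+ n.
  have [k [E [->|E']]] := dyad_near s0 st Hn.
    by rewrite subrr normr0 mulr_ge0 ?exprn_ge0// ltW.
  rewrite E' E; apply: le_trans (HC n); apply: fN => //.
    by rewrite -E; have /andP[_] := dyad_itv n s0; move: an as_; lra.
  by rewrite -E'; have /andP[h _] := dyad_itv n t0; apply: le_trans tb.
have rn : r ^+ n <= 2 `^ gamma * `|s - t| `^ gamma.
  rewrite distrC (gtr0_norm ts0) -powRM ?(ltW ts0)//.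
  have -> : r ^+ n = ((2 ^+ n)^-1) `^ gamma.
    rewrite /r -powR_mulrn ?powR_ge0// -(@powR_mulrn _ 2 n)// -powRN -!powRrM.
    by congr (_ `^ _); ring.
  apply: ge0_ler_powR; rewrite ?nnegrE ?invr_ge0 ?(ltW (p2 n)) ?(ltW g0)//.
    by rewrite mulr_ge0// ltW.
  by move: Hm; rewrite exprS invfM => Hm; rewrite mulrC -ler_pdivrMr// mulrC ltW.
rewrite -/(dyad_lim s) in ls; rewrite -/(dyad_lim t) in lt.
apply: (@le_trans _ _ (D * r ^+ n)); last by rewrite -mulrA ler_wpM2l.
have -> : dyad_lim s - dyad_lim t = (dyad_lim s - f (dyad n s)) - (dyad_lim t - f (dyad n t))
   - (f (dyad n t) - f (dyad n s)) by ring.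
apply: le_trans (ler_normB _ _) _; rewrite /D mulrDl; apply: lerD mid.
apply: le_trans (ler_normB _ _) _; rewrite mulrDr mulr1 mulrDl; exact: lerD.
Qed.

End chaining_path.

(** The open interval is exhausted by the intervals from 1/(m+2) to 1 - 1/(m+2). The limit path is
    the same for all [gamma]. *)
Lemma path_locally_hoelder {R : realType} (f : R -> R) :
  (forall m : nat, exists N, forall n k, (N <= n)%N ->
     (m.+2%:R^-1 : R) <= k%:R / 2 ^+ n -> (k.+1%:R / 2 ^+ n : R) <= 1 - m.+2%:R^-1 ->
     `|f (k.+1%:R / 2 ^+ n) - f (k%:R / 2 ^+ n)| <= delta n) ->
  (forall t : R, 0 < t < 1 -> cvg (f (dyad n t) @[n --> \oo])) /\
  forall gamma, 0 < gamma < 2^-1 -> locally_hoelder gamma `]0, 1[ (dyad_lim f).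
Proof.
move=> Hf.
have ainv (x : R) : 0 < x -> exists m : nat, m.+2%:R^-1 < x.
  move=> x0; have := archi_boundP (ltW (_ : 0 < x^-1)); rewrite invr_gt0 => /(_ x0).
  set B := Num.bound _ => HB; exists B.
  rewrite -[ltRHS]invrK ltf_pV2 ?posrE ?invr_gt0//.
  by apply: lt_le_trans HB _; rewrite ler_nat; apply: leqW.
have a0 m : 0 <= m.+2%:R^-1 :> R by rewrite invr_ge0.
split=> [t /andP[t0 t1]|gamma g01 x /=].
  have mn : 0 < Num.min t (1 - t) by rewrite lt_min t0 subr_gt0.
  have [m] := ainv _ mn; rewrite lt_min => /andP[mt m1].
  have [N HN] := Hf m.
  (* For mere convergence any rate below 1/2 is good enough. *)
  have [r0 r1 [C C0 HC]] := @delta_geometric R 4^-1 (ltac:(apply/andP; split; lra)).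
  by apply: (dyad_path_cvg (a0 m) HN C0 r0 r1 HC mt); rewrite lerBrDr -lerBrDl ltW.
rewrite in_itv/= => /andP[x0 x1].
have mn : 0 < Num.min (x / 2) ((1 - x) / 2) by rewrite lt_min !divr_gt0 ?subr_gt0.
have [m] := ainv _ mn; rewrite lt_min => /andP[mx m1].
have [N HN] := Hf m.
have [eta eta0 [C C0 HC]] := dyad_lim_hoelder (a0 m) HN g01 mx.
exists (Num.min (eta / 2) (Num.min (x / 2) ((1 - x) / 2))).
  by rewrite !lt_min !divr_gt0 ?subr_gt0.
exists C => s t _ _; rewrite !lt_min !ltr_norml => /and3P[/andP[s1 s2] /andP[s3 s4] /andP[s5 s6]].
move=> /and3P[/andP[t1 t2] /andP[t3 t4] /andP[t5 t6]].
move: HC m1; set al := m.+2%:R^-1 => HC m1.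
have [st|ts] := leP s t; first by apply: HC; move: m1; lra.
by rewrite distrC (distrC s); apply: HC; move: m1; lra.
Qed.

(** * Gaussian increments *)

Section normal_estimates.
Context {R : realType}.
Local Open Scope ereal_scope.
Local Notation mu := (@lebesgue_measure R).

Lemma normal_peak_le (s : R) : (0 < s)%R -> (normal_peak s <= (2 * s)^-1)%R.
Proof.
move=> s0; rewrite /normal_peak lef_pV2 ?posrE ?mulr_gt0// ?sqrtr_gt0; last first.
  by rewrite mulrn_wgt0// mulr_gt0 ?exprn_gt0 ?pi_gt0.
have -> : (2 * s = Num.sqrt ((2 * s) ^+ 2))%R.
  by rewrite sqrtr_sqr ger0_norm// mulr_ge0// ltW.
rewrite ler_wsqrtr// exprMn.
have := ler_wpM2l (sqr_ge0 s) (@pi_ge2 R); set u := (s ^+ 2)%R; set v := (u * pi)%R.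
by lra.
Qed.

Lemma measurable_norm_gt (l : R) : measurable [set x : R | (l < `|x|)%R].
Proof.
have -> : [set x : R | (l < `|x|)%R] = ~` `[(- l)%R, l].
  apply/seteqP; split=> x /=; rewrite in_itv/= -ler_norml; first by rewrite ltNge => /negP.
  by move/negP; rewrite -ltNge.
exact: measurableC.
Qed.

Lemma normal_prob_itv (s c r : R) : (0 < s)%R -> (0 <= r)%R ->
  normal_prob 0 s `[(c - r)%R, (c + r)%R] <= (r / s)%:E.
Proof.
move=> s0 r0; rewrite /normal_prob.
apply: (@le_trans _ _ (\int[mu]_(x in `[(c - r)%R, (c + r)%R]) (normal_peak s)%:E)).
  apply: ge0_le_integral => //.
  - by move=> x _; rewrite lee_fin normal_pdf_ge0.
  - by apply/measurable_EFinP; apply: measurable_funTS; exact: measurable_normal_pdf.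
  - by move=> x _; rewrite lee_fin normal_pdf_ub// gt_eqF.
rewrite integral_cst//= lebesgue_measure_itv/= lte_fin.
case: ifPn => [_|_]; last by rewrite mule0 lee_fin divr_ge0// ltW.
rewrite -EFinB -EFinM lee_fin.
have -> : (c + r - (c - r) = 2 * r)%R by ring.
apply: (@le_trans _ _ ((2 * s)^-1 * (2 * r))%R).
  by rewrite ler_wpM2r ?normal_peak_le// mulr_ge0.
by rewrite invfM mulrACA mulVf// mul1r mulrC.
Qed.

(** Half of the exponent is bounded by its value at [l]; the other half is, up to a constant, the
    normal density of doubled variance, whose total mass is 1. *)
Lemma normal_prob_tail (s l : R) : (0 < s)%R -> (0 <= l)%R ->
  normal_prob 0 s [set x | (l < `|x|)%R] <= (2 * expR (- (l ^+ 2 / (4 * s ^+ 2))))%:E.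
Proof.
move=> s0 l0; set A := [set x | _].
have sne : s != 0%R by rewrite gt_eqF.
have s20 : (0 < Num.sqrt 2 * s)%R by rewrite mulr_gt0// sqrtr_gt0.
have s2ne : (Num.sqrt 2 * s)%R != 0%R by rewrite gt_eqF.
have mA : measurable A by exact: measurable_norm_gt.
have sq2 : (Num.sqrt 2 ^+ 2 = 2 :> R)%R by rewrite sqr_sqrtr.
pose k := (2 * expR (- (l ^+ 2 / (4 * s ^+ 2))))%R.
have k0 : (0 <= k)%R by rewrite mulr_ge0// expR_ge0.
have bd x : A x -> (normal_pdf 0 s x <= k * normal_pdf 0 (Num.sqrt 2 * s) x)%R.
  move=> Ax; rewrite !normal_pdfE// /normal_fun !subr0.
  have -> : normal_peak (Num.sqrt 2 * s) = (normal_peak s / Num.sqrt 2)%R.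
    rewrite /normal_peak exprMn sq2 -invfM; congr (_^-1)%R.
    by rewrite -mulrA -mulrnAr sqrtrM// mulrC.
  rewrite exprMn sq2.
  have -> : (- x ^+ 2 / (s ^+ 2 *+ 2) = - (x ^+ 2 / (4 * s ^+ 2)) + - x ^+ 2 / (2 * s ^+ 2 *+ 2))%R.
    by field.
  rewrite expRD.
  have h1 : (expR (- (x ^+ 2 / (4 * s ^+ 2))) <= expR (- (l ^+ 2 / (4 * s ^+ 2))))%R.
    rewrite ler_expR lerN2 ler_wpM2r//; first by rewrite invr_ge0 mulr_ge0 ?sqr_ge0.
    by rewrite -[leRHS]real_normK ?num_real// lerXn2r ?nnegrE// ltW.
  have h2 : (1 <= 2 / Num.sqrt 2 :> R)%R.
    rewrite ler_pdivlMr ?sqrtr_gt0// mul1r -[leRHS](ger0_norm (x := 2%R))// -sqrtr_sqr ler_wsqrtr//.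
    by rewrite expr2 ler_peMr// ler1n.
  have p0 := normal_peak_ge0 s.
  set E1 := expR (- (x ^+ 2 / _)) in h1 *; set E2 := expR (- (l ^+ 2 / _)) in k k0 h1 *.
  set E3 := expR (- x ^+ 2 / _); have E30 : (0 <= E3)%R by exact: expR_ge0.
  have -> : (k * (normal_peak s / Num.sqrt 2 * E3) = normal_peak s * (2 / Num.sqrt 2 * (E2 * E3)))%R.
    by rewrite /k; ring.
  rewrite ler_wpM2l//; apply: (@le_trans _ _ (E2 * E3)%R); first by rewrite ler_wpM2r.
  by rewrite ler_peMl// mulr_ge0// expR_ge0.
rewrite /normal_prob.
apply: (@le_trans _ _ (\int[mu]_(x in A) (k%:E * (normal_pdf 0 (Num.sqrt 2 * s) x)%:E))).
  apply: ge0_le_integral => //.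
  - by move=> x _; rewrite lee_fin normal_pdf_ge0.
  - by apply/measurable_EFinP; apply: measurable_funTS; exact: measurable_normal_pdf.
  - apply/measurable_EFinP; apply: measurable_funTS; apply: measurable_funM => //.
    exact: measurable_normal_pdf.
rewrite ge0_integralZl_EFin//; last 2 first.
- by move=> x _; rewrite lee_fin normal_pdf_ge0.
- by apply/measurable_EFinP; apply: measurable_funTS; exact: measurable_normal_pdf.
rewrite -[leRHS]mule1 lee_wpmul2l//.
rewrite -(@integral_normal_pdf R 0 (Num.sqrt 2 * s)).
apply: ge0_subset_integral => //; first by apply/measurable_EFinP; exact: measurable_normal_pdf.
by move=> x _; rewrite lee_fin normal_pdf_ge0.
Qed.

(* The second moment is about an arbitrary c: the density bound shows that an interval
   of length sigma has mass at most 1/2, so sigma ^ 2 <= 8 v whatever c is. *)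
Lemma centered_normal_tail d (T : measurableType d) (P : probability T R) (D : T -> R) (c v l : R) :
  measurable_fun setT D -> centered_normal P D ->
  \int[P]_w (((D w - c) ^+ 2)%R)%:E <= v%:E -> (0 < v)%R -> (0 <= l)%R ->
  P [set w | (l < `|D w|)%R] <= (2 * expR (- (l ^+ 2 / (32 * v))))%:E.
Proof.
move=> mD [s s0 law] Iv v0 l0.
have mA := measurable_norm_gt l.
have -> : [set w | (l < `|D w|)%R] = D @^-1` [set x | (l < `|x|)%R] by [].
rewrite law//; case: ifPn => [/eqP _|sne].
  rewrite diracE (_ : (0%R \in _) = false) ?lee_fin ?mulr_ge0 ?expR_ge0//.
  by apply/negbTE/negP => /set_mem /=; rewrite normr0 ltNge l0.
have {}s0 : (0 < s)%R by rewrite lt_neqAle eq_sym sne.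
apply: le_trans (normal_prob_tail s0 l0) _.
rewrite lee_fin ler_wpM2l// ler_expR lerN2 ler_wpM2l ?sqr_ge0//.
rewrite lef_pV2 ?posrE ?mulr_gt0 ?exprn_gt0//.
suff : (s ^+ 2 <= 8 * v)%R by lra.
have mI : measurable (D @^-1` `[(c - s / 2)%R, (c + s / 2)%R]).
  by rewrite -[X in measurable X]setTI; exact: mD.
have PI : P (D @^-1` `[(c - s / 2)%R, (c + s / 2)%R]) <= (2^-1)%:E.
  rewrite law// (negbTE sne); apply: le_trans (normal_prob_itv _ s0 _) _.
    by rewrite divr_ge0// ltW.
  by rewrite lee_fin mulrAC mulfV// mul1r.
have PC : (2^-1)%:E <= P (~` (D @^-1` `[(c - s / 2)%R, (c + s / 2)%R])).
  rewrite probability_setC// -[P _]fineK ?fin_num_measure// -EFinB lee_fin.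
  have : (fine (P (D @^-1` `[c - s / 2, c + s / 2])) <= 2^-1)%R.
    by rewrite -lee_fin fineK ?fin_num_measure.
  lra.
have : ((s / 2) ^+ 2 / 2)%:E <= v%:E.
  apply: le_trans Iv.
  apply: (@le_trans _ _ (\int[P]_(w in ~` (D @^-1` `[(c - s / 2)%R, (c + s / 2)%R])) ((s / 2) ^+ 2)%:E)).
    rewrite integral_cst//=; last exact: measurableC.
    by rewrite EFinM lee_wpmul2l// lee_fin sqr_ge0.
  apply: (@le_trans _ _ (\int[P]_(w in ~` (D @^-1` `[(c - s / 2)%R, (c + s / 2)%R])) (((D w - c) ^+ 2)%R)%:E)).
    apply: ge0_le_integral => //; first exact: measurableC.
    - by move=> w _; rewrite lee_fin sqr_ge0.
    - apply/measurable_EFinP; apply: measurable_funTS; apply: measurable_funX.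
      exact: measurable_funB.
    move=> w /= /negP; rewrite in_itv/= => H; rewrite lee_fin.
    rewrite -[leRHS]real_normK ?num_real// lerXn2r ?nnegrE ?divr_ge0 ?(ltW s0)//.
    rewrite leNgt; apply/negP => /ltW; rewrite ler_norml => /andP[h1 h2]; move/negP: H; apply.
    by apply/andP; split; lra.
  apply: ge0_subset_integral => //; first exact: measurableC.
    apply/measurable_EFinP; apply: measurable_funX; exact: measurable_funB.
  by move=> w _; rewrite lee_fin sqr_ge0.
rewrite lee_fin => h; have -> : (s ^+ 2 = 8 * ((s / 2) ^+ 2 / 2))%R by field.
by rewrite ler_wpM2l.
Qed.

End normal_estimates.

(** With m = n + 1 and c = 32 K, (m - c)^2 >= 0 gives m^2 / c >= 2 m - c, and expR 2 >= 4. The rate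
    4^(-n) remains summable after multiplication by the 2^n intervals of level n. *)
Lemma gaussian_tail_rate {R : realType} (K : R) (n : nat) : 0 < K ->
  expR (- (delta n ^+ 2 / (32 * (K / 2 ^+ n)))) <= expR (32 * K) / 4 ^+ n.
Proof.
move=> K0; set c := 32 * K; have c0 : 0 < c by rewrite mulr_gt0.
have p2 : 2 ^+ n != 0 :> R by rewrite expf_neq0.
have sq2 : (Num.sqrt 2 ^+ n) ^+ 2 = 2 ^+ n :> R by rewrite exprAC sqr_sqrtr.
have -> : delta n ^+ 2 / (32 * (K / 2 ^+ n)) = n.+1%:R ^+ 2 / c :> R.
  rewrite /delta expr_div_n sq2 /c; field.
  by rewrite p2 gt_eqF.
set m : R := n.+1%:R.
have h : - (m ^+ 2 / c) <= c + - (2 * m).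
  rewrite -subr_ge0; have -> : c + - (2 * m) - - (m ^+ 2 / c) = (m - c) ^+ 2 / c by field; rewrite gt_eqF.
  by rewrite divr_ge0 ?sqr_ge0// ltW.
apply: (@le_trans _ _ (expR (c + - (2 * m)))); first by rewrite ler_expR.
rewrite expRD ler_wpM2l ?expR_ge0// expRN lef_pV2 ?posrE ?expR_gt0 ?exprn_gt0//.
have -> : expR (2 * m) = expR 2 ^+ n.+1 by rewrite /m expRM_natr.
have e4 : 4 <= expR 2 :> R.
  have -> : 2 = 1 + 1 :> R by [].
  have e2 : 2 <= expR 1 :> R by apply: le_trans (expR_ge1Dx 1).
  by rewrite expRD; nra.
apply: (@le_trans _ _ (expR 2 ^+ n)); first by rewrite lerXn2r ?nnegrE ?expR_ge0.
by rewrite exprS ler_peMl ?exprn_ge0 ?expR_ge0// -expR0 ler_expR.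
Qed.

(** * Increments of the Gaussian process *)

Section increments.
Context d (T : measurableType d) (R : realType) (P : probability T R).
Variables (X : R -> {RV P >-> R}) (H : R -> R -> R).
Hypothesis GP : centered_gaussian_process `]0, 1[ X H.
Local Open Scope ereal_scope.

(** The covariance centres its arguments at their means, whence the constant subtracted here;
    [centered_normal_tail] accepts any constant, so the means need not be computed. *)
Lemma increment_variance s t : (0 < s < 1)%R -> (0 < t < 1)%R ->
  \int[P]_w (((X t w - X s w - (fine 'E_P[X t] - fine 'E_P[X s])) ^+ 2)%R)%:E =
  (H s s - 2 * H s t + H t t)%:E.
Proof.
move=> s01 t01; have [_ cov] := GP.
have Ds : `]0%R, 1%R[%classic s by rewrite /= in_itv.
have Dt : `]0%R, 1%R[%classic t by rewrite /= in_itv.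
pose U w := (X s w - fine 'E_P[X s])%R; pose V w := (X t w - fine 'E_P[X t])%R.
have mU : measurable_fun setT U by apply: measurable_funB.
have mV : measurable_fun setT V by apply: measurable_funB.
have EI (W : T -> R) : \int[P]_w (W w)%:E = 'E_P[W] by rewrite unlock.
have UU : \int[P]_w (U w * U w)%:E = (H s s)%:E by rewrite (EI (fun w => U w * U w)%R) -(cov s s Ds Ds) covariance.unlock.
have UV : \int[P]_w (U w * V w)%:E = (H s t)%:E by rewrite (EI (fun w => U w * V w)%R) -(cov s t Ds Dt) covariance.unlock.
have VV : \int[P]_w (V w * V w)%:E = (H t t)%:E by rewrite (EI (fun w => V w * V w)%R) -(cov t t Dt Dt) covariance.unlock.
have sqi (W : T -> R) (r : R) : measurable_fun setT W -> \int[P]_w (W w * W w)%:E = r%:E ->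
    P.-integrable setT (EFin \o (fun w => W w * W w)%R).
  move=> mW IW; apply/integrableP; split; first by apply/measurable_EFinP; exact: measurable_funM.
  under eq_integral do rewrite /= ger0_norm -?expr2 ?sqr_ge0//.
  by rewrite (eq_integral (fun w => (W w * W w)%:E)) ?IW ?ltry// => w _; rewrite expr2.
have iU := sqi _ _ mU UU; have iV := sqi _ _ mV VV.
have iUV : P.-integrable setT (EFin \o (fun w => U w * V w)%R).
  apply: (@le_integrable _ _ _ _ _ _ _ ((EFin \o (fun w => U w * U w)%R) \+ (EFin \o (fun w => V w * V w)%R))) => //.
  - by apply/measurable_EFinP; exact: measurable_funM.
  - move=> w _ /=; rewrite lee_fin.
    have h1 : (0 <= U w * U w + V w * V w)%R by rewrite addr_ge0// -expr2 sqr_ge0.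
    rewrite (ger0_norm h1) ler_norml; apply/andP; split; nra.
  - exact: integrableD.
rewrite (eq_integral (fun w => ((U w * U w)%:E + (V w * V w)%:E) + (- 2)%:E * (U w * V w)%:E)); last first.
  move=> w _; rewrite -EFinM -!EFinD; congr EFin; rewrite /U /V; ring.
rewrite integralD//=; last 2 first.
- exact: integrableD.
- exact: integrableZl.
rewrite integralD//= integralZl//= UU VV UV -EFinM -!EFinD; congr EFin; ring.
Qed.

Hypothesis HC : forall a b : R, (0 < a)%R -> (a <= b)%R -> (b < 1)%R -> exists2 C : R, (0 <= C)%R &
  forall s t, (a <= s)%R -> (s <= t)%R -> (t <= b)%R -> (H s s - 2 * H s t + H t t <= C * (t - s))%R.

Lemma increment_tail a b : (0 < a)%R -> (a <= b)%R -> (b < 1)%R -> exists2 C : R, (0 <= C)%R &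
  forall n s t, (a <= s)%R -> (s <= t)%R -> (t <= b)%R -> (t - s <= (2 ^+ n)^-1)%R ->
    P [set w | (delta n < `|X t w - X s w|)%R] <= (C / 4 ^+ n)%:E.
Proof.
move=> a0 ab b1; have [C C0 hC] := HC a0 ab b1.
(* [C + 1] instead of [C] makes the bound on the variance positive. *)
have K0 : (0 < C + 1)%R by lra.
exists (2 * expR (32 * (C + 1)))%R => [|n s t as_ st tb ts].
  by rewrite mulr_ge0// expR_ge0.
have p2 : (0 < 2 ^+ n :> R)%R by rewrite exprn_gt0.
have s01 : (0 < s < 1)%R by apply/andP; split; lra.
have t01 : (0 < t < 1)%R by apply/andP; split; lra.
have [norm _] := GP.
have cn : centered_normal P (fun w => X t w - X s w)%R.
  have := norm 2%N (fun k => if k == 0%N :> nat then t else s) (fun k => if k == 0%N :> nat then 1%R else (-1)%R) _.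
  have -> : (fun w => \sum_(k < 2) (if k == 0%N :> nat then 1 else -1) * X (if k == 0%N :> nat then t else s) w)%R =
    (fun w => X t w - X s w)%R.
    by apply/funext => w; rewrite !big_ord_recl big_ord0 /= addr0 mul1r mulN1r.
  by apply => k; case: ifP => _; rewrite /= in_itv.
have mD : measurable_fun setT (fun w => X t w - X s w)%R by apply: measurable_funB.
have := @centered_normal_tail R _ _ P _ (fine 'E_P[X t] - fine 'E_P[X s]) ((C + 1) / 2 ^+ n)%R (delta n) mD cn.
rewrite increment_variance//.
have h : (H s s - 2 * H s t + H t t <= (C + 1) / 2 ^+ n)%R.
  apply: le_trans (hC s t as_ st tb) _; apply: ler_pM => //; first by rewrite subr_ge0.
  by rewrite lerDl.
rewrite lee_fin => /(_ h); rewrite divr_gt0// delta_ge0 => /(_ isT isT) /le_trans; apply.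
by rewrite lee_fin -mulrA ler_wpM2l// gaussian_tail_rate.
Qed.

End increments.

(** * Construction of the Hoelder-continuous version *)

Section version.
Context d (T : measurableType d) (R : realType) (P : probability T R).
Local Open Scope ereal_scope.

Lemma borel_cantelli_half (F : nat -> set T) (C : R) : (0 <= C)%R ->
  (forall n, measurable (F n)) -> (forall n, P (F n) <= (C / 2 ^+ n)%:E) ->
  P (lim_sup_set F) = 0.
Proof.
move=> C0 mF FC; apply: lim_sup_set_cvg0 => //.
apply: (@le_lt_trans _ _ (2 * C)%:E); last exact: ltry.
rewrite nneseries_esumT//.
apply: (@le_trans _ _ (\esum_(n in setT) ((2 * C)%:E * (om1 (2^-1) n)%:E))).
  apply: le_esum => n _; apply: le_trans (FC n) _; rewrite -EFinM lee_fin /om1 exprVn.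
  by have -> : (2 * C * ((1 - 2^-1) * (2 ^+ n)^-1) = C / 2 ^+ n)%R by field; rewrite expf_neq0.
rewrite esumZl ?mulr_ge0//; last by move=> n; rewrite lee_fin om1_ge0//; lra.
by rewrite om1_sum ?mule1//; apply/andP; split; lra.
Qed.

Lemma delta_cvg0 : @delta R n @[n --> \oo] --> 0%R.
Proof.
have [r0 r1 [C C0 HC]] := @delta_geometric R (4^-1)%R (ltac:(apply/andP; split; lra)).
apply: (@squeeze_cvgr _ _ _ _ (fun=> 0%R) (fun n => C * (2 `^ (- 4^-1)) ^+ n)%R).
- by near=> n; rewrite delta_ge0 HC.
- exact: cvg_cst.
- rewrite -[X in _ --> X](mulr0 C); apply: cvgMl_tmp; apply: cvg_expr.
  by rewrite ger0_norm ?(ltW r0).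
Unshelve. all: by end_near. Qed.

Variable X : R -> {RV P >-> R}.
Hypothesis tail : forall a b : R, (0 < a)%R -> (a <= b)%R -> (b < 1)%R -> exists2 C : R, (0 <= C)%R &
  forall n s t, (a <= s)%R -> (s <= t)%R -> (t <= b)%R -> (t - s <= (2 ^+ n)^-1)%R ->
    P [set w | (delta n < `|X t w - X s w|)%R] <= (C / 4 ^+ n)%:E.

Let incr (l s t : R) : set T := [set w | (l < `|X t w - X s w|)%R].

Let mincr l s t : measurable (incr l s t).
Proof.
have mD : measurable_fun setT (fun w => X t w - X s w)%R by apply: measurable_funB.
by have := mD measurableT _ (measurable_norm_gt l); rewrite setTI.
Qed.

Let badk (m n k : nat) : set T :=
  if (m.+2%:R^-1 <= k%:R / 2 ^+ n :> R)%R && (k.+1%:R / 2 ^+ n <= 1 - m.+2%:R^-1 :> R)%R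
  then incr (delta n) (k%:R / 2 ^+ n) (k.+1%:R / 2 ^+ n) else set0.

Let bad (m n : nat) : set T := \big[setU/set0]_(k < 2 ^ n) badk m n k.

Let mbad m n : measurable (bad m n).
Proof. by apply: bigsetU_measurable => k _; rewrite /badk; case: ifP. Qed.

Let bad_null m : P (lim_sup_set (bad m)) = 0.
Proof.
have p2 n : (0 < 2 ^+ n :> R)%R by rewrite exprn_gt0.
have m0 : (0 < m.+2%:R^-1 :> R)%R by rewrite invr_gt0.
have m2 : (m.+2%:R^-1 <= 2^-1 :> R)%R by rewrite lef_pV2 ?posrE// ler_nat.
have aux1 (x : R) : (x <= 2^-1 -> x <= 1 - x)%R by lra.
have aux2 (x : R) : (0 < x -> 1 - x < 1)%R by lra.
have [C C0 HC] := tail m0 (aux1 _ m2) (aux2 _ m0).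
apply: (borel_cantelli_half C0 (mbad m)) => n.
apply: le_trans (Boole_inequality P (A := badk m n) _) _; first by move=> k _; rewrite /badk; case: ifP.
apply: (@le_trans _ _ (\sum_(k < 2 ^ n) (C / 4 ^+ n)%:E)).
  apply: lee_sum => k _; rewrite /badk; case: ifPn => [/andP[h1 h2]|_]; last first.
    by rewrite measure0 lee_fin divr_ge0 ?exprn_ge0.
  apply: HC => //; first by rewrite ler_pM2r ?invr_gt0// ler_nat.
  by rewrite -mulrBl -natr1 addrAC subrr add0r mul1r.
rewrite sumEFin lee_fin sumr_const card_ord -(mulr_natr _ (2 ^ n)%N) natrX.
have -> : (4 ^+ n = 2 ^+ n * 2 ^+ n :> R)%R by rewrite -exprMn; congr (_ ^+ _)%R; ring.
by rewrite invfM mulrA mulfVK// gt_eqF.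
Qed.

Let N : set T := \bigcup_m lim_sup_set (bad m).

Let mN : measurable N.
Proof.
apply: bigcup_measurable => m _; apply: bigcap_measurable => // n _.
exact: bigcup_measurable.
Qed.

Let PN : P N = 0.
Proof.
apply/eqP; rewrite eq_le measure_ge0 andbT.
apply: le_trans (@measure_sigma_subadditive _ _ _ P N (fun m => lim_sup_set (bad m)) _ mN (@subset_refl _ N)) _.
  by move=> m; apply: bigcap_measurable => // n _; exact: bigcup_measurable.
by rewrite eseries0// => m _ _; exact: bad_null.
Qed.

Let good_path w : ~ N w -> forall m : nat, exists M, forall n k, (M <= n)%N ->
  ((m.+2%:R^-1 : R) <= k%:R / 2 ^+ n)%R -> ((k.+1%:R / 2 ^+ n : R) <= 1 - m.+2%:R^-1)%R ->
  (`|X (k.+1%:R / 2 ^+ n) w - X (k%:R / 2 ^+ n) w| <= delta n)%R.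
Proof.
move=> Nw m; have : ~ lim_sup_set (bad m) w by move=> H; apply: Nw; exists m.
move=> /existsNP[M /not_implyP[_ H]]; exists M => n k Mn h1 h2.
rewrite leNgt; apply/negP => h; apply: H; exists n => //.
have kn : (k < 2 ^ n)%N.
  rewrite -(ltr_nat R) natrX.
  have : (k.+1%:R / 2 ^+ n < 1 :> R)%R.
    by apply: le_lt_trans h2 _; rewrite ltrBlDr ltrDl invr_gt0.
  rewrite ltr_pdivrMr ?exprn_gt0// mul1r; apply: lt_trans.
  by rewrite ltr_nat.
rewrite /bad (bigD1 (Ordinal kn))//=; left.
by rewrite /badk h1 h2.
Qed.

Lemma hoelder_version : exists Y : R -> {RV P >-> R},
  (forall t, (0 < t < 1)%R -> {ae P, forall w, X t w = Y t w}) /\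
  (forall gamma : R, (0 < gamma < 2^-1)%R ->
     forall w, locally_hoelder gamma `]0%R, 1%R[ (fun t => Y t w)).
Proof.
(* A single null set [N] serves all times and all exponents. Paths are set to 0 on it, so that every
   path of the version is Hoelder-continuous. *)
pose Yf t w := if (0 < t < 1)%R then
  if w \in N then 0%R else dyad_lim (fun u => X u w) t else 0%R.
have path w (Nw : ~ N w) := @path_locally_hoelder R (fun u => X u w) (good_path Nw).
have mY t : measurable_fun setT (Yf t).
  have [t01|nt] := boolP (0 < t < 1)%R; last first.
    have -> : Yf t = cst 0%R by apply/funext => w; rewrite /Yf (negbTE nt).
    exact: measurable_cst.
  apply: (@measurable_fun_cvg _ _ _ _ (fun n w => X (dyad n t) w * \1_(~` N) w)%R).
    by move=> n; apply: measurable_funM => //; apply: measurable_indic; exact: measurableC.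
  move=> w _; rewrite /Yf t01; case: ifPn => [/set_mem Nw|/negP Nw].
    under eq_fun do rewrite indicE memNset ?mulr0//.
    exact: cvg_cst.
  have {}Nw : ~ N w by move=> h; apply: Nw; apply/mem_set.
  under eq_fun do rewrite indicE mem_set ?mulr1//.
  by have [cv _] := path w Nw; exact: cv t t01.
pose Y t : {RV P >-> R} := HB.pack (Yf t) (isMeasurableFun.Build _ _ _ _ (Yf t) (mY t)).
exists Y; split=> [t t01|gamma g01 w].
- have /andP[t0 t1] := t01.
  have [C C0 HC] := tail (a := t / 2) (b := t) (ltac:(lra)) (ltac:(lra)) t1.
  (* From level [n0] on, the dyadic approximations of [t] lie in [t/2, t], where one constant of the
     tail bound is valid. *)
  have [n0 Hn0] : exists n0, forall n, ((2 ^+ (n + n0))^-1 <= t / 2)%R.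
    have := archi_boundP (ltW (_ : (0 < (t / 2)^-1)%R)); rewrite invr_gt0 divr_gt0// => /(_ isT).
    set B := Num.bound _ => HB; exists B => n.
    rewrite -[leRHS]invrK lef_pV2 ?posrE ?exprn_gt0 ?invr_gt0 ?divr_gt0//.
    apply: ltW; apply: lt_le_trans HB _; rewrite -natrX ler_nat ltnW//.
    exact: leq_ltn_trans (leq_addl n B) (ltn_expl _ _).
  (* Outside the limsup of these events, X at the dyadic approximations of [t] converges to X at
     [t]; outside [N] it converges to the version. Both exceptional sets are null. *)
  pose F n := incr (delta (n + n0)) (dyad (n + n0) t) t.
  have PF : P (lim_sup_set F) = 0.
    apply: (borel_cantelli_half C0) => [n|n]; first exact: mincr.
    have /andP[h1 h2] := dyad_itv (n + n0) (ltW t0); have := Hn0 n => h3.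
    apply: le_trans (HC _ _ _ _ _ _ _) _ => //; [by move: h2 h3; lra|by move: h2; lra|].
    rewrite lee_fin ler_wpM2l// lef_pV2 ?posrE ?exprn_gt0//.
    apply: (@le_trans _ _ (2 ^+ (n + n0))%R); first by rewrite ler_weXn2l ?ler1n// leq_addr.
    by rewrite lerXn2r ?nnegrE// ler_nat.
  exists (N `|` lim_sup_set F); split.
  + apply: measurableU => //; apply: bigcap_measurable => // n _.
    by apply: bigcup_measurable => j _; exact: mincr.
  + apply/eqP; rewrite eq_le measure_ge0 andbT.
    have -> : 0 = P N + P (lim_sup_set F) by rewrite PN PF adde0.
    apply: measureU2 => //; apply: bigcap_measurable => // n _.
    by apply: bigcup_measurable => j _; exact: mincr.
  move=> w /= XY; apply: contrapT => /not_orP[Nw Fw]; apply: XY.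
  rewrite /Yf t01 memNset//.
  have [cv _] := path w Nw; have {}cv := cv t t01.
  move: Fw => /existsNP[M /not_implyP[_ HM]].
  apply/esym/cvg_lim => //; apply/cvgrPdist_lt => eps eps0.
  have : \forall n \near \oo, (delta n < eps :> R)%R by exact: (cvgr_lt _ delta_cvg0).
  move=> [M' _ HM']; exists (maxn (M + n0) M') => // n /=; rewrite geq_max => /andP[Mn M'n].
  apply: le_lt_trans (HM' n M'n); rewrite leNgt; apply/negP => h; apply: HM.
  exists (n - n0)%N; first by rewrite /= leq_subRL ?(leq_trans (leq_addl _ _) Mn)// addnC.
  by rewrite /F /= subnK// (leq_trans (leq_addl _ _) Mn).
move=> x x01 /=.
have [Nw|Nw] := pselect (N w).
  exists 1%R => //; exists 0%R => s t; rewrite /= !in_itv/= /Yf => -> -> _ _.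
  by rewrite mem_set// subrr normr0 mul0r.
have [_ hol] := path w Nw.
have [eta eta0 [C HC]] := hol gamma g01 x x01.
exists eta => //; exists C => s t Ds Dt hs ht; have := HC s t Ds Dt hs ht.
by move: Ds Dt; rewrite /= !in_itv/= /Yf => -> ->; rewrite memNset.
Qed.

End version.

Theorem proposition2p8 (R : realType) (p : finperm) (e : R -> R) (H : R -> R -> R)
    (p_nonempty : (0 < psize p)%N)
    (eP : forall t, 0 <= t < 1 -> is_e p t (e t))
    (HP : forall s t, 0 <= s < 1 -> 0 <= t < 1 -> is_H p e s t (H s t)) :
  (forall gamma : R, 0 < gamma < 1 -> locally_hoelder gamma `[0, 1[ e) /\
  (forall (d : measure_display) (T : measurableType d) (P : probability T R)
          (X : R -> {RV P >-> R}),
     centered_gaussian_process `]0, 1[ X H ->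
     exists Y : R -> {RV P >-> R},
       (forall t, 0 < t < 1 -> {ae P, forall w, X t w = Y t w}) /\
       (forall gamma : R, 0 < gamma < 2^-1 ->
          forall w, locally_hoelder gamma `]0, 1[ (fun t => Y t w))).
Proof.
have bsP b : b \in blocks p -> is_block b := @block_blocks p b.
have n0 := size_blocks_gt0 p_nonempty.
split=> [gamma g01|d T P X GP]; first exact: (e_hoelder bsP eP).
apply: hoelder_version; apply: increment_tail GP _.
exact: increment_bound bsP n0 eP HP.
Qed.
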